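(* Consider the distributed bilevel problem, the network, the FAB iteration and the notion of admissible parameters described in the context. Fix initial points $(x_i^0,y_i^0,z_i^0)_{i=1}^n$ and constants $0<c_1\le c_2$. Then there is a constant $C>0$, independent of $K$ (it may depend on the problem data, the network and matrix sequences, the initial points and $c_1,c_2$), such that the following holds. For every integer $K\ge 2$ and every choice of step sizes $\eta_x^k\equiv\eta_x$, $\eta_y^k\equiv\eta_y$, $\eta_z^k\equiv\eta_z$ (constant in $k$) and penalty parameter $\lambda$ that is admissible and satisfies $$c_1K^{-1/3}\le \eta_x,\eta_y,\eta_z\le c_2K^{-1/3},\qquad c_1K^{1/3}\le\lambda\le c_2K^{1/3},$$ the sequence generated by FAB satisfies $$\min_{0\le k<K-1}\big\|\nabla\mathcal F^*(\bar x^k)\big\|^2\le C\,(ab)^{-n}K^{-2/3},\qquad \bar x^k:=\frac1n\sum_{i=1}^n x_i^k .$$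
   Context: **Problem.** $n\ge2$ agents; $f_i,g_i:\mathbb R^{d_x}\times\mathbb R^{d_y}\to\mathbb R$, $i\in[n]=\{1,\dots,n\}$; $F=\frac1n\sum_i f_i$, $G=\frac1n\sum_i g_i$; $y^*(x)=\arg\min_y G(x,y)$; $\mathcal F^*(x)=F(x,y^*(x))$. Each $f_i$ is bounded below. Smoothness assumptions, for each $i$: $f_i$ is $L_{f,0}$-Lipschitz in $y$, has $L_{f,1}$-Lipschitz gradient and $L_{f,2}$-Lipschitz Hessian; $g_i$ is $\mu$-strongly convex in $y$ ($\mu>0$), has $L_{g,1}$-Lipschitz gradient and $L_{g,2}$-Lipschitz Hessian. **Network.** For each $k\ge0$, $\mathcal G^k=([n],\mathcal E^k)$ is a strongly connected directed graph with in/out-neighbor sets $\mathcal N^k_{i,\rm in},\mathcal N^k_{i,\rm out}$. $A^k=[a^k_{ij}]$ is nonnegative row-stochastic with $a^k_{ij}>0$ iff $j\in\mathcal N^k_{i,\rm in}\cup\{i\}$; $B^k=[b^k_{ij}]$ is nonnegative column-stochastic with $b^k_{ji}>0$ iff $j\in\mathcal N^k_{i,\rm out}\cup\{i\}$. There are $a,b>0$ such that all nonzero entries satisfy $a^k_{ij}\ge a$, $b^k_{ij}\ge b$ for all $k$. **FAB.** Let $\mathcal L_i(x,y,z)=f_i(x,y)+\lambda(g_i(x,y)-g_i(x,z))$ and $d_{x,i}^k=\nabla_x\mathcal L_i$, $d_{y,i}^k=\nabla_y\mathcal L_i$, $d_{z,i}^k=-\nabla_z\mathcal L_i$, evaluated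 at $(x_i^k,y_i^k,z_i^k)$. Initialize $t_{\xi,i}^0=d_{\xi,i}^0$ for $\xi\in\{x,y,z\}$. For $k=0,\dots,K-1$, all $i$ and $\xi\in\{x,y,z\}$: $$\xi_i^{k+1}=\sum_j a^k_{ij}\xi_j^k-\eta_\xi^k t_{\xi,i}^k,\qquad t_{\xi,i}^{k+1}=\sum_j b^k_{ij}t_{\xi,j}^k+d_{\xi,i}^{k+1}-d_{\xi,i}^k .$$ **Network constants.** For a vector $v$, $\min(v),\max(v)$ denote its smallest/largest entry. $\{\alpha_k\}_{k\ge0}$ and $\{\beta_k\}_{k\ge0}$ are sequences of stochastic vectors (nonnegative entries with sum 1) with $\alpha_{k+1}^\top A^k=\alpha_k^\top$, $\beta_{k+1}=B^k\beta_k$, and, for all $k,i$, $$\tfrac{\underline\alpha}{n}\le[\alpha_k]_i\le\tfrac{\overline\alpha}{n}\le1,\quad \tfrac{\underline\beta}{n}\le[\beta_k]_i\le\tfrac{\overline\beta}{n}\le1,\qquad \underline\alpha:=a^n,\ \underline\beta:=b^n .$$ (Such sequences exist.) For a strongly connected digraph $\mathcal G$, $\mathrm D(\mathcal G)$ is its diameter. A shortest-path covering $\mathcal P$ of $\mathcal G$ is a choice, for each ordered pair of distinct nodes, of one shortest directed path from the first to the second; $K(\mathcal P)$ is the maximum over edges of the number of paths in $\mathcal P$ containing that edge; $\mathrm K(\mathcal G)$ is the maximum of $K(\mathcal P)$ over all such coverings. Set $$c_k=\frac{\min(\alpha_{k+1})a^2}{\max^2(\alpha_k)\mathrm D(\mathcal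 G^k)\mathrm K(\mathcal G^k)},\qquad e_k=\frac{\min^2(\beta_k)b^2}{\max^2(\beta_k)\max(\beta_{k+1})\mathrm D(\mathcal G^k)\mathrm K(\mathcal G^k)},$$ $\underline c=\inf_kc_k$, $\underline e=\inf_ke_k$, $\underline q=\inf_k\min\{n\min(\beta_k)\mu,\ n\min(\beta_k)L_{g,1}\}$, $\gamma=\sup_k\big(n+\tfrac1{\min(\beta_{k+1})}\big)$, $$\mathcal C_{b,1}=\frac{4L_{g,1}^2n^2\overline\alpha^2\overline\beta}{\underline q\,\underline\alpha\,\underline\beta^2},\quad \mathcal C_{b,2}=\frac{13L_{g,1}^2n^2\overline\alpha^2\overline\beta}{\underline q\,\underline\alpha\,\underline\beta^2},\quad \mathcal C_{b,3}=\frac{672\gamma L_{g,1}^2}{n\underline e},\quad \mathcal C_{aux}=\frac{2\mathcal C_{b,3}\overline\alpha\overline\beta}{\underline c}+\frac{168\gamma L_{g,1}^2}{\underline e},$$ $$L_{*,1}=\Big(L_{f,1}+\tfrac{4L_{f,1}L_{g,1}}{\mu}+\tfrac{L_{f,0}L_{g,2}}{\mu}+\tfrac{L_{f,0}L_{g,1}L_{g,2}}{\mu^2}+L_{g,1}\Big)\Big(\tfrac1\mu+\tfrac{2L_{g,1}}{\mu^2}\Big)\Big(L_{f,1}+\tfrac{L_{f,0}L_{g,2}}{\mu}\Big),$$ $$L_{*,2}=\frac{\Big(2L_{f,1}+\frac{L_{f,1}L_{g,1}}{\mu}+L_{f,0}\big(\frac{2L_{g,2}}{\mu}+\frac{L_{g,2}L_{g,1}}{\mu^2}\big)\Big)L_{g,1}}{\mu}+L_{f,1}+L_{f,0}\Big(\frac{L_{g,2}L_{f,0}}{\mu}+\frac{L_{g,2}L_{f,0}^2}{\mu^2}\Big).$$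 **Admissible parameters.** Positive $(\eta_x,\eta_y,\eta_z,\lambda)$ are admissible if, with $\eta_{\max}=\max\{\eta_x,\eta_y,\eta_z\}$: (1) $\frac1\lambda\le\min\{1,\frac{L_{g,1}}{L_{f,1}},\frac{\mu}{2L_{f,1}},\frac{4n\underline c\,\mathcal C_{b,3}}{5L_{*,2}^2}\}$; (2) $\eta_{\max}\le\min\{1,\frac{(\overline\alpha\overline\beta)^2}{16n^2\mathcal C_{aux}},\frac1{8n^2\mathcal C_{aux}},\frac1{4\overline\alpha\overline\beta L_{*,1}}\}$; (3) $\lambda\eta_{\max}\le\min\{\frac1{\underline q},\frac{\overline\alpha^2\overline\beta}{12\underline\alpha\underline\beta\mathcal C_{aux}},\frac{\underline\alpha^2\underline\beta\,\underline c\,\mathcal C_{b,3}}{90nL_{g,1}^2},\frac{\underline\alpha\underline\beta\,\underline c\,\underline q\,\mathcal C_{b,3}}{120n\mathcal C_{b,1}L_{g,1}^2},\frac{\underline\alpha\underline\beta\,\underline c\,\underline q\,\mathcal C_{b,3}}{320n\mathcal C_{b,2}L_{g,1}^2},\frac{\underline\alpha\underline\beta\,\underline e}{15},\frac{\underline q\,\underline\beta\,\underline e}{20\mathcal C_{b,2}},\frac{\underline\alpha\underline\beta}{16n^2\mathcal C_{aux}}\}$; (4) with $r_y=\frac{\mu}{L_{g,1}}\sqrt{\frac{\underline q}{432\underline\alpha\mathcal C_{b,2}}}$ and $r_z=\frac{\mu}{L_{g,1}}\sqrt{\frac{\underline q}{12\underline\alpha\mathcal C_{b,1}}}$: $\frac{\eta_x}{\eta_y}\le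 r_y$, $\frac{\lambda\eta_x^2}{\eta_y}\le\frac{\overline\alpha^2\overline\beta}{24\underline\alpha\underline\beta\mathcal C_{aux}}r_y^3$, $\frac{\eta_x}{\eta_z}\le r_z$, $\frac{\lambda\eta_x^2}{\eta_z}\le\frac{\overline\alpha^2\overline\beta}{6\underline\alpha\underline\beta\mathcal C_{aux}}r_z^3$. *)

(* Defs.v *)
From HB Require Import structures.
From mathcomp Require Import all_boot all_order all_algebra.
From mathcomp Require Import all_classical all_reals all_analysis.

Set Implicit Arguments.
Unset Strict Implicit.
Unset Printing Implicit Defensive.

Import Order.TTheory GRing.Theory Num.Theory.
Import numFieldNormedType.Exports.

Local Open Scope classical_set_scope.
Local Open Scope ring_scope.

(* The library norm on 'rV is the sup norm; differentiability does not depend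
   on this choice, but Lipschitz and strong convexity constants do. *)

Definition enorm (R : realType) (d : nat) (v : 'rV[R]_d) : R :=
  Num.sqrt (\sum_i v 0 i ^+ 2).

Definition opnorm (R : realType) (d m : nat) (M : 'M[R]_(d, m)) : R :=
  sup [set enorm (v *m M) | v in [set v | enorm v <= 1]].

Definition grad (R : realType) (d : nat) (h : 'rV[R]_d -> R) (x : 'rV[R]_d) :
    'rV[R]_d :=
  \row_i 'D_(delta_mx 0 i) h x.

Definition lipschitz_gradient (R : realType) (d : nat) (L : R)
    (h : 'rV[R]_d -> R) : Prop :=
  (forall u, differentiable h u) /\
  (forall u v, enorm (grad h u - grad h v) <= L * enorm (u - v)).

Definition lipschitz_hessian (R : realType) (d : nat) (L : R)
    (h : 'rV[R]_d -> R) : Prop :=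
  (forall u, differentiable (grad h) u) /\
  (forall u v, opnorm ('J (grad h) u - 'J (grad h) v) <= L * enorm (u - v)).

Definition strongly_convex (R : realType) (d : nat) (mu : R)
    (h : 'rV[R]_d -> R) : Prop :=
  forall (u v : 'rV[R]_d) (t : R), 0 <= t <= 1 ->
    h (t *: u + (1 - t) *: v) <=
      t * h u + (1 - t) * h v - mu / 2 * t * (1 - t) * enorm (u - v) ^+ 2.

Definition argmin (R : realType) (d : nat) (h : 'rV[R]_d -> R) : 'rV[R]_d :=
  get [set y | forall y', h y <= h y'].

Definition joint (R : realType) (dx dy : nat)
    (h : 'rV[R]_dx -> 'rV[R]_dy -> R) (w : 'rV[R]_(dx + dy)) : R :=
  h (lsubmx w) (rsubmx w).

(* Entries are compared through inf and sup over the (finite) range, which are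
   attained as soon as n > 0. *)
Definition minentry (R : realType) (n : nat) (v : 'cV[R]_n) : R :=
  inf (range (fun i => v i 0)).

Definition maxentry (R : realType) (n : nat) (v : 'cV[R]_n) : R :=
  sup (range (fun i => v i 0)).

(* A digraph on 'I_n is a relation e, with an edge from i to j when [e i j]. *)

(* [p] lists the vertices visited after [x], as in [path]. *)
Definition dipath (n : nat) (e : rel 'I_n) (x y : 'I_n) (p : seq 'I_n) : bool :=
  path e x p && (last x p == y).

(* The least length of a path from [x] to [y]; such a length is below n
   whenever [y] is reachable from [x] (the value is n otherwise). *)
Definition distance (n : nat) (e : rel 'I_n) (x y : 'I_n) : nat :=
  find (fun m => [exists p : m.-tuple 'I_n, dipath e x y p]) (iota 0 n).

Definition diameter (n : nat) (e : rel 'I_n) : nat :=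
  \max_(u : 'I_n * 'I_n) distance e u.1 u.2.

(* Shortest paths have length less than n, so coverings live in a finite type;
   the values at pairs (i, i) are irrelevant. *)
Definition path_family (n : nat) : finType :=
  {ffun 'I_n * 'I_n -> n.-bseq 'I_n}.

Definition shortest_path_covering (n : nat) (e : rel 'I_n)
    (P : path_family n) : bool :=
  [forall u : 'I_n * 'I_n, (u.1 != u.2) ==>
     dipath e u.1 u.2 (P u) && (size (P u) == distance e u.1 u.2)].

Definition path_edges (n : nat) (x : 'I_n) (p : seq 'I_n) : seq ('I_n * 'I_n) :=
  zip (x :: p) p.

Definition covering_utility (n : nat) (e : rel 'I_n) (P : path_family n) : nat :=
  \max_(ed : 'I_n * 'I_n | e ed.1 ed.2)
     #|[pred u : 'I_n * 'I_n | (u.1 != u.2) && (ed \in path_edges u.1 (P u))]|.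

Definition max_utility (n : nat) (e : rel 'I_n) : nat :=
  \max_(P : path_family n | shortest_path_covering e P) covering_utility e P.

Record problem (R : realType) (n dx dy : nat) := Problem {
  fobj : 'I_n -> 'rV[R]_dx -> 'rV[R]_dy -> R;
  gobj : 'I_n -> 'rV[R]_dx -> 'rV[R]_dy -> R;
  Lf0 : R;
  Lf1 : R;
  Lf2 : R;
  mu : R;
  Lg1 : R;
  Lg2 : R
}.

Section Problem.
Context (R : realType) (n dx dy : nat) (P : problem R n dx dy).

(* No sign is assumed for the Lipschitz constants: for dx, dy > 0 these
   conditions force Lg1 >= mu and the other ones to be nonnegative. *)
Record problem_assumptions : Prop := ProblemAssumptions {
  f_bounded_below : forall i, exists m : R, forall x y, m <= fobj P i x y;
  f_lipschitz_y : forall i x y y',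
    `|fobj P i x y - fobj P i x y'| <= Lf0 P * enorm (y - y');
  f_lipschitz_gradient : forall i, lipschitz_gradient (Lf1 P) (joint (fobj P i));
  f_lipschitz_hessian : forall i, lipschitz_hessian (Lf2 P) (joint (fobj P i));
  mu_gt0 : 0 < mu P;
  g_strongly_convex : forall i x, strongly_convex (mu P) (gobj P i x);
  g_lipschitz_gradient : forall i, lipschitz_gradient (Lg1 P) (joint (gobj P i));
  g_lipschitz_hessian : forall i, lipschitz_hessian (Lg2 P) (joint (gobj P i))
}.

Definition Fobj (x : 'rV[R]_dx) (y : 'rV[R]_dy) : R :=
  n%:R^-1 * \sum_i fobj P i x y.

Definition Gobj (x : 'rV[R]_dx) (y : 'rV[R]_dy) : R :=
  n%:R^-1 * \sum_i gobj P i x y.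

Definition ystar (x : 'rV[R]_dx) : 'rV[R]_dy := argmin (Gobj x).

Definition Fstar (x : 'rV[R]_dx) : R := Fobj x (ystar x).

Definition penalized (lambda : R) (i : 'I_n) (x : 'rV[R]_dx)
    (y z : 'rV[R]_dy) : R :=
  fobj P i x y + lambda * (gobj P i x y - gobj P i x z).

Definition dirx (lambda : R) (i : 'I_n) x y z : 'rV[R]_dx :=
  grad (fun u => penalized lambda i u y z) x.

Definition diry (lambda : R) (i : 'I_n) x y z : 'rV[R]_dy :=
  grad (fun u => penalized lambda i x u z) y.

Definition dirz (lambda : R) (i : 'I_n) x y z : 'rV[R]_dy :=
  - grad (fun u => penalized lambda i x y u) z.

End Problem.

Record network (R : realType) (n : nat) := Network {
  edge : nat -> rel 'I_n;
  Amx : nat -> 'M[R]_n;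
  Bmx : nat -> 'M[R]_n;
  a_lb : R;
  b_lb : R;
  alpha : nat -> 'cV[R]_n;
  beta : nat -> 'cV[R]_n;
  alpha_up : R;
  beta_up : R
}.

Definition alpha_lo (R : realType) (n : nat) (N : network R n) : R :=
  a_lb N ^+ n.

Definition beta_lo (R : realType) (n : nat) (N : network R n) : R :=
  b_lb N ^+ n.

Definition stochastic (R : realType) (n : nat) (v : 'cV[R]_n) : Prop :=
  (forall i, 0 <= v i 0) /\ \sum_i v i 0 = 1.

Record network_assumptions (R : realType) (n : nat) (N : network R n) : Prop :=
  NetworkAssumptions {
  strongly_connected : forall k i j, connect (edge N k) i j;
  A_ge0 : forall k i j, 0 <= Amx N k i j;
  A_row_stochastic : forall k i, \sum_j Amx N k i j = 1;
  A_pattern : forall k i j, (0 < Amx N k i j) = edge N k j i || (j == i);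
  B_ge0 : forall k i j, 0 <= Bmx N k i j;
  B_column_stochastic : forall k j, \sum_i Bmx N k i j = 1;
  B_pattern : forall k i j, (0 < Bmx N k j i) = edge N k i j || (j == i);
  a_lb_gt0 : 0 < a_lb N;
  b_lb_gt0 : 0 < b_lb N;
  A_lb : forall k i j, Amx N k i j != 0 -> a_lb N <= Amx N k i j;
  B_lb : forall k i j, Bmx N k i j != 0 -> b_lb N <= Bmx N k i j;
  alpha_stochastic : forall k, stochastic (alpha N k);
  beta_stochastic : forall k, stochastic (beta N k);
  alpha_rec : forall k, (alpha N k.+1)^T *m Amx N k = (alpha N k)^T;
  beta_rec : forall k, beta N k.+1 = Bmx N k *m beta N k;
  alpha_bounds : forall k i,
    alpha_lo N / n%:R <= alpha N k i 0 <= alpha_up N / n%:R;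
  alpha_up_le : alpha_up N / n%:R <= 1;
  beta_bounds : forall k i,
    beta_lo N / n%:R <= beta N k i 0 <= beta_up N / n%:R;
  beta_up_le : beta_up N / n%:R <= 1
}.

Definition tracking (R : realType) (n d : nat) (N : network R n) (K : nat)
    (eta : nat -> R) (xi t dir : nat -> 'I_n -> 'rV[R]_d) : Prop :=
  (forall i, t 0%N i = dir 0%N i) /\
  (forall k i, (k < K)%N ->
     xi k.+1 i = \sum_j Amx N k i j *: xi k j - eta k *: t k i /\
     t k.+1 i = \sum_j Bmx N k i j *: t k j + dir k.+1 i - dir k i).

Definition FAB (R : realType) (n dx dy : nat) (P : problem R n dx dy)
    (N : network R n) (K : nat) (lambda : R) (etax etay etaz : nat -> R)
    (x : nat -> 'I_n -> 'rV[R]_dx) (y z : nat -> 'I_n -> 'rV[R]_dy)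
    (tx : nat -> 'I_n -> 'rV[R]_dx) (ty tz : nat -> 'I_n -> 'rV[R]_dy) : Prop :=
  [/\ tracking N K etax x tx (fun k i => dirx P lambda i (x k i) (y k i) (z k i)),
      tracking N K etay y ty (fun k i => diry P lambda i (x k i) (y k i) (z k i)) &
      tracking N K etaz z tz (fun k i => dirz P lambda i (x k i) (y k i) (z k i))].

Definition average (R : realType) (n d : nat) (v : 'I_n -> 'rV[R]_d) : 'rV[R]_d :=
  n%:R^-1 *: \sum_i v i.

Section Constants.
Context (R : realType) (n dx dy : nat) (P : problem R n dx dy) (N : network R n).

Definition c_seq (k : nat) : R :=
  minentry (alpha N k.+1) * a_lb N ^+ 2 /
  (maxentry (alpha N k) ^+ 2 *
   (diameter (edge N k))%:R * (max_utility (edge N k))%:R).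

Definition e_seq (k : nat) : R :=
  minentry (beta N k) ^+ 2 * b_lb N ^+ 2 /
  (maxentry (beta N k) ^+ 2 * maxentry (beta N k.+1) *
   (diameter (edge N k))%:R * (max_utility (edge N k))%:R).

Definition c_inf : R := inf (range c_seq).

Definition e_inf : R := inf (range e_seq).

Definition q_inf : R :=
  inf (range (fun k => Num.min (n%:R * minentry (beta N k) * mu P)
                               (n%:R * minentry (beta N k) * Lg1 P))).

Definition gamma_sup : R :=
  sup (range (fun k => n%:R + (minentry (beta N k.+1))^-1)).

Definition Cb1 : R :=
  4 * Lg1 P ^+ 2 * n%:R ^+ 2 * alpha_up N ^+ 2 * beta_up N /
  (q_inf * alpha_lo N * beta_lo N ^+ 2).

Definition Cb2 : R :=
  13 * Lg1 P ^+ 2 * n%:R ^+ 2 * alpha_up N ^+ 2 * beta_up N /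
  (q_inf * alpha_lo N * beta_lo N ^+ 2).

Definition Cb3 : R := 672 * gamma_sup * Lg1 P ^+ 2 / (n%:R * e_inf).

Definition Caux : R :=
  2 * Cb3 * alpha_up N * beta_up N / c_inf
  + 168 * gamma_sup * Lg1 P ^+ 2 / e_inf.

Definition Lstar1 : R :=
  (Lf1 P + 4 * Lf1 P * Lg1 P / mu P + Lf0 P * Lg2 P / mu P
   + Lf0 P * Lg1 P * Lg2 P / mu P ^+ 2 + Lg1 P)
  * ((mu P)^-1 + 2 * Lg1 P / mu P ^+ 2)
  * (Lf1 P + Lf0 P * Lg2 P / mu P).

Definition Lstar2 : R :=
  (2 * Lf1 P + Lf1 P * Lg1 P / mu P
   + Lf0 P * (2 * Lg2 P / mu P + Lg2 P * Lg1 P / mu P ^+ 2)) * Lg1 P / mu P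
  + Lf1 P
  + Lf0 P * (Lg2 P * Lf0 P / mu P + Lg2 P * Lf0 P ^+ 2 / mu P ^+ 2).

Definition ry : R :=
  mu P / Lg1 P * Num.sqrt (q_inf / (432 * alpha_lo N * Cb2)).

Definition rz : R :=
  mu P / Lg1 P * Num.sqrt (q_inf / (12 * alpha_lo N * Cb1)).

(* The lists are the arguments of minima: [all (fun b => v <= b) s] says that
   v is at most the minimum of s. When Lf1, Lstar1 or Lstar2 vanishes, a bound
   with that denominator must read +oo; hence the quotients in \bar R, where
   0^-1 = +oo. *)
Record admissible (etax etay etaz lambda : R) : Prop := Admissible {
  steps_gt0 : [/\ 0 < etax, 0 < etay, 0 < etaz & 0 < lambda];
  lambda_bound :
    all (fun b : \bar R => (lambda^-1)%:E <= b)%E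
      [:: 1%E;
          ((Lg1 P)%:E / (Lf1 P)%:E)%E;
          ((mu P)%:E / (2 * Lf1 P)%:E)%E;
          ((4 * n%:R * c_inf * Cb3)%:E / (5 * Lstar2 ^+ 2)%:E)%E];
  eta_bound :
    all (fun b : \bar R => (Num.max etax (Num.max etay etaz))%:E <= b)%E
      [:: 1%E;
          ((alpha_up N * beta_up N) ^+ 2 / (16 * n%:R ^+ 2 * Caux))%:E;
          (1 / (8 * n%:R ^+ 2 * Caux))%:E;
          (1%:E / (4 * alpha_up N * beta_up N * Lstar1)%:E)%E];
  lambda_eta_bound :
    all (fun b : R => lambda * Num.max etax (Num.max etay etaz) <= b)
      [:: 1 / q_inf;
          alpha_up N ^+ 2 * beta_up N / (12 * alpha_lo N * beta_lo N * Caux);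
          alpha_lo N ^+ 2 * beta_lo N * c_inf * Cb3 / (90 * n%:R * Lg1 P ^+ 2);
          alpha_lo N * beta_lo N * c_inf * q_inf * Cb3
            / (120 * n%:R * Cb1 * Lg1 P ^+ 2);
          alpha_lo N * beta_lo N * c_inf * q_inf * Cb3
            / (320 * n%:R * Cb2 * Lg1 P ^+ 2);
          alpha_lo N * beta_lo N * e_inf / 15;
          q_inf * beta_lo N * e_inf / (20 * Cb2);
          alpha_lo N * beta_lo N / (16 * n%:R ^+ 2 * Caux)];
  ratio_y : etax / etay <= ry;
  ratio_y2 : lambda * etax ^+ 2 / etay <=
    alpha_up N ^+ 2 * beta_up N / (24 * alpha_lo N * beta_lo N * Caux) * ry ^+ 3;
  ratio_z : etax / etaz <= rz;
  ratio_z2 : lambda * etax ^+ 2 / etaz <=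
    alpha_up N ^+ 2 * beta_up N / (6 * alpha_lo N * beta_lo N * Caux) * rz ^+ 3
}.

End Constants.

(* Main.v *)
Require Import Defs.
From HB Require Import structures.
From mathcomp Require Import all_boot all_order all_algebra.
From mathcomp Require Import all_classical all_reals all_analysis.
From mathcomp Require Import ring lra.

(* Put delta = 1 / lambda and rescale the trackers by delta, so that the step
   sizes lambda eta are bounded above and below. Then y follows the minimizer
   y_delta(x) of delta F(x, .) + G(x, .), z follows y*(x), and the total x-direction
   at these points is n delta grad F*(x) up to O(delta^2), since the penalized
   objective differs from F* by O(delta) in its gradient.

   Averages weighted by alpha_k are unaffected by the mixing A^k, and t_i / beta_i
   undergoes a row-stochastic averaging. A Poincare inequality along a shortest
   path covering gives the contraction rates c and e. Consensus, tracking and gap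
   errors combine into a Lyapunov function M with
     M_{k+1} <= M_k - D_k + O(delta^2 |grad F*|^2) + O(delta^4),
   where D_k >= theta M_k, while
     F*_{k+1} <= F*_k - a delta u_k^2 + u_k G_k + O(G_k^2),  G_k^2 = O(M_k + delta^4),
   with u_k = |grad F*|. Summing, the sum of delta u_k^2 over k < K stays bounded
   because K delta^3 is, and the smallest u_k^2 is O(1 / (K delta)) = O(K^(-2/3)). *)

Set Implicit Arguments.
Unset Strict Implicit.
Unset Printing Implicit Defensive.

Import Order.TTheory GRing.Theory Num.Theory.
Import numFieldNormedType.Exports.

Local Open Scope classical_set_scope.
Local Open Scope ring_scope.

(** * The Euclidean norm *)

(** Two obstacles shape the argument. The initial errors are O(1), so telescoping delta F* + M would
    only bound the sum of delta^2 u_k^2 and give the rate K^(-1/3). The transient of M is therefore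
    cut off by a geometric majorant: the Lyapunov function keeps the excess alone, which is 0 at the
    start, and after division by delta the transient acts as a Gronwall factor with summable
    exponents. The second obstacle is that y* is only known as an argmin. Its derivative is never
    formed: stationarity of y* at neighbouring points gives an expansion of F* with quadratic
    remainder, and this expansion alone yields the gradient of F*, its Lipschitz constant and a
    bound of |grad F*|^2 by F* minus a lower bound. In the same spirit the assumptions on values
    (Lipschitz in y, strong convexity) are turned into statements on gradients and Hessians by
    testing expansions at small t. Finally, the feedback between step lengths and errors is
    quadratic in lambda eta, whereas the admissible bounds are linear in it; they are multiplied in
    pairs. *)

Section Dot.
Context {R : realType}.
Implicit Types d : nat.

Definition dot d (u v : 'rV[R]_d) : R := \sum_i u 0 i * v 0 i.

Definition sq d (u : 'rV[R]_d) : R := dot u u.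

Context {d : nat}.
Implicit Types (u v w : 'rV[R]_d) (a : R).

Lemma dotC u v : dot u v = dot v u.
Proof. by apply: eq_bigr => i _; rewrite mulrC. Qed.

Lemma dotDl u v w : dot (u + v) w = dot u w + dot v w.
Proof. by rewrite -big_split; apply: eq_bigr => i _ /=; rewrite mxE mulrDl. Qed.

Lemma dotDr u v w : dot w (u + v) = dot w u + dot w v.
Proof. by rewrite dotC dotDl !(dotC w). Qed.

Lemma dotZl a u v : dot (a *: u) v = a * dot u v.
Proof. by rewrite mulr_sumr; apply: eq_bigr => i _; rewrite mxE mulrA. Qed.

Lemma dotZr a u v : dot u (a *: v) = a * dot u v.
Proof. by rewrite dotC dotZl dotC. Qed.

Lemma dotNl u v : dot (- u) v = - dot u v.
Proof. by rewrite -scaleN1r dotZl mulN1r. Qed.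

Lemma dotNr u v : dot u (- v) = - dot u v.
Proof. by rewrite dotC dotNl dotC. Qed.

Lemma dotBl u v w : dot (u - v) w = dot u w - dot v w.
Proof. by rewrite dotDl dotNl. Qed.

Lemma dot0l u : dot 0 u = 0.
Proof. by rewrite -(scale0r 0) dotZl mul0r. Qed.

Lemma dot0r u : dot u 0 = 0.
Proof. by rewrite dotC dot0l. Qed.

Lemma dot_suml (I : Type) (r : seq I) (F : I -> 'rV[R]_d) v :
  dot (\sum_(i <- r) F i) v = \sum_(i <- r) dot (F i) v.
Proof.
by elim: r => [|i r IH]; rewrite ?big_nil ?dot0l// !big_cons dotDl IH.
Qed.

Lemma sq_ge0 u : 0 <= sq u.
Proof. by apply: sumr_ge0 => i _; rewrite -expr2 sqr_ge0. Qed.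

Lemma sq0 : sq (0 : 'rV[R]_d) = 0.
Proof. exact: dot0l. Qed.

Lemma sqZ a u : sq (a *: u) = a ^+ 2 * sq u.
Proof. by rewrite /sq dotZl dotZr expr2 mulrA. Qed.

Lemma sqN u : sq (- u) = sq u.
Proof. by rewrite /sq dotNl dotNr opprK. Qed.

Lemma sqD u v : sq (u + v) = sq u + 2 * dot u v + sq v.
Proof. rewrite /sq dotDl !dotDr (dotC v u); ring. Qed.

Lemma sqB u v : sq (u - v) = sq u - 2 * dot u v + sq v.
Proof. rewrite sqD sqN dotNr; ring. Qed.

Lemma sqBC u v : sq (u - v) = sq (v - u).
Proof. by rewrite -sqN opprB. Qed.

Lemma sq_eq0 u : sq u = 0 -> u = 0.
Proof.
move=> /eqP; rewrite psumr_eq0; last by move=> i _; rewrite -expr2 sqr_ge0.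
move=> /allP h; apply/rowP => i; rewrite mxE.
by have := h i (mem_index_enum _); rewrite -expr2 sqrf_eq0 => /eqP.
Qed.

Lemma dot_young a u v : 0 < a -> 2 * dot u v <= a * sq u + a^-1 * sq v.
Proof.
move=> a0; have := sq_ge0 (a *: u - v).
rewrite sqB sqZ dotZl => h.
have a1 : 0 <= a^-1 by rewrite invr_ge0 ltW.
have := mulr_ge0 a1 h.
have -> : a^-1 * (a ^+ 2 * sq u - 2 * (a * dot u v) + sq v)
  = a * sq u - 2 * dot u v + a^-1 * sq v by field; rewrite gt_eqF.
lra.
Qed.

Lemma sqD_young a u v : 0 < a ->
  sq (u + v) <= (1 + a) * sq u + (1 + a^-1) * sq v.
Proof. move=> a0; rewrite sqD; have := dot_young u v a0; lra. Qed.

Lemma sqD_le2 u v : sq (u + v) <= 2 * sq u + 2 * sq v.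
Proof. have := @sqD_young 1 u v ltr01; rewrite invr1; lra. Qed.

Lemma sqB_le2 u v : sq (u - v) <= 2 * sq u + 2 * sq v.
Proof. by have := sqD_le2 u (- v); rewrite sqN. Qed.

Lemma cauchy_schwarz u v : dot u v ^+ 2 <= sq u * sq v.
Proof.
have [/sq_eq0 ->|u0] := eqVneq (sq u) 0; first by rewrite dot0l sq0 expr0n mul0r.
have u1 : 0 < sq u by rewrite lt_def u0 sq_ge0.
have := sq_ge0 (sq u *: v - dot u v *: u).
rewrite sqB !sqZ dotZl dotZr (dotC v u) => h.
have {h} : 0 <= sq u * (sq u * sq v - dot u v ^+ 2) by move: h; lra.
by rewrite pmulr_rge0// subr_ge0.
Qed.

Lemma enorm_ge0 u : 0 <= enorm u.
Proof. exact: sqrtr_ge0. Qed.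

Lemma enorm_sq u : enorm u ^+ 2 = sq u.
Proof.
rewrite /enorm sqr_sqrtr; last by apply: sumr_ge0 => i _; rewrite sqr_ge0.
by apply: eq_bigr => i _; rewrite expr2.
Qed.

Lemma enormE u : enorm u = Num.sqrt (sq u).
Proof. by congr Num.sqrt; apply: eq_bigr => i _; rewrite expr2. Qed.

Lemma enormZ a u : enorm (a *: u) = `|a| * enorm u.
Proof. by rewrite !enormE sqZ sqrtrM ?sqr_ge0// sqrtr_sqr. Qed.

Lemma enormN u : enorm (- u) = enorm u.
Proof. by rewrite !enormE sqN. Qed.

Lemma enorm0 : enorm (0 : 'rV[R]_d) = 0.
Proof. by rewrite enormE sq0 sqrtr0. Qed.

Lemma enorm_eq0 u : enorm u = 0 -> u = 0.
Proof. by move=> h; apply: sq_eq0; rewrite -enorm_sq h expr0n. Qed.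

Lemma dot_le_enorm u v : `|dot u v| <= enorm u * enorm v.
Proof.
rewrite -(@ler_pXn2r _ 2)// ?nnegrE ?normr_ge0 ?mulr_ge0 ?enorm_ge0//.
by rewrite exprMn !enorm_sq real_normK ?num_real// cauchy_schwarz.
Qed.

Lemma enormD u v : enorm (u + v) <= enorm u + enorm v.
Proof.
rewrite -(@ler_pXn2r _ 2)// ?nnegrE ?addr_ge0 ?enorm_ge0//.
rewrite sqrrD !enorm_sq sqD -mulr_natl.
have := dot_le_enorm u v; have := ler_norm (dot u v); lra.
Qed.

Lemma enormB u v : enorm (u - v) <= enorm u + enorm v.
Proof. by rewrite -(enormN v) enormD. Qed.

Lemma enorm_sum (I : Type) (r : seq I) (F : I -> 'rV[R]_d) :
  enorm (\sum_(i <- r) F i) <= \sum_(i <- r) enorm (F i).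
Proof.
elim: r => [|i r IH]; first by rewrite !big_nil enorm0.
rewrite !big_cons; apply: le_trans (enormD _ _) _; exact: lerD.
Qed.

Lemma enorm_le_sq u c : 0 <= c -> enorm u <= c -> sq u <= c ^+ 2.
Proof.
by move=> c0 h; rewrite -enorm_sq ler_pXn2r// nnegrE enorm_ge0.
Qed.

Lemma sq_le_enorm u c : 0 <= c -> sq u <= c ^+ 2 -> enorm u <= c.
Proof.
by move=> c0; rewrite -enorm_sq ler_pXn2r// nnegrE enorm_ge0.
Qed.

Lemma enorm_le_dual u c : (forall v, dot u v <= c * enorm v) -> 0 <= c ->
  enorm u <= c.
Proof.
move=> /(_ u); rewrite -/(sq u) -enorm_sq expr2 => h c0.
have [->//|u0] := eqVneq (enorm u) 0.
by rewrite -(ler_pM2r (_ : 0 < enorm u))// lt_def u0 enorm_ge0.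
Qed.

End Dot.
Arguments dot {R d} u v.
Arguments sq {R d} u.

(** * Gradients and Hessians *)

Section Calculus.
Context {R : realType} {d : nat}.
Implicit Types (h : 'rV[R]_d -> R) (u v w : 'rV[R]_d).

Lemma is_derive_line h w v t l :
  is_derive (w + t *: v) v h l -> is_derive t 1 (fun s : R => h (w + s *: v)) l.
Proof.
have E : (fun e : R => e^-1 *: ((h \o shift (w + t *: v)) (e *: v) - h (w + t *: v)))
  = (fun e : R => e^-1 *: (((fun s : R => h (w + s *: v)) \o shift t) (e *: 1)
                           - h (w + t *: v))).
  apply/funext => e /=; congr (_ *: (h _ - _)).
  by rewrite [e *: 1]mulr1 scalerDl addrCA.
move=> [dh hl]; apply: DeriveDef; first by move: dh; rewrite /derivable E.
by move: hl; rewrite /derive E.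
Qed.

Lemma derive_grad h w v : differentiable h w -> 'D_v h w = dot (grad h w) v.
Proof.
move=> dh; rewrite deriveE// [in LHS](row_sum_delta v) linear_sum.
apply: eq_bigr => i _; rewrite linearZ /= mxE deriveE// mulrC.
by congr (_ * _); rewrite /= mxE.
Qed.

Lemma mean_value_line h (k : 'rV[R]_d -> R) w v :
  (forall p, is_derive p v h (k p)) ->
  exists2 t : R, 0 <= t <= 1 & h (w + v) - h w = k (w + t *: v).
Proof.
move=> dh.
have dl (t : R) : is_derive t 1 (fun s : R => h (w + s *: v)) (k (w + t *: v)).
  exact: is_derive_line.
have [t] := @MVT R (fun s => h (w + s *: v)) (fun t => k (w + t *: v)) 0 1 ltr01
   (fun t _ => dl t)
   (derivable_within_continuous (fun t _ => (@ex_derive _ _ _ _ _ _ _ (dl t)))).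
rewrite in_itv /= => /andP[t0 t1].
rewrite scale1r scale0r addr0 subr0 mulr1 => ->.
by exists t; rewrite ?(ltW t0) ?(ltW t1).
Qed.

(** The mean value theorem on the segment stands in for the integral remainder; this costs |L|
    instead of L / 2. The absolute value appears because L carries no sign assumption. *)
Lemma taylor_lipschitz_gradient (L : R) h w v : lipschitz_gradient L h ->
  `|h (w + v) - h w - dot (grad h w) v| <= `|L| * sq v.
Proof.
move=> [dh Lh].
have [] := @mean_value_line h (fun p => dot (grad h p) v) w v.
  move=> p; apply: DeriveDef; first exact: diff_derivable.
  exact: derive_grad.
move=> t /andP[t0 t1] ->; rewrite -dotBl.
apply: le_trans (dot_le_enorm _ _) _.
have := Lh (w + t *: v) w; rewrite addrAC subrr add0r enormZ ger0_norm// => H.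
rewrite -enorm_sq expr2 mulrA ler_wpM2r ?enorm_ge0//.
apply: le_trans H _; apply: le_trans (_ : `|L| * (t * enorm v) <= _).
  by rewrite ler_wpM2r ?mulr_ge0 ?enorm_ge0// ler_norm.
by rewrite ler_wpM2l// ler_piMl ?enorm_ge0.
Qed.

Lemma is_derive_dot_field (G : 'rV[R]_d -> 'rV[R]_d) u v w :
  differentiable G w ->
  is_derive w v (fun p => dot (G p) u) (dot (v *m 'J G w) u).
Proof.
move=> dG.
have dGv : derivable G w v by exact: diff_derivable.
have -> : (fun p => dot (G p) u) = \sum_i (u 0 i *: (fun p => G p 0 i)).
  apply/funext => p; rewrite fct_sumE; apply: eq_bigr => i _ /=.
  by rewrite mulrC.
have -> : dot (v *m 'J G w) u = \sum_i u 0 i *: 'D_v (fun p => G p 0 i) w.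
  rewrite -deriveEjacobian// derive_mx//; apply: eq_bigr => i _.
  by rewrite mxE [RHS]mulrC.
apply: is_derive_sum => i; apply: is_deriveZ; apply: derivableP.
exact: (derivable_mxP _ _ _).1.
Qed.

Lemma enorm_mul_opnorm (M : 'M[R]_d) v : enorm (v *m M) <= opnorm M * enorm v.
Proof.
have [->|v0] := eqVneq v 0; first by rewrite mul0mx !enorm0 mulr0.
have v1 : 0 < enorm v.
  by rewrite lt_def enorm_ge0 andbT; apply: contra_neq v0 => /enorm_eq0.
(* [sup] says something only for a nonempty bounded set; Cauchy-Schwarz in each column bounds this
   one by the Frobenius norm of M. *)
have bnd : has_sup [set enorm (v *m M) | v in [set v | enorm v <= 1]].
  split; first by exists (enorm (0 *m M)); exists 0 => //=; rewrite enorm0 ler01.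
  exists (Num.sqrt (\sum_j sq (\row_i M i j))); move=> _ [p /= p1 <-].
  rewrite enormE ler_sqrt; last by apply: sumr_ge0 => j _; exact: sq_ge0.
  apply: ler_sum => j _; rewrite -expr2.
  have -> : (p *m M) 0 j = dot p (\row_i M i j).
    by rewrite mxE; apply: eq_bigr => i _; rewrite mxE.
  apply: le_trans (cauchy_schwarz _ _) _.
  rewrite ler_piMl ?sq_ge0// -enorm_sq -(expr1n _ 2).
  by rewrite ler_pXn2r ?nnegrE ?enorm_ge0.
have : enorm (((enorm v)^-1 *: v) *m M) <= opnorm M.
  apply: ub_le_sup; first exact: bnd.2.
  exists ((enorm v)^-1 *: v) => //=.
  by rewrite enormZ ger0_norm ?invr_ge0 ?enorm_ge0// mulVf ?gt_eqF.
rewrite -scalemxAl enormZ ger0_norm ?invr_ge0 ?enorm_ge0//.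
by rewrite ler_pdivrMl// mulrC.
Qed.

(** The mean value theorem is scalar, so the remainder is tested against a fixed vector u. The
    intermediate point depends on u but its bound does not, and [enorm_le_dual] recovers the
    norm. *)
Lemma taylor_lipschitz_hessian (L : R) h w v : lipschitz_hessian L h ->
  enorm (grad h (w + v) - grad h w - v *m 'J (grad h) w) <= `|L| * sq v.
Proof.
move=> [dG LG]; apply: enorm_le_dual; last by rewrite mulr_ge0 ?sq_ge0.
move=> u; rewrite !dotBl.
have [] := @mean_value_line (fun p => dot (grad h p) u)
  (fun p => dot (v *m 'J (grad h) p) u) w v.
  by move=> p; exact: is_derive_dot_field.
move=> t /andP[t0 t1] ->; rewrite -dotBl -mulmxBr.
apply: le_trans (ler_norm _) _; apply: le_trans (dot_le_enorm _ _) _.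
rewrite ler_wpM2r ?enorm_ge0//; apply: le_trans (enorm_mul_opnorm _ _) _.
rewrite -enorm_sq expr2 mulrA ler_wpM2r ?enorm_ge0//.
apply: le_trans (LG _ _) _; rewrite addrAC subrr add0r enormZ ger0_norm//.
apply: le_trans (_ : `|L| * (t * enorm v) <= _).
  by rewrite ler_wpM2r ?mulr_ge0 ?enorm_ge0// ler_norm.
by rewrite ler_wpM2l// ler_piMl ?enorm_ge0.
Qed.

(** Division by t^k and passage to t = 0 without limits; it extracts first-order (k = 1) and
    second-order (k = 2) information from expansions with an O(t^(k+1)) error. If a > b, the
    explicit t of the proof violates the hypothesis. *)
Lemma le_of_small (a b C : R) (k : nat) :
  (forall t : R, 0 < t <= 1 -> t ^+ k * a <= t ^+ k * b + C * t ^+ k.+1) -> a <= b.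
Proof.
move=> H; rewrite leNgt; apply/negP => ba.
have C1 : 0 < `|C| + (a - b) + 1.
  by have := normr_ge0 C; move: ba; lra.
pose t := (a - b) / (`|C| + (a - b) + 1) / 2.
have t0 : 0 < t by rewrite !divr_gt0 ?subr_gt0.
have tE : t * (`|C| + (a - b) + 1) = (a - b) / 2.
  by rewrite /t mulrAC divfK ?gt_eqF.
have t1 : t <= 1.
  rewrite -(ler_pM2r C1) tE mul1r.
  by have := normr_ge0 C; move: ba; lra.
have := H t; rewrite t0 t1 => /(_ isT).
rewrite (mulrC C) exprSr -mulrA -mulrDr ler_pM2l ?exprn_gt0//.
have : t * C <= t * `|C| by rewrite ler_wpM2l ?ler_norm// ltW.
have : 0 < t * ((a - b) + 1) by rewrite mulr_gt0// addr_gt0// subr_gt0.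
move: tE ba; lra.
Qed.

Lemma jacobian_grad_sym (L1 L2 : R) h w u v :
  lipschitz_gradient L1 h -> lipschitz_hessian L2 h ->
  dot (u *m 'J (grad h) w) v = dot (v *m 'J (grad h) w) u.
Proof.
move=> h1 h2.
(* The second difference of h is symmetric in its two increments. *)
have key (p q : 'rV[R]_d) (t : R) : 0 < t <= 1 ->
  `|(h (w + t *: q + t *: p) - h (w + t *: q)) - (h (w + t *: p) - h w)
    - t ^+ 2 * dot (p *m 'J (grad h) w) q|
  <= (`|L2| * ((enorm p + enorm q) ^+ 2 + sq q) * enorm q) * t ^+ 3.
  move=> /andP[t0 t1].
  have [] := @mean_value_line (fun z => h (z + t *: p) - h z)
     (fun z => dot (grad h (z + t *: p) - grad h z) (t *: q)) w (t *: q).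
    move=> z; rewrite dotBl.
    have D y : is_derive y (t *: q) h (dot (grad h y) (t *: q)).
      apply: DeriveDef; first by apply: diff_derivable; case: h1.
      by apply: derive_grad; case: h1.
    apply: is_deriveB.
    have [a b] := D (z + t *: p).
    have E : (fun e : R => e^-1 *: ((h \o shift (z + t *: p)) (e *: (t *: q)) - h (z + t *: p)))
      = (fun e : R => e^-1 *: (((fun z => h (z + t *: p)) \o shift z) (e *: (t *: q)) - h (z + t *: p))).
      by apply/funext => e /=; rewrite addrA.
    apply: DeriveDef; first by move: a; rewrite /derivable E.
    by move: b; rewrite /derive E.
  move=> s /andP[s0 s1] ->.
  have -> : t ^+ 2 * dot (p *m 'J (grad h) w) q
     = dot ((t *: p) *m 'J (grad h) w) (t *: q).
    by rewrite -scalemxAl dotZl dotZr mulrA.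
  rewrite -dotBl.
  apply: le_trans (dot_le_enorm _ _) _.
  have -> : (`|L2| * ((enorm p + enorm q) ^+ 2 + sq q) * enorm q) * t ^+ 3
    = (`|L2| * (t ^+ 2 * (enorm p + enorm q) ^+ 2 + t ^+ 2 * sq q)) * (t * enorm q).
    ring.
  rewrite enormZ gtr0_norm// ler_wpM2r ?mulr_ge0 ?enorm_ge0 ?(ltW t0)//.
  (* Both points are expanded around w: the linear terms then differ by exactly the Hessian applied
     to t p, and two remainders of size O(t^2) are left against the factor |t q|. *)
  have A1 := @taylor_lipschitz_hessian L2 h w (s *: (t *: q) + t *: p) h2.
  have A2 := @taylor_lipschitz_hessian L2 h w (s *: (t *: q)) h2.
  have -> : grad h (w + s *: (t *: q) + t *: p) - grad h (w + s *: (t *: q))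
              - (t *: p) *m 'J (grad h) w
     = (grad h (w + (s *: (t *: q) + t *: p)) - grad h w
          - (s *: (t *: q) + t *: p) *m 'J (grad h) w)
       - (grad h (w + s *: (t *: q)) - grad h w - (s *: (t *: q)) *m 'J (grad h) w).
    rewrite mulmxDl addrA; apply/rowP => i; rewrite !mxE; ring.
  apply: le_trans (enormB _ _) _; rewrite mulrDr.
  apply: lerD.
    apply: le_trans A1 _; rewrite ler_wpM2l// -exprMn; apply: enorm_le_sq.
      by rewrite mulr_ge0 ?addr_ge0 ?enorm_ge0 ?(ltW t0).
    apply: le_trans (enormD _ _) _.
    rewrite !enormZ !ger0_norm ?(ltW t0)// mulrDr addrC lerD2l.
    by rewrite mulrCA ler_wpM2l ?(ltW t0)// ler_piMl ?enorm_ge0.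
  apply: le_trans A2 _; rewrite ler_wpM2l// !sqZ.
  rewrite ler_piMl ?mulr_ge0 ?sqr_ge0 ?sq_ge0 ?(ltW t0)//.
  by rewrite exprn_ile1.
have half (p q : 'rV[R]_d) :
    dot (p *m 'J (grad h) w) q <= dot (q *m 'J (grad h) w) p.
  apply: (@le_of_small _ _ ((`|L2| * ((enorm p + enorm q) ^+ 2 + sq q) * enorm q) +
     (`|L2| * ((enorm q + enorm p) ^+ 2 + sq p) * enorm p)) 2) => t t01.
  have := key p q t t01; have := key q p t t01.
  rewrite (addrAC w (t *: q)) !ler_norml => /andP[_ a] /andP[b _].
  move: a b; rewrite mulrDl; lra.
by apply/eqP; rewrite eq_le !half.
Qed.

End Calculus.


(** * Functions with a quadratic expansion: gradient, continuity, minimizers *)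

Section QuadraticExpansion.
Context {R : realType} {d : nat}.
Implicit Types (h : 'rV[R]_d -> R) (g x v : 'rV[R]_d).

Lemma enorm_le_norm v : enorm v <= Num.sqrt d%:R * `|v|.
Proof.
apply: sq_le_enorm; first by rewrite mulr_ge0 ?sqrtr_ge0.
rewrite exprMn sqr_sqrtr// -[d in d%:R]card_ord -sum1_card natr_sum mulr_suml.
apply: ler_sum => i _; rewrite mul1r -expr2 -[leLHS]real_normK ?num_real//.
rewrite ler_pXn2r ?nnegrE//.
rewrite [leRHS]/Num.Def.normr /= mx_normrE.
exact: (le_bigmax _ (fun ij : 'I_1 * 'I_d => `|v ij.1 ij.2|) (0, i)).
Qed.

Lemma norm_le_enorm v : `|v| <= enorm v.
Proof.
rewrite [leLHS]/Num.Def.normr /= mx_normrE.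
apply: bigmax_le => [|[i j] _ /=]; first exact: enorm_ge0.
rewrite ord1 -(@ler_pXn2r _ 2)// ?nnegrE ?enorm_ge0//.
rewrite real_normK ?num_real// enorm_sq /sq /dot (bigD1 j)//= expr2 lerDl.
by apply: sumr_ge0 => k _; rewrite -expr2 sqr_ge0.
Qed.

(** Identifies [grad] for a function known only through an expansion, as F* is: the difference
    quotient along each basis vector differs from the entry of g by O(t). *)
Lemma grad_quadratic h x g (C : R) :
  (forall v, `|h (x + v) - h x - dot g v| <= C * sq v) -> grad h x = g.
Proof.
move=> H; apply/rowP => i; rewrite mxE /derive.
apply/cvg_lim => //; apply/cvgrPdist_le => e e0.
have C0 : 0 < `|C| + 1 by rewrite ltr_wpDl.
near=> t.
have t0 : t != 0 by near: t; exact: nbhs_dnbhs_neq.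
have te : `|t| * (`|C| + 1) <= e.
  rewrite -ler_pdivlMr//; near: t; apply: dnbhs0_le; exact: divr_gt0.
have dE : dot g (delta_mx 0 i) = g 0 i.
  rewrite /dot (bigD1 i)//= mxE !eqxx mulr1 big1 ?addr0// => j ji.
  by rewrite mxE (negbTE ji) andbF mulr0.
have sE : sq (delta_mx 0 i : 'rV[R]_d) = 1.
  rewrite /sq /dot (bigD1 i)//= mxE !eqxx mulr1 big1 ?addr0// => j ji.
  by rewrite mxE (negbTE ji) andbF mulr0.
have := H (t *: delta_mx 0 i).
rewrite sqZ sE mulr1 dotZr dE /= (addrC x) => Hx.
apply: le_trans te.
have -> : g 0 i - t^-1 *: (h (t *: delta_mx 0 i + x) - h x)
   = - (t^-1 * (h (t *: delta_mx 0 i + x) - h x - t * g 0 i)).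
  by rewrite /GRing.scale /=; field.
rewrite normrN normrM normfV ler_pdivrMl ?normr_gt0//.
apply: le_trans Hx _; rewrite -(real_normK (num_real t)) expr2 mulrC -mulrA.
by rewrite !ler_wpM2l//; have := ler_norm C; lra.
Unshelve. all: by end_near. Qed.

Lemma continuous_quadratic h (g : 'rV[R]_d -> 'rV[R]_d) (C : R) :
  (forall x v, `|h (x + v) - h x - dot (g x) v| <= C * sq v) -> continuous h.
Proof.
move=> H x.
have F : Filter (nbhs x) by exact: nbhs_filter.
apply/(@cvgrPdist_le _ _ _ _ F) => e e0.
pose k : R := Num.sqrt d%:R; set B := enorm (g x) * k + `|C| * k ^+ 2 + 1.
have k0 : 0 <= k by exact: sqrtr_ge0.
have B0 : 0 < B.
  by rewrite ltr_wpDl// addr_ge0// mulr_ge0 ?enorm_ge0 ?sqr_ge0.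
apply/(@nbhs_normP _ _ x); exists (Num.min 1 (e / B)) => /=.
  by rewrite lt_min ltr01 divr_gt0.
move=> z; rewrite /ball_ /= lt_min => /andP[/ltW z1 /ltW].
rewrite ler_pdivlMr// => ze.
have := H x (z - x); rewrite subrKC => Hx.
apply: le_trans ze.
have E : `|dot (g x) (z - x)| <= enorm (g x) * (k * `|x - z|).
  apply: le_trans (dot_le_enorm _ _) _; rewrite ler_wpM2l ?enorm_ge0//.
  by rewrite distrC; exact: enorm_le_norm.
have S : C * sq (z - x) <= `|C| * (k ^+ 2 * `|x - z|).
  apply: le_trans (_ : `|C| * sq (z - x) <= _).
    by rewrite ler_wpM2r ?sq_ge0// ler_norm.
  rewrite ler_wpM2l//; apply: le_trans (_ : (k * `|x - z|) ^+ 2 <= _).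
    apply: enorm_le_sq; first by rewrite mulr_ge0.
    by rewrite distrC; exact: enorm_le_norm.
  by rewrite exprMn ler_wpM2l ?sqr_ge0// expr2 ler_piMl.
move: Hx E; rewrite (distrC (h x)) !ler_norml => /andP[h1 h2] /andP[h3 h4].
have -> : `|x - z| * B = enorm (g x) * (k * `|x - z|)
   + `|C| * (k ^+ 2 * `|x - z|) + `|x - z| by rewrite /B; ring.
have := normr_ge0 (x - z).
by move=> ?; apply/andP; split; lra.
Qed.

Lemma exists_minimizer h (x0 : 'rV[R]_d) (r : R) : continuous h ->
  (forall x, h x <= h x0 -> enorm x <= r) -> exists y, forall x, h y <= h x.
Proof.
move=> ch bnd.
have [] := @EVT_min_rV R d h [set x | h x <= h x0].
- by exists x0 => /=.
- apply: bounded_closed_compact.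
    exists r; split; first exact: num_real.
    move=> s rs x /= /bnd xr; apply: le_trans (norm_le_enorm x) _.
    exact: le_trans xr (ltW rs).
  exact: (@closed_comp _ _ h [set t | t <= h x0] (fun x _ => ch x) (@closed_le _ _)).
- exact: continuous_subspaceT.
move=> y; rewrite inE /= => yx0 ymin; exists y => x.
have [xx0|/ltW x0x] := leP (h x) (h x0); first by apply: ymin; rewrite inE.
exact: le_trans yx0 x0x.
Qed.

Lemma grad_eq0_of_min h x g (C : R) :
  (forall v, `|h (x + v) - h x - dot g v| <= C * sq v) ->
  (forall y, h x <= h y) -> g = 0.
Proof.
move=> H hmin; apply: sq_eq0; apply/eqP; rewrite eq_le sq_ge0 andbT.
apply: (@le_of_small _ _ _ (C * sq g) 1) => t /andP[t0 t1].
have := H (- t *: g); rewrite sqZ dotZr -/(sq g) sqrrN ler_norml => /andP[_].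
have := hmin (x + - t *: g); rewrite expr1; lra.
Qed.

(* Three-point argument: expand h around x and x' at the common point x' + v. *)
Lemma lipschitz_of_quadratic h (g : 'rV[R]_d -> 'rV[R]_d) (C : R) : 0 <= C ->
  (forall x v, `|h (x + v) - h x - dot (g x) v| <= C * sq v) ->
  forall x x', sq (g x - g x') <= (6 * C) ^+ 2 * sq (x - x').
Proof.
move=> C0 H x x'; set r := enorm (x - x').
have r0 : 0 <= r by exact: enorm_ge0.
rewrite -[sq (x - x')]enorm_sq -/r -exprMn.
apply: enorm_le_sq; first by rewrite !mulr_ge0.
have [rz|rn0] := eqVneq r 0.
  have -> : x = x' by apply/eqP; rewrite -subr_eq0; apply/eqP/enorm_eq0.
  by rewrite subrr enorm0 !mulr_ge0.
set D := g x - g x'; have [D0|D0] := eqVneq (enorm D) 0.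
  by rewrite D0 !mulr_ge0.
have rp : 0 < r by rewrite lt_def rn0.
have Dp : 0 < enorm D by rewrite lt_def D0 enorm_ge0.
(* With |v| = |x - x'| the three remainders are at most C, C and 4 C times r^2, hence the factor 6;
   the direction of D turns the dot product into r |D|. *)
pose v := (r / enorm D) *: D.
have sv : sq v = r ^+ 2.
  by rewrite /v sqZ -[sq D]enorm_sq -exprMn divfK.
have dv : dot D v = r * enorm D.
  by rewrite /v dotZr -/(sq D) -enorm_sq; field.
have := H x (x' - x + v); have := H x' v; have := H x (x' - x).
rewrite (addrA x (x' - x) v) !subrKC sv.
have : sq (x' - x + v) <= 4 * r ^+ 2.
  by have := sqD_le2 (x' - x) v; rewrite sv sqBC -[sq (x - x')]enorm_sq -/r; lra.
move=> /(ler_wpM2l C0); rewrite sqBC -[sq (x - x')]enorm_sq -/r.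
rewrite (@dotDr _ _ (x' - x) v) !ler_norml => e1 /andP[e2 e3] /andP[e4 e5] /andP[e6 e7].
have : dot D v <= 6 * C * r ^+ 2 by rewrite /D dotBl; lra.
by rewrite dv expr2 mulrA (mulrC r) ler_pM2r.
Qed.

(** One gradient step of length 1 / (2 C) lowers h by at least |g|^2 / (4 C), and h cannot fall
    below m. *)
Lemma sq_grad_le_gap h (g : 'rV[R]_d -> 'rV[R]_d) (C m : R) : 0 < C ->
  (forall x v, `|h (x + v) - h x - dot (g x) v| <= C * sq v) ->
  (forall x, m <= h x) -> forall x, sq (g x) <= 4 * C * (h x - m).
Proof.
move=> C0 H hm x; have := H x (- (2 * C)^-1 *: g x).
have := hm (x + - (2 * C)^-1 *: g x).
rewrite dotZr -/(sq _) sqZ ler_norml => a /andP[_ b].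
have E : C * ((- (2 * C)^-1) ^+ 2 * sq (g x)) = (4 * C)^-1 * sq (g x).
  by field; rewrite gt_eqF.
have E2 : - (2 * C)^-1 * sq (g x) = - (2 * ((4 * C)^-1 * sq (g x))).
  by field; rewrite gt_eqF.
rewrite -ler_pdivrMl ?mulr_gt0//.
move: a b; rewrite E E2; lra.
Qed.

End QuadraticExpansion.

(** * The regularized lower level problem *)

Section RowMx.
Context {R : realType} {d1 d2 : nat}.
Implicit Types (u : 'rV[R]_d1) (v : 'rV[R]_d2) (w : 'rV[R]_(d1 + d2)).

Lemma dot_row_mx u u' v v' :
  dot (row_mx u v) (row_mx u' v') = dot u u' + dot v v'.
Proof.
rewrite /dot big_split_ord; congr (_ + _); apply: eq_bigr => i _.
  by rewrite !row_mxEl.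
by rewrite !row_mxEr.
Qed.

Lemma dot_row_mxr w u v :
  dot w (row_mx u v) = dot (lsubmx w) u + dot (rsubmx w) v.
Proof. by rewrite -dot_row_mx hsubmxK. Qed.

Lemma sq_row_mx u v : sq (row_mx u v) = sq u + sq v.
Proof. exact: dot_row_mx. Qed.

Lemma sq_row_mx0 u : sq (row_mx u 0 : 'rV_(d1 + d2)) = sq u.
Proof. by rewrite sq_row_mx sq0 addr0. Qed.

Lemma sq_row_0mx v : sq (row_mx 0 v : 'rV_(d1 + d2)) = sq v.
Proof. by rewrite sq_row_mx sq0 add0r. Qed.

Lemma enorm_row_mx0 u : enorm (row_mx u 0 : 'rV_(d1 + d2)) = enorm u.
Proof. by rewrite !enormE sq_row_mx0. Qed.

Lemma enorm_row_0mx v : enorm (row_mx 0 v : 'rV_(d1 + d2)) = enorm v.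
Proof. by rewrite !enormE sq_row_0mx. Qed.

Lemma row_mx_split u v : row_mx u v = row_mx u 0 + row_mx 0 v.
Proof. by rewrite add_row_mx addr0 add0r. Qed.

Lemma sub_row_mx u u' v v' :
  row_mx u v - row_mx u' v' = row_mx (u - u') (v - v') :> 'rV_(d1 + d2).
Proof. by rewrite opp_row_mx add_row_mx. Qed.

End RowMx.

(** * Regularized minimizers, hypergradient and penalty bias *)

Section Bilevel.
Context {R : realType} {dx dy : nat}.
Implicit Types (x : 'rV[R]_dx) (y : 'rV[R]_dy) (w : 'rV[R]_(dx + dy)).
Variables (F G : 'rV[R]_(dx + dy) -> R).
Variables (gF gG : 'rV[R]_(dx + dy) -> 'rV[R]_(dx + dy)).
Variable JG : 'rV[R]_(dx + dy) -> 'M[R]_(dx + dy).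
Variables (lF lG hG l0 m mu : R).
Hypotheses (lF0 : 0 <= lF) (hG0 : 0 <= hG) (l00 : 0 <= l0).
Hypotheses (mu0 : 0 < mu) (mulG : mu <= lG).
Hypothesis F_ge : forall w, m <= F w.
Hypothesis F_quad : forall w v, `|F (w + v) - F w - dot (gF w) v| <= lF * sq v.
Hypothesis G_quad : forall w v, `|G (w + v) - G w - dot (gG w) v| <= lG * sq v.
Hypothesis gF_lip : forall w w', enorm (gF w - gF w') <= lF * enorm (w - w').
Hypothesis gG_lip : forall w w', enorm (gG w - gG w') <= lG * enorm (w - w').
Hypothesis gG_taylor : forall w v,
  enorm (gG (w + v) - gG w - v *m JG w) <= hG * sq v.
Hypothesis JG_sym : forall w u v, dot (u *m JG w) v = dot (v *m JG w) u.
Hypothesis F_lip_y : forall w y, dot (gF w) (row_mx 0 y) <= l0 * enorm y.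
Hypothesis G_convex : forall x y y', G (row_mx x y) +
    dot (gG (row_mx x y)) (row_mx 0 (y' - y)) + mu / 2 * sq (y' - y)
  <= G (row_mx x y').

Let lG0 : 0 < lG. Proof. exact: lt_le_trans mu0 mulG. Qed.

Lemma gG_monotone x y y' : mu * sq (y' - y) <=
  dot (gG (row_mx x y') - gG (row_mx x y)) (row_mx 0 (y' - y)).
Proof.
have := G_convex x y y'; have := G_convex x y' y.
have -> : row_mx 0 (y - y') = - row_mx 0 (y' - y) :> 'rV[R]_(dx + dy).
  by rewrite opp_row_mx oppr0 opprB.
rewrite (sqBC y) dotNr dotBl; lra.
Qed.

(** The penalized lower level divided by lambda = 1 / delta. In this scaling delta = 0 is the
    original lower level, so y* and the penalized minimizer are instances of one construction. *)
Definition psi (delta : R) x y : R :=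
  delta * F (row_mx x y) + G (row_mx x y).

Lemma psi_quad (delta : R) x y (v : 'rV[R]_dy) : 0 <= delta ->
  `|psi delta x (y + v) - psi delta x y
    - dot (rsubmx (delta *: gF (row_mx x y) + gG (row_mx x y))) v|
  <= (delta * lF + lG) * sq v.
Proof.
move=> d0.
have E : row_mx x (y + v) = row_mx x y + row_mx 0 v :> 'rV_(dx + dy).
  by rewrite add_row_mx addr0.
have := F_quad (row_mx x y) (row_mx 0 v).
have := G_quad (row_mx x y) (row_mx 0 v).
have L : rsubmx (delta *: gF (row_mx x y) + gG (row_mx x y))
    = delta *: rsubmx (gF (row_mx x y)) + rsubmx (gG (row_mx x y)).
  by rewrite linearD linearZ.
rewrite -E !sq_row_0mx !dot_row_mxr !dot0r !add0r L /psi.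
rewrite dotDl dotZl !ler_norml => /andP[a1 a2] /andP[].
move=> /(ler_wpM2l d0) b1 /(ler_wpM2l d0) b2.
by apply/andP; split; lra.
Qed.

(** Strong convexity of G and the lower bound m of F confine the sublevel set of y = 0 to a ball,
    where the continuous function [psi] attains its minimum. *)
Lemma psi_min (delta : R) x : 0 <= delta ->
  exists y, forall y', psi delta x y <= psi delta x y'.
Proof.
move=> d0.
pose a := enorm (gG (row_mx x 0)).
pose b := delta * (F (row_mx x 0) - m).
have b0 : 0 <= b by rewrite mulr_ge0// subr_ge0.
apply: (@exists_minimizer _ _ (psi delta x) 0 (1 + 2 * (a + b) / mu)).
  apply: (@continuous_quadratic _ _ (psi delta x)
    (fun y => rsubmx (delta *: gF (row_mx x y) + gG (row_mx x y))) (delta * lF + lG)).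
  by move=> y v; exact: psi_quad.
move=> y; rewrite /psi => H.
have := G_convex x 0 y; rewrite subr0 => C.
have D : - (a * enorm y) <= dot (gG (row_mx x 0)) (row_mx 0 y).
  have := dot_le_enorm (gG (row_mx x 0)) (row_mx 0 y).
  by rewrite enorm_row_0mx ler_norml => /andP[].
have Fd : delta * m <= delta * F (row_mx x y) by rewrite ler_wpM2l.
have K : mu / 2 * sq y <= a * enorm y + b.
  rewrite /b; move: C D H Fd; lra.
have a0 : 0 <= a by exact: enorm_ge0.
(* For |y| > 1 the constant b is at most b |y|, and the quadratic inequality can be divided by
   |y|. *)
have [y1|y1] := leP (enorm y) 1.
  apply: le_trans y1 _; rewrite lerDl.
  by rewrite divr_ge0 ?(ltW mu0)// mulr_ge0// addr_ge0.
apply: le_trans (_ : 2 * (a + b) / mu <= _); last by rewrite lerDr.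
rewrite ler_pdivlMr//.
have : mu / 2 * enorm y * enorm y <= (a + b) * enorm y.
  rewrite -mulrA -expr2 enorm_sq; apply: le_trans K _.
  by rewrite mulrDl lerD2l ler_peMr// ltW.
rewrite ler_pM2r; last exact: lt_trans y1.
lra.
Qed.

Definition ydel (delta : R) x : 'rV[R]_dy := argmin (psi delta x).

Lemma ydel_min (delta : R) x y : 0 <= delta ->
  psi delta x (ydel delta x) <= psi delta x y.
Proof.
move=> d0; have [y0 h0] := psi_min x d0.
have := @getPex _ [set y | forall y', psi delta x y <= psi delta x y'].
by apply; exists y0.
Qed.

Let W (delta : R) x : 'rV[R]_(dx + dy) := row_mx x (ydel delta x).

Lemma ydel_stationary (delta : R) x y : 0 <= delta ->
  delta * dot (gF (W delta x)) (row_mx 0 y) + dot (gG (W delta x)) (row_mx 0 y)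
  = 0.
Proof.
move=> d0.
have := @grad_eq0_of_min _ _ (psi delta x) (ydel delta x) _ _
  (fun v => psi_quad x _ v d0) (fun y => ydel_min x y d0).
have -> : rsubmx (delta *: gF (W delta x) + gG (W delta x))
    = delta *: rsubmx (gF (W delta x)) + rsubmx (gG (W delta x)).
  by rewrite linearD linearZ.
rewrite !dot_row_mxr !dot0r !add0r -dotZl -dotDl => ->.
by rewrite dot0l.
Qed.

Lemma ystar_stationary x y : dot (gG (W 0 x)) (row_mx 0 y) = 0.
Proof.
by have := @ydel_stationary 0 x y (lexx _); rewrite mul0r add0r.
Qed.

(** The stationarity conditions at x and x' are subtracted and tested with the difference D: strong
    monotonicity in y against Lipschitz dependence on x. As delta lF is at most mu / 10, the ratio
    (lG + delta lF) / (mu - delta lF) is at most 11/9 lG / mu, and (11/9)^2 <= 3/2. *)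
Lemma ydel_lipschitz (delta : R) x x' : 0 <= delta -> 10 * (delta * lF) <= mu ->
  sq (ydel delta x' - ydel delta x) <= 3 / 2 * (lG / mu) ^+ 2 * sq (x' - x).
Proof.
move=> d0 dmu; set D := ydel delta x' - ydel delta x.
pose a := delta * lF; pose w := row_mx x' (ydel delta x) : 'rV[R]_(dx + dy).
have a0 : 0 <= a by rewrite mulr_ge0.
have s1 := ydel_stationary x' D d0; have s2 := ydel_stationary x D d0.
have M := gG_monotone x' (ydel delta x) (ydel delta x').
rewrite -/D -/w -/(W delta x') dotBl in M.
have nW : enorm (W delta x' - w) = enorm D.
  by rewrite sub_row_mx subrr enorm_row_0mx.
have nw : enorm (w - W delta x) = enorm (x' - x).
  by rewrite sub_row_mx subrr enorm_row_mx0.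
have bound (g : 'rV[R]_(dx + dy) -> 'rV[R]_(dx + dy)) l u v :
    (forall w w', enorm (g w - g w') <= l * enorm (w - w')) ->
    `|dot (g u) (row_mx 0 D) - dot (g v) (row_mx 0 D)| <= l * enorm (u - v) * enorm D.
  move=> gl; rewrite -dotBl; apply: le_trans (dot_le_enorm _ _) _.
  by rewrite enorm_row_0mx ler_wpM2r ?enorm_ge0.
have F1 := bound _ _ (W delta x') w gF_lip; rewrite nW in F1.
have F2 := bound _ _ w (W delta x) gF_lip; rewrite nw in F2.
have G2 := bound _ _ w (W delta x) gG_lip; rewrite nw in G2.
have [/enorm_eq0 ->|Dn] := eqVneq (enorm D) 0.
  by rewrite sq0 mulr_ge0 ?sq_ge0// mulr_ge0 ?sqr_ge0// divr_ge0.
have Dp : 0 < enorm D by rewrite lt_def Dn enorm_ge0.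
have K : mu * enorm D <= a * enorm D + (a + lG) * enorm (x' - x).
  rewrite -(ler_pM2r Dp).
  move: F1 F2; rewrite !ler_norml => /andP[f1 f2] /andP[f3 f4].
  have := ler_wpM2l d0 f1; have := ler_wpM2l d0 f3.
  move: G2; rewrite ler_norml => /andP[g1 g2].
  move: M; rewrite -enorm_sq expr2 => M.
  rewrite /a; move: s1 s2 M g1 g2; lra.
have K2 : 9 / 10 * mu * enorm D <= 11 / 10 * lG * enorm (x' - x).
  have : 0 <= (mu / 10 - a) * enorm D.
    by rewrite mulr_ge0 ?enorm_ge0// subr_ge0 /a; lra.
  have : 0 <= (lG / 10 - a) * enorm (x' - x).
    by rewrite mulr_ge0 ?enorm_ge0// subr_ge0 /a; move: mulG; lra.
  lra.
have K3 : enorm D <= 11 / 9 * (lG / mu) * enorm (x' - x).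
  rewrite -(ler_pM2l mu0).
  have -> : mu * (11 / 9 * (lG / mu) * enorm (x' - x))
     = 11 / 9 * lG * enorm (x' - x) by field; rewrite gt_eqF.
  lra.
have e0 := enorm_ge0 (x' - x).
have r0 : 0 <= lG / mu by rewrite divr_ge0 ?(ltW lG0) ?(ltW mu0).
apply: le_trans (enorm_le_sq _ K3) _; first by rewrite mulr_ge0// mulr_ge0// divr_ge0.
rewrite exprMn enorm_sq ler_wpM2r ?sq_ge0//.
by rewrite exprMn ler_wpM2r ?sqr_ge0// expr2; lra.
Qed.

Lemma ystar_lipschitz x x' :
  sq (ydel 0 x' - ydel 0 x) <= 3 / 2 * (lG / mu) ^+ 2 * sq (x' - x).
Proof. by apply: ydel_lipschitz => //; rewrite mul0r mulr0 ltW. Qed.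

(** Strong monotonicity between the two minimizers: the y-gradient of G is 0 at y* and - delta times
    that of F at [ydel delta x], where l0 bounds it. *)
Lemma ydel_near_ystar (delta : R) x : 0 <= delta ->
  enorm (ydel delta x - ydel 0 x) <= delta * l0 / mu.
Proof.
move=> d0; set D := ydel delta x - ydel 0 x.
have M := gG_monotone x (ydel 0 x) (ydel delta x).
rewrite -/D -/(W 0 x) -/(W delta x) dotBl ystar_stationary subr0 in M.
have s1 := ydel_stationary x D d0.
have := F_lip_y (W delta x) (- D).
have -> : row_mx 0 (- D) = - row_mx 0 D :> 'rV[R]_(dx + dy).
  by rewrite opp_row_mx oppr0.
rewrite enormN dotNr => Fl.
have {Fl} := ler_wpM2l d0 Fl => Fl.
rewrite ler_pdivlMr// mulrC.
have [->|Dn] := eqVneq (enorm D) 0; first by rewrite mulr0 mulr_ge0.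
have Dp : 0 < enorm D by rewrite lt_def Dn enorm_ge0.
rewrite -(ler_pM2r Dp) -mulrA -expr2 enorm_sq -mulrA.
by apply: le_trans M _; lra.
Qed.

(** [JG] enters only through the expansion [gG_taylor] and its symmetry. Its norm bound here, and
    the coercivity of its y-block in [JG_pos], are read off from the Lipschitz and monotone
    behaviour of [gG] over small increments. *)
Lemma JG_bound w v : enorm (v *m JG w) <= lG * enorm v.
Proof.
apply: (@le_of_small _ _ _ (hG * sq v) 1) => t /andP[t0 t1].
have := gG_taylor w (t *: v); have := gG_lip (w + t *: v) w.
rewrite addrAC subrr add0r enormZ gtr0_norm// sqZ -scalemxAl => h1 h2.
have : enorm (t *: (v *m JG w)) <=
    enorm (gG (w + t *: v) - gG w) + enorm (gG (w + t *: v) - gG w - t *: (v *m JG w)).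
  by rewrite -{1}[t *: (v *m JG w)](subKr (gG (w + t *: v) - gG w)) enormB.
rewrite enormZ gtr0_norm// expr1; lra.
Qed.

Lemma JG_pos x y (v : 'rV[R]_dy) :
  mu * sq v <= dot (row_mx 0 v *m JG (row_mx x y)) (row_mx 0 v).
Proof.
set w := row_mx x y.
apply: (@le_of_small _ _ _ (hG * sq v * enorm v) 2) => t /andP[t0 t1].
have := gG_monotone x y (y + t *: v).
rewrite addrAC subrr add0r sqZ.
have -> : row_mx x (y + t *: v) = w + t *: row_mx 0 v :> 'rV_(dx + dy).
  by rewrite scale_row_mx add_row_mx scaler0 addr0.
have -> : row_mx 0 (t *: v) = t *: row_mx 0 v :> 'rV[R]_(dx + dy).
  by rewrite scale_row_mx scaler0.
rewrite dotZr -/w => h1.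
have h2 := gG_taylor w (t *: row_mx 0 v).
have := dot_le_enorm (gG (w + t *: row_mx 0 v) - gG w
   - (t *: row_mx 0 v) *m JG w) (t *: row_mx 0 v).
rewrite dotBl !dotZr -scalemxAl dotZl => h3.
have h4 := le_trans (ler_norm _) h3.
have h5 : enorm (gG (w + t *: row_mx 0 v) - gG w - t *: (row_mx 0 v *m JG w))
     * enorm (t *: row_mx 0 v : 'rV[R]_(dx + dy)) <= hG * sq v * enorm v * t ^+ 3.
  apply: le_trans (ler_wpM2r (enorm_ge0 _) _) _; first by rewrite scalemxAl; exact: h2.
  rewrite enormZ gtr0_norm// sqZ sq_row_0mx enorm_row_0mx.
  by rewrite le_eqVlt; apply/orP; left; apply/eqP; ring.
move: h1 h4 h5; rewrite -/w; lra.
Qed.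

Let Hyy x := drsubmx (JG (W 0 x)).

Let mul_Hyy x y : y *m Hyy x = rsubmx (row_mx 0 y *m JG (W 0 x)).
Proof.
rewrite -[in RHS](submxK (JG (W 0 x))) mul_row_block !mul0mx !add0r.
by rewrite row_mxKr.
Qed.

Let Hyy_unit x : Hyy x \in unitmx.
Proof.
rewrite -row_free_unit; apply: inj_row_free => v v0.
apply: sq_eq0; apply/eqP; rewrite eq_le sq_ge0 andbT.
have := JG_pos x (ydel 0 x) v.
by rewrite dot_row_mxr -mul_Hyy v0 dot0l dot0r addr0 pmulr_rle0.
Qed.

(* The Lagrange multiplier of the constraint that y minimizes G (x, .). *)
Let nu x : 'rV[R]_dy := rsubmx (gF (W 0 x)) *m invmx (Hyy x).

Let nuP x y : dot (row_mx 0 (nu x) *m JG (W 0 x)) (row_mx 0 y)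
  = dot (gF (W 0 x)) (row_mx 0 y).
Proof. by rewrite !dot_row_mxr -mul_Hyy mulmxKV ?Hyy_unit// !dot0r. Qed.

Let nu_le x : enorm (nu x) <= l0 / mu.
Proof.
have := JG_pos x (ydel 0 x) (nu x); rewrite nuP.
move=> /le_trans /(_ (F_lip_y _ _)) H.
rewrite ler_pdivlMr// mulrC.
have [->|Dn] := eqVneq (enorm (nu x)) 0; first by rewrite mulr0.
have Dp : 0 < enorm (nu x) by rewrite lt_def Dn enorm_ge0.
by rewrite -(ler_pM2r Dp) -mulrA -expr2 enorm_sq.
Qed.

(** The implicit differentiation formula grad_x F - (mixed Hessian of G) (yy-Hessian of G)^-1 grad_y
    F, written with the multiplier [nu]. *)
Definition hypergrad x : 'rV[R]_dx :=
  lsubmx (gF (W 0 x)) - lsubmx (row_mx 0 (nu x) *m JG (W 0 x)).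

Definition lipH : R := (lF + hG * (l0 / mu)) * (1 + 3 / 2 * (lG / mu) ^+ 2).

(** No derivative of y* enters. The y-gradient of G vanishes at both minimizers, so the Hessian of G
    applied to the joint increment z, paired with (0, nu), is O(|z|^2). By symmetry and [nuP] this
    pairing is exactly the difference between the first-order term of F along z and [hypergrad]
    along v; and z = O(v) because y* is Lipschitz. *)
Lemma hyper_quad x (v : 'rV[R]_dx) : `|F (W 0 (x + v)) - F (W 0 x) - dot (hypergrad x) v|
  <= lipH * sq v.
Proof.
set w := W 0 x; set D := ydel 0 (x + v) - ydel 0 x; set z := row_mx v D.
have Ew : W 0 (x + v) = w + z by rewrite add_row_mx addrC subrKC addrC.
have sz : sq z <= (1 + 3 / 2 * (lG / mu) ^+ 2) * sq v.
  rewrite sq_row_mx; have := ystar_lipschitz x (x + v).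
  by rewrite addrAC subrr add0r -/D; lra.
have q := F_quad w z; rewrite -Ew in q.
have e : dot (gG (w + z) - gG w - z *m JG w) (row_mx 0 (nu x))
    = - dot (z *m JG w) (row_mx 0 (nu x)).
  by rewrite dotBl -Ew dotBl !ystar_stationary subrr sub0r.
have t : `|dot (z *m JG w) (row_mx 0 (nu x))| <= hG * (l0 / mu) * sq z.
  rewrite -normrN -e; apply: le_trans (dot_le_enorm _ _) _.
  rewrite enorm_row_0mx mulrAC ler_pM ?enorm_ge0//; exact: gG_taylor.
have E : dot (gF w) z - dot (hypergrad x) v = dot (z *m JG w) (row_mx 0 (nu x)).
  rewrite JG_sym /hypergrad -/w /z dotBl (row_mx_split v D) !dotDr nuP.
  by rewrite !dot_row_mxr !dot0r !addr0 !add0r; ring.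
rewrite -E in t.
apply: le_trans (_ : (lF + hG * (l0 / mu)) * sq z <= _); last first.
  rewrite /lipH -mulrA ler_wpM2l// addr_ge0// mulr_ge0// divr_ge0//.
  exact: ltW.
move: q t; rewrite !ler_norml mulrDl => /andP[q1 q2] /andP[t1 t2].
by apply/andP; split; lra.
Qed.

(** By the envelope formula, the gradient of x -> min_y (F + G / delta) - min_y (G / delta). Times n
    delta it is the total x-direction at the exact lower-level solutions. *)
Definition hypergrad_del (delta : R) x : 'rV[R]_dx :=
  lsubmx (gF (W delta x)) + delta^-1 *: (lsubmx (gG (W delta x)) - lsubmx (gG (W 0 x))).

Definition biasH : R := lF * (l0 / mu)
  + (lG * ((lF * (l0 / mu) + hG * (l0 / mu) ^+ 2) / mu) + hG * (l0 / mu) ^+ 2).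

(** The multiplier is the first-order displacement of the minimizer: [ydel delta x] = y* - delta nu
    + O(delta^2). The error [zeta] of this expansion is bounded by testing stationarity with [zeta]
    itself and using coercivity of the y-block. Dividing the expansion of the x-gradient of G by
    delta then reproduces the nu term of [hypergrad] up to O(delta). *)
Lemma hypergrad_del_bias (delta : R) x : 0 < delta ->
  enorm (hypergrad_del delta x - hypergrad x) <= delta * biasH.
Proof.
move=> d0.
have r0 : 0 <= l0 / mu by rewrite divr_ge0// ltW.
have m0 := ltW mu0; have g0 := ltW lG0.
have q0 : 0 <= hG * (l0 / mu) ^+ 2 by rewrite mulr_ge0 ?sqr_ge0.
have p0 : 0 <= lF * (l0 / mu) by exact: mulr_ge0.
have b0 : 0 <= biasH.
  rewrite /biasH; apply: addr_ge0 => //; apply: addr_ge0 => //.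
  by apply: mulr_ge0 => //; apply: divr_ge0 => //; exact: addr_ge0.
set w := W 0 x; set D := ydel delta x - ydel 0 x; pose z := row_mx 0 D : 'rV[R]_(dx + dy).
have Ew : W delta x = w + z by rewrite add_row_mx subrKC addr0.
have nD : enorm D <= delta * (l0 / mu) by rewrite mulrA ydel_near_ystar// ltW.
have nz : enorm z <= delta * (l0 / mu) by rewrite enorm_row_0mx.
have sz : sq z <= (delta * (l0 / mu)) ^+ 2.
  by apply: enorm_le_sq => //; rewrite mulr_ge0// ltW.
have err (q : 'rV[R]_(dx + dy)) : `|dot (gG (w + z) - gG w) q - dot (z *m JG w) q|
    <= hG * (delta * (l0 / mu)) ^+ 2 * enorm q.
  rewrite -dotBl; apply: le_trans (dot_le_enorm _ _) _.
  rewrite ler_wpM2r ?enorm_ge0//; apply: le_trans (gG_taylor _ _) _.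
  by rewrite ler_wpM2l.
have errF (q : 'rV[R]_(dx + dy)) : `|dot (gF (w + z)) q - dot (gF w) q|
    <= lF * (delta * (l0 / mu)) * enorm q.
  rewrite -dotBl; apply: le_trans (dot_le_enorm _ _) _.
  rewrite ler_wpM2r ?enorm_ge0//; apply: le_trans (gF_lip _ _) _.
  by rewrite addrAC subrr add0r ler_wpM2l.
pose zeta := D + delta *: nu x.
pose B := lF * (l0 / mu) + hG * (l0 / mu) ^+ 2.
have nzeta : enorm zeta <= delta ^+ 2 * B / mu.
  have P := JG_pos x (ydel 0 x) zeta; rewrite -/(W 0 x) -/w in P.
  have E : dot (row_mx 0 zeta *m JG w) (row_mx 0 zeta)
     = dot (z *m JG w) (row_mx 0 zeta) + delta * dot (gF w) (row_mx 0 zeta).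
    rewrite -nuP -dotZl -dotDl scalemxAl -mulmxDl; congr (dot (_ *m _) _).
    by rewrite scale_row_mx add_row_mx scaler0 addr0.
  have e1 := err (row_mx 0 zeta); have e2 := errF (row_mx 0 zeta).
  have s1 := ydel_stationary x zeta (ltW d0).
  rewrite dotBl {2}/w ystar_stationary subr0 enorm_row_0mx in e1.
  rewrite enorm_row_0mx in e2; rewrite Ew in s1.
  rewrite E in P.
  rewrite ler_pdivlMr// mulrC.
  have [->|Dn] := eqVneq (enorm zeta) 0.
    by rewrite mulr0 mulr_ge0 ?sqr_ge0// addr_ge0.
  have Dp : 0 < enorm zeta by rewrite lt_def Dn enorm_ge0.
  rewrite -(ler_pM2r Dp) -mulrA -expr2 enorm_sq /B.
  apply: le_trans P _.
  move: e1 e2; rewrite !ler_norml => /andP[a1 a2] /andP[a3 a4].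
  have := ler_wpM2l (ltW d0) a3; move: s1 a1; lra.
have zE (q : 'rV[R]_(dx + dy)) : dot (z *m JG w) q
   = dot (row_mx 0 zeta *m JG w) q - delta * dot (row_mx 0 (nu x) *m JG w) q.
  rewrite -dotZl -dotBl scalemxAl -mulmxBl; congr (dot (_ *m _) _).
  by rewrite scale_row_mx sub_row_mx scaler0 subr0 /zeta addrK.
apply: enorm_le_dual; last by rewrite mulr_ge0// ltW.
move=> u; set q := row_mx u 0 : 'rV[R]_(dx + dy).
have E : dot (hypergrad_del delta x - hypergrad x) u
  = (dot (gF (w + z)) q - dot (gF w) q)
    + delta^-1 * (dot (gG (w + z) - gG w) q + delta * dot (row_mx 0 (nu x) *m JG w) q).
  rewrite /hypergrad_del /hypergrad Ew -/w dotBl dotDl dotZl !dotBl.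
  rewrite /q !dot_row_mxr !dot0r !addr0; field; exact: lt0r_neq0.
have dz : dot (row_mx 0 zeta *m JG w) q <= lG * (delta ^+ 2 * B / mu) * enorm q.
  apply: le_trans (ler_norm _) _; apply: le_trans (dot_le_enorm _ _) _.
  rewrite ler_wpM2r ?enorm_ge0//; apply: le_trans (JG_bound _ _) _.
  by rewrite enorm_row_0mx ler_wpM2l// ltW.
have := err q; have := errF q; rewrite zE !ler_norml => /andP[_ e1] /andP[_ e2].
have e3 : dot (gG (w + z) - gG w) q + delta * dot (row_mx 0 (nu x) *m JG w) q
   <= delta * (delta * ((lG * (B / mu) + hG * (l0 / mu) ^+ 2) * enorm q)).
  have -> : delta * (delta * ((lG * (B / mu) + hG * (l0 / mu) ^+ 2) * enorm q))
    = lG * (delta ^+ 2 * B / mu) * enorm q + hG * (delta * (l0 / mu)) ^+ 2 * enorm q.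
    ring.
  lra.
rewrite E -(enorm_row_mx0 u (d2 := dy)) -/q.
have : delta^-1 * (dot (gG (w + z) - gG w) q + delta * dot (row_mx 0 (nu x) *m JG w) q)
   <= delta * ((lG * (B / mu) + hG * (l0 / mu) ^+ 2) * enorm q).
  by rewrite ler_pdivrMl.
rewrite /biasH -/B; lra.
Qed.

End Bilevel.

(** * Shortest path coverings and mixing *)

Section Digraph.
Variables (n : nat) (e : rel 'I_n).
Hypothesis e_conn : forall i j, connect e i j.

(** A path realizing [distance] exists by connectivity. Removing its loops cannot make it shorter,
    by minimality of [find], so a repetition-free path of the same length results; without
    repetitions each edge is counted once. *)
Lemma shortest_path x y : exists p : seq 'I_n,
  [/\ dipath e x y p, size p = distance e x y, uniq p & (size p <= n)%N].
Proof.
pose Q m := [exists p : m.-tuple 'I_n, dipath e x y p].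
have QP p : dipath e x y p -> Q (size p).
  by move=> h; apply/existsP; exists (in_tuple p).
have shrt p : dipath e x y p -> exists p', [/\ dipath e x y p',
    (size p' <= size p)%N, uniq p' & (size p' < n)%N].
  move=> /andP[pp /eqP lp].
  case/shortenP: pp lp => p' pp' up' sp lp.
  exists p'; split.
  - by rewrite /dipath pp' lp eqxx.
  - by rewrite uniq_leq_size//; case/andP: up'.
  - by case/andP: up'.
  - by have := max_card (mem (x :: p')); rewrite card_ord (card_uniqP up').
have [p0 hp0] : exists p, dipath e x y p.
  by have /connectP[p pp lp] := e_conn x y; exists p; rewrite /dipath pp lp eqxx.
have [p1 [hp1 _ _ p1n]] := shrt _ hp0.
have hasQ : has Q (iota 0 n).
  by apply/hasP; exists (size p1); [rewrite mem_iota | exact: QP].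
have dn : (distance e x y < n)%N by rewrite -[X in (_ < X)%N](size_iota 0) -has_find.
have := nth_find 0%N hasQ; rewrite nth_iota// add0n => /existsP[p hp].
have [p' [hp' sp' up' p'n]] := shrt _ hp.
exists p'; split => //; last exact: ltnW.
apply/eqP; rewrite eqn_leq; apply/andP; split; first by rewrite size_tuple in sp'.
rewrite leqNgt; apply/negP => lt.
have := before_find 0%N lt; rewrite nth_iota// add0n.
by move=> h; have := QP _ hp'; rewrite /Q h.
Qed.

Lemma exists_covering : exists2 P : path_family n, shortest_path_covering e P &
  forall u, [/\ dipath e u.1 u.2 (P u), uniq (P u)
    & size (P u) = distance e u.1 u.2].
Proof.
have H (u : 'I_n * 'I_n) : exists b : n.-bseq 'I_n,
    [/\ dipath e u.1 u.2 b, uniq b & size b = distance e u.1 u.2].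
  have [p [h1 h2 h3 h4]] := shortest_path u.1 u.2.
  by exists (Bseq h4); split.
have [f hf] := fin_all_exists H.
exists [ffun u => f u]; last by move=> u; rewrite ffunE.
apply/forallP => u; apply/implyP => _; rewrite ffunE.
by have [-> _ ->] := hf u; rewrite eqxx.
Qed.

Context {R : realType} {d : nat}.

(** Cauchy-Schwarz along the path, by induction: Young's inequality with parameter the number k of
    remaining edges reproduces the factor exactly, as (1 + 1/k) k = 1 + k. *)
Lemma path_telescope (xi : 'I_n -> 'rV[R]_d) x p :
  sq (xi x - xi (last x p)) <=
  (size p)%:R * \sum_(ed <- path_edges x p) sq (xi ed.1 - xi ed.2).
Proof.
elim: p x => [|y p IH] x; first by rewrite subrr sq0 mul0r.
rewrite /path_edges /= big_cons /= -/(path_edges y p).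
set S := \sum_(_ <- _) _ in IH *.
have {IH} := IH y; rewrite -/(path_edges y p) -/S.
have S0 : 0 <= S by apply: sumr_ge0 => ed _; exact: sq_ge0.
have -> : xi x - xi (last y p) = (xi x - xi y) + (xi y - xi (last y p)).
  by rewrite addrA subrK.
case: p @S S0 => [|z p] S S0 IH.
  by rewrite subrr addr0 mul1r lerDl.
set k : R := (size (z :: p))%:R in IH *.
have k0 : 0 < k by rewrite ltr0n.
apply: le_trans (sqD_young _ _ k0) _.
have -> : (size (z :: p)).+1%:R = 1 + k :> R by rewrite -natr1 addrC.
rewrite mulrDr lerD2l.
have -> : (1 + k) * S = (1 + k^-1) * (k * S).
  by field; rewrite gt_eqF.
by rewrite ler_wpM2l// addr_ge0// invr_ge0 ltW.
Qed.

Lemma path_edges_edge x p ed : path e x p -> ed \in path_edges x p ->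
  e ed.1 ed.2.
Proof.
elim: p x => [//|y p IH] x /= /andP[exy py].
rewrite /path_edges /= inE -/(path_edges y p) => /orP[/eqP -> //|].
exact: IH.
Qed.

Lemma path_edges_uniq x (p : seq 'I_n) : uniq p -> uniq (path_edges x p).
Proof.
elim: p x => [//|y p IH] x /= /andP[yp up].
rewrite /path_edges /= -/(path_edges y p) IH// andbT.
apply: contra yp => /(map_f snd) /=; rewrite /path_edges.
apply: mem_subseq; elim: p {IH up} y => [//|z p IH] y /=.
by rewrite eqxx; exact: IH.
Qed.

(* Each ordered pair is joined by its path of the covering, and an edge is
   used by at most max_utility of these paths. *)
Lemma digraph_poincare (xi : 'I_n -> 'rV[R]_d) :
  \sum_i \sum_j sq (xi i - xi j) <=
  (diameter e)%:R * (max_utility e)%:R *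
  \sum_i \sum_(j | e j i) sq (xi j - xi i).
Proof.
have [P cP hP] := exists_covering.
pose w (ed : 'I_n * 'I_n) := sq (xi ed.1 - xi ed.2).
have w0 ed : 0 <= w ed by exact: sq_ge0.
pose pe u := path_edges u.1 (P u).
rewrite (eq_bigr (fun i => \sum_(j | predT j) sq (xi i - xi j)))//.
rewrite (pair_big_dep predT (fun _ _ => true) (fun i j => sq (xi i - xi j))) /=.
rewrite -/(diameter e).
have E2 : \sum_i \sum_(j | e j i) sq (xi j - xi i) = \sum_(ed | e ed.1 ed.2) w ed.
  rewrite (exchange_big_dep predT)//= pair_big_dep /=.
  exact: eq_bigl.
rewrite E2 (bigID (fun u => u.1 != u.2)) /= [X in _ + X]big1 ?addr0; last first.
  by move=> u; rewrite negbK => /eqP ->; rewrite subrr sq0.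
apply: le_trans (_ : \sum_(u : 'I_n * 'I_n | u.1 != u.2)
    (diameter e)%:R * \sum_(ed | e ed.1 ed.2 && (ed \in pe u)) w ed <= _).
  apply: ler_sum => u _; have [/andP[pp /eqP lp] up sp] := hP u.
  rewrite -lp; apply: le_trans (path_telescope _ _ _) _.
  rewrite big_uniq ?path_edges_uniq//=.
  have -> : \sum_(ed in path_edges u.1 (P u)) sq (xi ed.1 - xi ed.2)
     = \sum_(ed | e ed.1 ed.2 && (ed \in pe u)) w ed.
    apply: eq_bigl => ed; rewrite -/(pe u).
    case: (boolP (ed \in pe u)) => h; rewrite ?andbF// andbT.
    by rewrite (path_edges_edge pp h).
  rewrite ler_wpM2r ?sumr_ge0// ler_nat sp.
  exact: (@leq_bigmax _ (fun u => distance e u.1 u.2) u).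
rewrite -mulr_sumr -mulrA ler_wpM2l//.
rewrite (eq_bigr (fun u => \sum_(ed | e ed.1 ed.2) if ed \in pe u then w ed else 0));
  last by move=> u _; rewrite big_mkcondr.
rewrite exchange_big /= mulr_sumr; apply: ler_sum => ed eed.
rewrite -big_mkcondr /= sumr_const -[leLHS]mulr_natl  ler_wpM2r// ler_nat.
apply: leq_trans (_ : (covering_utility e P <= _)%N).
  exact: (@leq_bigmax_cond _ (fun ed => e ed.1 ed.2) (fun ed =>
    #|[pred u : 'I_n * 'I_n | (u.1 != u.2) && (ed \in path_edges u.1 (P u))]|)).
exact: (@leq_bigmax_cond _ (shortest_path_covering e) (covering_utility e)).
Qed.

Lemma exists_out_edge (hn : (2 <= n)%N) i : exists2 j, j != i & e i j.
Proof.
have [k ki] : exists k : 'I_n, k != i.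
  have n0 : (0 < n)%N by exact: ltnW.
  have [i0|i0] := eqVneq (val i) 0%N.
    by exists (Ordinal hn); apply/eqP => h; move: i0; rewrite -h.
  by exists (Ordinal n0); apply/eqP => h; move: i0; rewrite -h.
have [p [/andP[pp /eqP lp] _ up _]] := shortest_path i k.
have /connectP[q pq lq] := e_conn i k.
case/shortenP: pq lq => [[|j q']] /=; first by move=> _ _ _ h; rewrite h eqxx in ki.
move=> /andP[eij _] /andP[ij _] _ _; exists j => //.
by move: ij; rewrite inE negb_or eq_sym => /andP[].
Qed.

Lemma distance_le i j : (distance e i j <= n)%N.
Proof. by rewrite -[X in (_ <= X)%N](size_iota 0) find_size. Qed.

Lemma diameter_le : (diameter e <= n)%N.
Proof. by apply/bigmax_leqP => u _; exact: distance_le. Qed.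

(** Together with [diameter_le], a bound in n alone; it keeps the mixing rates away from 0 uniformly
    over the changing graphs. *)
Lemma max_utility_le : (max_utility e <= n * n)%N.
Proof.
apply/bigmax_leqP => P _; apply/bigmax_leqP => ed _.
by apply: leq_trans (max_card _) _; rewrite card_prod card_ord.
Qed.

End Digraph.


(** * Weighted means and variances *)

Section WeightedVariance.
Context {R : realType} {n d : nat}.
Implicit Types (p : 'I_n -> R) (xi zeta : 'I_n -> 'rV[R]_d) (u : 'rV[R]_d).

Definition wmean p xi : 'rV[R]_d := \sum_i p i *: xi i.

Definition wvar p xi : R := \sum_i p i * sq (xi i - wmean p xi).

Lemma wvar_ge0 p xi : (forall i, 0 <= p i) -> 0 <= wvar p xi.
Proof. by move=> p0; apply: sumr_ge0 => i _; rewrite mulr_ge0 ?sq_ge0. Qed.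

Lemma wvar_decomp p xi u : \sum_i p i = 1 ->
  \sum_i p i * sq (xi i - u) = sq (wmean p xi - u) + wvar p xi.
Proof.
move=> p1; set m := wmean p xi.
have E i : p i * sq (xi i - u) = p i * sq (xi i - m)
    + (2 * (p i * dot (xi i - m) (m - u)) + p i * sq (m - u)).
  have -> : xi i - u = (xi i - m) + (m - u) by rewrite addrA subrK.
  rewrite sqD; ring.
rewrite (eq_bigr _ (fun i _ => E i)) !big_split /= -!mulr_sumr -mulr_suml p1 mul1r.
have -> : \sum_i p i * dot (xi i - m) (m - u) = 0.
  rewrite (eq_bigr (fun i => dot (p i *: xi i - p i *: m) (m - u))).
    rewrite -dot_suml sumrB -scaler_suml p1 scale1r -/(wmean p xi) -/m subrr.
    by rewrite dot0l.
  by move=> i _; rewrite -scalerBr dotZl.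
by rewrite mulr0 add0r addrC.
Qed.

Lemma wvar_le p xi u : \sum_i p i = 1 ->
  wvar p xi <= \sum_i p i * sq (xi i - u).
Proof. by move=> p1; rewrite (wvar_decomp _ _ p1) lerDr sq_ge0. Qed.

Lemma sq_wmean_le p xi : (forall i, 0 <= p i) -> \sum_i p i = 1 ->
  sq (wmean p xi) <= \sum_i p i * sq (xi i).
Proof.
move=> p0 p1; have := wvar_decomp xi 0 p1; rewrite subr0.
under eq_bigr do rewrite subr0.
by move=> ->; rewrite lerDl wvar_ge0.
Qed.

Lemma wvar_pairs p xi : \sum_i p i = 1 ->
  2 * wvar p xi = \sum_i \sum_j p i * p j * sq (xi i - xi j).
Proof.
move=> p1.
rewrite (eq_bigr (fun i => p i * (sq (xi i - wmean p xi) + wvar p xi))); last first.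
  move=> i _; rewrite (sqBC (xi i)) -(wvar_decomp xi (xi i) p1) mulr_sumr.
  by apply: eq_bigr => j _; rewrite sqBC mulrA.
under eq_bigr do rewrite mulrDr.
rewrite big_split /= -mulr_suml p1 -/(wvar p xi); ring.
Qed.

(** Weighted Cauchy-Schwarz with A and S as in the proof: the nonnegative sum of p_i |A xi_i - (c_i
    / p_i) S|^2 expands to A times the difference of the two sides. *)
Lemma sq_sum_weighted (c : 'I_n -> R) p xi : (forall i, 0 < p i) ->
  sq (\sum_i c i *: xi i) <= (\sum_i c i ^+ 2 / p i) * \sum_i p i * sq (xi i).
Proof.
move=> p0; set A := \sum_i c i ^+ 2 / p i; set S := \sum_i c i *: xi i.
have A0 : 0 <= A by apply: sumr_ge0 => i _; rewrite divr_ge0 ?sqr_ge0// ltW.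
have T0 : 0 <= \sum_i p i * sq (xi i).
  by apply: sumr_ge0 => i _; rewrite mulr_ge0 ?sq_ge0// ltW.
have [Az|An] := eqVneq A 0.
  have c0 i : c i = 0.
    move: Az => /eqP; rewrite psumr_eq0; last first.
      by move=> j _; rewrite divr_ge0 ?sqr_ge0// ltW.
    move=> /allP /(_ i (mem_index_enum _)) /=.
    by rewrite mulf_eq0 invr_eq0 (gt_eqF (p0 i)) orbF expf_eq0 /= => /eqP.
  rewrite /S big1 ?sq0 ?mulr_ge0// => i _; by rewrite c0 scale0r.
have Ap : 0 < A by rewrite lt_def An.
have : 0 <= \sum_i p i * sq (A *: xi i - (c i / p i) *: S).
  by apply: sumr_ge0 => i _; rewrite mulr_ge0 ?sq_ge0// ltW.
have E i : p i * sq (A *: xi i - (c i / p i) *: S) =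
   A ^+ 2 * (p i * sq (xi i)) - 2 * A * dot (c i *: xi i) S + (c i ^+ 2 / p i) * sq S.
  rewrite sqB !sqZ !dotZl !dotZr; field; exact: lt0r_neq0.
rewrite (eq_bigr _ (fun i _ => E i)) big_split sumrB /= -!mulr_sumr -mulr_suml.
rewrite -dot_suml -/S -/(sq S) -/A.
have -> : A ^+ 2 * (\sum_i p i * sq (xi i)) - 2 * A * sq S + A * sq S
  = A * (A * (\sum_i p i * sq (xi i)) - sq S) by ring.
by rewrite pmulr_rge0// subr_ge0.
Qed.

End WeightedVariance.

(** * Row-stochastic mixing and its contraction rate *)

Section Mixing.
Context {R : realType} {n : nat}.
Variables (e : rel 'I_n) (W : 'M[R]_n) (p q : 'I_n -> R) (omega pmax c a : R).
Hypothesis e_conn : forall i j, connect e i j.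
Hypothesis W_ge0 : forall i j, 0 <= W i j.
Hypothesis W_stoch : forall i, \sum_j W i j = 1.
Hypotheses (p_ge0 : forall i, 0 <= p i) (p_sum : \sum_i p i = 1).
Hypotheses (q_ge0 : forall i, 0 <= q i) (q_sum : \sum_i q i = 1).
Hypothesis qW : forall j, \sum_i q i * W i j = p j.
Hypothesis omega_ge0 : 0 <= omega.
Hypothesis omega_le : forall i j, e j i -> omega <= q i * W i i * W i j.
Hypothesis pmax_ge : forall i, p i <= pmax.
Hypothesis c_le :
  c * (pmax ^+ 2 * (diameter e)%:R * (max_utility e)%:R) <= omega.
Hypotheses (a0 : 0 < a) (W_diag : forall i, a <= W i i).
Context {d : nat}.
Implicit Types (xi zeta : 'I_n -> 'rV[R]_d).

Definition mix xi (i : 'I_n) : 'rV[R]_d := \sum_j W i j *: xi j.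

(** The variance lost by mixing is kept as a quantity of its own: part of it contracts the consensus
    error, the rest pays for the movement of the agents, which excites the trackers. *)
Definition mix_drop xi : R :=
  wvar p xi - \sum_i q i * sq (mix xi i - wmean p xi).

(** Law of total variance: drawing a row i with law q and then an agent with law W i gives the law
    p. *)
Lemma mix_dropE xi : mix_drop xi = \sum_i q i * wvar (W i) xi.
Proof.
rewrite /mix_drop {1}/wvar.
under eq_bigr do rewrite -qW mulr_suml.
rewrite exchange_big /= -sumrB; apply: eq_bigr => i _.
under eq_bigr do rewrite -mulrA.
rewrite -mulr_sumr wvar_decomp// -/(mix xi i); ring.
Qed.

Lemma mix_drop_ge0 xi : 0 <= mix_drop xi.
Proof.
by rewrite mix_dropE; apply: sumr_ge0 => i _; rewrite mulr_ge0 ?wvar_ge0.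
Qed.

Lemma mix_drop_le xi : mix_drop xi <= wvar p xi.
Proof.
by rewrite /mix_drop lerBlDr lerDl sumr_ge0// => i _; rewrite mulr_ge0 ?sq_ge0.
Qed.

(** Agent i takes part in its own average with weight at least a; of the variance of row i only that
    term is kept. *)
Lemma mix_move_le xi : a * (\sum_i q i * sq (mix xi i - xi i)) <= mix_drop xi.
Proof.
rewrite mix_dropE mulr_sumr; apply: ler_sum => i _.
rewrite mulrCA ler_wpM2l// /wvar (bigD1 i)//= -/(mix xi i) sqBC.
apply: le_trans (_ : W i i * sq (xi i - mix xi i) <= _).
  by rewrite ler_wpM2r ?sq_ge0.
by rewrite lerDl sumr_ge0// => j _; rewrite mulr_ge0 ?sq_ge0.
Qed.

Lemma mix_drop_edges xi :
  omega * (\sum_i \sum_(j | e j i) sq (xi j - xi i)) <= mix_drop xi.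
Proof.
rewrite mix_dropE mulr_sumr; apply: ler_sum => i _.
rewrite -(@ler_pM2l _ 2)// mulrCA [leRHS]mulrCA wvar_pairs//.
have pos j k : 0 <= W i j * W i k * sq (xi j - xi k).
  by rewrite !mulr_ge0 ?sq_ge0.
(* Only the pairs of neighbours containing i itself are kept. *)
have low : 2 * (\sum_j W i i * W i j * sq (xi j - xi i)) <=
    \sum_j \sum_k W i j * W i k * sq (xi j - xi k).
  set S := \sum_j W i i * W i j * sq (xi j - xi i).
  have SE : S = \sum_(j | j != i) W i i * W i j * sq (xi j - xi i).
    by rewrite /S (bigD1 i)//= subrr sq0 mulr0 add0r.
  rewrite mulr_natl mulr2n [leRHS](bigD1 i)//=; apply: lerD.
    by apply: ler_sum => j _; rewrite sqBC.
  rewrite SE; apply: ler_sum => j _; rewrite (bigD1 i)//= (mulrC (W i i)) lerDl.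
  exact: sumr_ge0.
apply: le_trans (ler_wpM2l (q_ge0 i) low).
rewrite [leLHS]mulrCA [leRHS]mulrCA ler_wpM2l// !mulr_sumr.
rewrite [leRHS](bigID (e^~ i)) /=.
apply: le_trans (_ : \sum_(j | e j i) q i * (W i i * W i j * sq (xi j - xi i)) <= _).
  by apply: ler_sum => j eji; rewrite !mulrA ler_wpM2r ?sq_ge0// omega_le.
by rewrite lerDl sumr_ge0// => j _; rewrite !mulr_ge0 ?sq_ge0.
Qed.

Hypothesis c_ge0 : 0 <= c.

Lemma mix_drop_var xi : 2 * c * wvar p xi <= mix_drop xi.
Proof.
apply: le_trans (mix_drop_edges xi).
set E := \sum_i _; have E0 : 0 <= E.
  by apply: sumr_ge0 => i _; apply: sumr_ge0 => j _; exact: sq_ge0.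
apply: le_trans (ler_wpM2r E0 c_le).
rewrite (mulrC 2) -!mulrA ler_wpM2l// wvar_pairs//.
apply: le_trans (_ : pmax ^+ 2 * \sum_i \sum_j sq (xi i - xi j) <= _).
  rewrite mulr_sumr; apply: ler_sum => i _; rewrite mulr_sumr.
  apply: ler_sum => j _; rewrite ler_wpM2r ?sq_ge0// expr2.
  by rewrite ler_pM.
rewrite mulrA -expr2 ler_wpM2l ?sqr_ge0// mulrA; exact: digraph_poincare.
Qed.

(** Young's inequality with parameter c: by [mix_drop_var] half of the drop is at least c times the
    variance, which absorbs the factor 1 + c. *)
Lemma mix_step xi xi' zeta : 0 < c -> c <= 1 ->
  (forall i, xi' i = mix xi i + zeta i) ->
  wvar q xi' <= wvar p xi - mix_drop xi / 2 + 2 / c * \sum_i q i * sq (zeta i).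
Proof.
move=> c0 c1 xiE.
apply: le_trans (wvar_le _ (wmean p xi) q_sum) _.
have c2 : 1 + c^-1 <= 2 / c.
  by rewrite ler_pdivlMr// mulrDl mulVf ?gt_eqF//; lra.
apply: le_trans (_ : (1 + c) * (\sum_i q i * sq (mix xi i - wmean p xi))
   + 2 / c * \sum_i q i * sq (zeta i) <= _).
  rewrite !mulr_sumr -big_split; apply: ler_sum => i _ /=.
  rewrite xiE addrAC mulrCA (mulrCA (2 / c)) -mulrDr ler_wpM2l//.
  apply: le_trans (sqD_young _ _ c0) _.
  by rewrite lerD2l ler_wpM2r ?sq_ge0.
rewrite lerD2r.
have := mix_drop_var xi; have := mix_drop_ge0 xi.
have -> : \sum_i q i * sq (mix xi i - wmean p xi) = wvar p xi - mix_drop xi.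
  by rewrite /mix_drop; ring.
have := mulr_ge0 c_ge0 (mix_drop_ge0 xi); lra.
Qed.

End Mixing.

Section MixingRate.
Context {R : realType} {n : nat}.
Variables (e : rel 'I_n) (W : 'M[R]_n) (p q : 'I_n -> R) (omega pmax : R).
Hypothesis hn : (2 <= n)%N.
Hypothesis e_conn : forall i j, connect e i j.
Hypothesis W_ge0 : forall i j, 0 <= W i j.
Hypothesis W_stoch : forall i, \sum_j W i j = 1.
Hypotheses (p_gt0 : forall i, 0 < p i) (p_sum : \sum_i p i = 1).
Hypotheses (q_ge0 : forall i, 0 <= q i) (q_sum : \sum_i q i = 1).
Hypothesis qW : forall j, \sum_i q i * W i j = p j.
Hypothesis omega_ge0 : 0 <= omega.
Hypothesis omega_le : forall i j, e j i -> omega <= q i * W i i * W i j.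
Hypothesis pmax_ge : forall i, p i <= pmax.

(** The indicator of agent 1: [hn] read as 1 < n gives this index, and [ltnW hn] gives agent 0,
    where it vanishes. A nonconstant test family forces the Poincare constant to be positive. *)
Let bump (i : 'I_n) : 'rV[R]_1 := const_mx (i == Ordinal hn)%:R.

Let bump_pairs : 0 < \sum_i \sum_j sq (bump i - bump j).
Proof.
pose o : 'I_n := Ordinal (ltnW hn).
rewrite (bigD1 o)//= (bigD1 (Ordinal hn))//= -addrA ltr_wpDr//.
  apply: addr_ge0; apply: sumr_ge0 => i _; first exact: sq_ge0.
  by apply: sumr_ge0 => j _; exact: sq_ge0.
by rewrite /sq /dot big_ord1 !mxE eqxx /= sub0r mulrNN mulr1.
Qed.

Lemma diameter_utility_gt0 : 0 < (diameter e)%:R * (max_utility e)%:R :> R.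
Proof.
rewrite lt_def mulr_ge0// andbT; apply/negP => /eqP h.
have := digraph_poincare e_conn bump; rewrite h mul0r leNgt.
by rewrite bump_pairs.
Qed.

(** The drop is at least 2 c times the variance but never exceeds the variance, which is positive
    for [bump]. *)
Lemma mix_rate_le : omega /
  (pmax ^+ 2 * (diameter e)%:R * (max_utility e)%:R) <= 1 / 2.
Proof.
set c := omega / _.
have pm0 : 0 < pmax by exact: lt_le_trans (p_gt0 (Ordinal hn)) (pmax_ge _).
have D0 : 0 < pmax ^+ 2 * (diameter e)%:R * (max_utility e)%:R.
  by rewrite -mulrA mulr_gt0 ?exprn_gt0 ?diameter_utility_gt0.
have c0 : 0 <= c by rewrite divr_ge0// ltW.
have cle : c * (pmax ^+ 2 * (diameter e)%:R * (max_utility e)%:R) <= omega.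
  by rewrite /c divfK// gt_eqF.
have p_ge0 i : 0 <= p i by rewrite ltW.
have V : 2 * c * wvar p bump <= mix_drop W p q bump.
  exact: (@mix_drop_var _ _ e _ _ _ omega pmax).
have {}V := le_trans V (mix_drop_le W p q_ge0 bump).
have vp : 0 < wvar p bump.
  rewrite -(@pmulr_rgt0 _ 2)// wvar_pairs//.
  pose o : 'I_n := Ordinal (ltnW hn).
  rewrite (bigD1 o)//= (bigD1 (Ordinal hn))//= -addrA ltr_wpDr//.
    apply: addr_ge0; apply: sumr_ge0 => i _; first by rewrite !mulr_ge0 ?sq_ge0.
    by apply: sumr_ge0 => j _; rewrite !mulr_ge0 ?sq_ge0.
  rewrite /sq /dot big_ord1 !mxE eqxx /= sub0r mulrNN !mulr1.
  by rewrite mulr_gt0.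
have : 2 * c * wvar p bump <= 1 * wvar p bump by rewrite mul1r.
rewrite ler_pM2r//; lra.
Qed.

End MixingRate.

(** * Descent with a decaying perturbation *)

Ltac nonneg := lazymatch goal with
  | |- is_true (0 <= _ + _) => apply: addr_ge0; nonneg
  | |- is_true (0 <= _ * _) => apply: mulr_ge0; nonneg
  | |- is_true (0 <= _^-1) => rewrite invr_ge0; nonneg
  | |- is_true (0 <= _ ^+ 2) => exact: sqr_ge0
  | |- is_true (0 <= _ ^+ _) => apply: exprn_ge0; nonneg
  | |- _ => first [assumption | exact: ler0n | by apply: ltW | done]
  end.

Section DescentSequence.
Context {R : realType}.

Lemma telescope_sum (U x : nat -> R) (y : R) (K : nat) :
  (forall k, (k < K)%N -> U k.+1 + x k <= U k + y) ->
  U K + \sum_(0 <= k < K) x k <= U 0%N + K%:R * y.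
Proof.
elim: K => [|K IH] H; first by rewrite big_nil mul0r !addr0.
have h1 := IH (fun k kK => H k (ltnW kK)); have h2 := H K (ltnSn K).
rewrite big_nat_recr//= -natr1 mulrDl mul1r; lra.
Qed.

Variables (a0 theta C Phi0 M0 : R).
Hypotheses (a00 : 0 < a0) (theta0 : 0 < theta) (theta1 : theta <= 1).
Hypotheses (C0 : 0 <= C) (M00 : 0 <= M0).

(* M is the error Lyapunov function, D its dissipation, G the perturbation of
   the descent direction. The error is O(1) initially, while its driven part is
   only O(delta); the transient part is majorized by the square of the
   geometric sequence varpi, and only the excess enters the Lyapunov function. *)
Section Step.
Variables (delta a Phi Phi' M M' D u G varpi : R).
Hypotheses (d0 : 0 < delta) (d1 : delta <= 1) (aa0 : a0 <= a).
Hypotheses (M_ge0 : 0 <= M) (M'_ge0 : 0 <= M') (G_ge0 : 0 <= G) (v0 : 0 < varpi).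
Hypothesis h1 : M' <= M - D + a / 4 * delta ^+ 2 * u ^+ 2 + C * delta ^+ 4.
Hypothesis h2 : Phi' <= Phi - a * delta * u ^+ 2 + u * G + C * G ^+ 2.
Hypothesis h3 : theta * M <= D.
Hypothesis h4 : G ^+ 2 * ((2 * a)^-1 + delta * C) <= D / 2 + C * delta ^+ 4.
Hypothesis h5 : G ^+ 2 <= C * (M + delta ^+ 4).

Let varpi' := (1 - theta / 4) * varpi.
Let Q := Num.max (M - varpi ^+ 2) 0.
Let Q' := Num.max (M' - varpi' ^+ 2) 0.

Lemma descent_step (varpi0 : R) : varpi <= varpi0 ->
  delta * Phi' + Q' <= delta * Phi + Q - a0 / 4 * delta ^+ 2 * u ^+ 2
    + delta * ((1 / 2 + C + 2 * C ^+ 2 * varpi0) * varpi * (1 + u ^+ 2))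
    + (C / a0 + C ^+ 2 + 2 * C) * delta ^+ 4.
Proof.
move=> v1.
have ap : 0 < a by exact: lt_le_trans aa0.
have d40 : 0 <= delta ^+ 4 by rewrite exprn_ge0// ltW.
have du0 : 0 <= delta ^+ 2 * u ^+ 2 by rewrite mulr_ge0 ?sqr_ge0.
have f0 : 0 <= a / 4 * delta ^+ 2 * u ^+ 2 + C * delta ^+ 4.
  by nonneg.
set f := _ + _ in f0; have h1' : M' <= M - D + f by rewrite /f; move: h1; lra.
have adu : a0 * (delta ^+ 2 * u ^+ 2) <= a * (delta ^+ 2 * u ^+ 2).
  by rewrite ler_wpM2r.
have Cd : 0 <= C * delta ^+ 4 by rewrite mulr_ge0.
have Cda : 0 <= C / a0 * delta ^+ 4 by rewrite mulr_ge0// divr_ge0// ltW.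
have C2d : 0 <= C ^+ 2 * delta ^+ 4 by rewrite mulr_ge0 ?sqr_ge0.
have v00 : 0 <= varpi0 by apply: le_trans v1; exact: ltW.
have cv : 0 <= delta * ((1 / 2 + C + 2 * C ^+ 2 * varpi0) * varpi * (1 + u ^+ 2)).
  by nonneg.
(* The majorant varpi^2 loses at most the fraction theta / 2 per step, less than the fraction theta
   that M loses, so the transient of M stays below it. *)
have P' : (1 - theta / 2) * varpi ^+ 2 <= varpi' ^+ 2.
  rewrite /varpi' exprMn ler_wpM2r ?sqr_ge0//.
  by have := sqr_ge0 theta; rewrite -subr_ge0; lra.
have tM : 0 <= theta * M by nonneg.
(* If M exceeds twice the majorant, Q inherits half of the dissipation D, which pays for u G through
   Young's inequality with weight a delta. Otherwise G^2 is O(varpi^2 + delta^4) and the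
   perturbation is charged to the transient. *)
have [MP|MP] := ltP (2 * varpi ^+ 2) M.
  have QE : Q = M - varpi ^+ 2.
    by apply/max_idPl; have := sqr_ge0 varpi; lra.
  have Q'le : Q' <= Q - D / 2 + f.
    have vv : theta / 2 * varpi ^+ 2 <= theta / 4 * M.
      by have := ltW (_ : 0 < theta * (M - 2 * varpi ^+ 2)); rewrite mulr_gt0 ?subr_gt0//; lra.
    rewrite /Q' ge_max; apply/andP; split; rewrite QE; first by move: h1' h3 vv P' tM; lra.
    by move: M'_ge0 h1' f0; lra.
  have yng : u * G <= a * delta / 2 * u ^+ 2 + (2 * a * delta)^-1 * G ^+ 2.
    have := sqr_ge0 (a * delta * u - G).
    have i0 : 0 <= (2 * a * delta)^-1 by nonneg.
    move=> /(mulr_ge0 i0).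
    have -> : (2 * a * delta)^-1 * (a * delta * u - G) ^+ 2 =
      a * delta / 2 * u ^+ 2 - u * G + (2 * a * delta)^-1 * G ^+ 2.
      by field; rewrite !gt_eqF.
    lra.
  have dP : delta * Phi' <= delta * Phi - a / 2 * delta ^+ 2 * u ^+ 2
      + G ^+ 2 * ((2 * a)^-1 + delta * C).
    apply: le_trans (ler_wpM2l (ltW d0) h2) _.
    have := ler_wpM2l (ltW d0) yng.
    have e1 : delta * ((2 * a * delta)^-1 * G ^+ 2) = G ^+ 2 * (2 * a)^-1.
      by field; rewrite !gt_eqF.
    rewrite (mulrDr delta (_ * u ^+ 2)) e1; lra.
  move: Q'le dP h4 adu Cd Cda C2d cv; rewrite /f; lra.
have Q'le : Q' <= Q + f.
  have Q0 : 0 <= Q by rewrite /Q le_max lexx orbT.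
  have QM : M - varpi ^+ 2 <= Q by rewrite /Q le_max lexx.
  rewrite /Q' ge_max; apply/andP; split; last by lra.
  have vM := mulr_ge0 (ltW theta0) (sqr_ge0 varpi).
  have [Mv|Mv] := leP (varpi ^+ 2) M.
    have : theta * varpi ^+ 2 <= theta * M by rewrite ler_wpM2l// ltW.
    move=> vM2; apply: le_trans (_ : M - varpi ^+ 2 + f <= _); last by rewrite lerD2r.
    by move: h1' h3 P' vM vM2; lra.
  have : (1 - theta) * M <= (1 - theta) * varpi ^+ 2.
    by rewrite ler_wpM2l ?subr_ge0// ltW.
  move=> vM2; apply: le_trans (_ : f <= _); last by rewrite lerDr.
  by move: h1' h3 P' vM vM2; lra.
have G2 : G ^+ 2 <= C * (2 * varpi ^+ 2 + delta ^+ 4).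
  by apply: le_trans h5 _; rewrite ler_wpM2l// lerD2r.
(* The Young weight is a sum matched to the two parts of G^2: varpi for the transient part, a
   multiple of delta for the delta^4 part. The latter costs only a0 / 4 delta u^2, covered by the
   descent. *)
pose k := varpi + a0 / 2 * delta.
have k0 : 0 < k by rewrite addr_gt0// mulr_gt0// divr_gt0.
have yng : u * G <= k / 2 * u ^+ 2 + (2 * k)^-1 * G ^+ 2.
  have i0 : 0 <= (2 * k)^-1 by nonneg.
  have := mulr_ge0 i0 (sqr_ge0 (k * u - G)).
  have -> : (2 * k)^-1 * (k * u - G) ^+ 2 =
    k / 2 * u ^+ 2 - u * G + (2 * k)^-1 * G ^+ 2.
    by field; rewrite gt_eqF.
  lra.
have Gk : (2 * k)^-1 * G ^+ 2 <= C * varpi + C / a0 * delta ^+ 3.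
  rewrite ler_pdivrMl ?mulr_gt0//; apply: le_trans G2 _.
  have -> : 2 * k * (C * varpi + C / a0 * delta ^+ 3) =
    C * (2 * varpi ^+ 2 + delta ^+ 4) +
    (2 * varpi * (C / a0) * delta ^+ 3 + a0 * delta * C * varpi).
    by rewrite /k; field; rewrite gt_eqF.
  by rewrite lerDl; nonneg.
have CG : C * G ^+ 2 <= 2 * C ^+ 2 * varpi0 * varpi + C ^+ 2 * delta ^+ 3.
  apply: le_trans (ler_wpM2l C0 G2) _.
  have e1 : varpi ^+ 2 <= varpi0 * varpi by rewrite expr2 ler_wpM2r// ltW.
  have e2 : delta ^+ 4 <= delta ^+ 3.
    by rewrite [leLHS]exprS ler_piMl// exprn_ge0// ltW.
  have := ler_wpM2l (sqr_ge0 C) e1; have := ler_wpM2l (sqr_ge0 C) e2; lra.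
have dP : delta * Phi' <= delta * Phi - (a - a0 / 4) * delta ^+ 2 * u ^+ 2
   + delta * (varpi / 2 * u ^+ 2 + (C + 2 * C ^+ 2 * varpi0) * varpi)
   + (C / a0 + C ^+ 2) * delta ^+ 4.
  have := ler_wpM2l (ltW d0) (le_trans h2 (lerD (lerD (lexx _) yng) (lexx _))).
  have := ler_wpM2l (ltW d0) Gk; have := ler_wpM2l (ltW d0) CG.
  by rewrite /k; lra.
have W1 : 0 <= delta * ((C + 2 * C ^+ 2 * varpi0) * varpi * u ^+ 2).
  by nonneg.
have W2 : 0 <= delta * varpi by rewrite mulr_ge0// ltW.
have a0X : 0 <= a0 * (delta ^+ 2 * u ^+ 2) by nonneg.
move: a0X Q'le dP adu Cd Cda C2d W1 W2; rewrite /f; lra.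
Qed.

End Step.

(** M is included in the bounded sum because gradients will be compared at the plain and the
    weighted mean, whose distance M controls. All constants are fixed before K, delta and the
    sequences. *)
Lemma descent_sequence : exists2 C', 0 < C' &
  forall (K : nat) (delta : R) (a Phi M D u G : nat -> R),
    0 < delta -> delta <= 1 -> K%:R * delta ^+ 3 <= C ->
    (forall k, a0 <= a k <= C) -> Phi 0%N <= Phi0 -> M 0%N <= M0 ->
    (forall k, 0 <= Phi k) -> (forall k, 0 <= M k) -> (forall k, 0 <= G k) ->
    (forall k, (k < K)%N -> M k.+1 <=
       M k - D k + a k / 4 * delta ^+ 2 * u k ^+ 2 + C * delta ^+ 4) ->
    (forall k, (k < K)%N -> Phi k.+1 <=
       Phi k - a k * delta * u k ^+ 2 + u k * G k + C * G k ^+ 2) ->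
    (forall k, (k < K)%N -> theta * M k <= D k) ->
    (forall k, (k < K)%N -> G k ^+ 2 * ((2 * a k)^-1 + delta * C) <=
       D k / 2 + C * delta ^+ 4) ->
    (forall k, (k < K)%N -> G k ^+ 2 <= C * (M k + delta ^+ 4)) ->
    (forall k, u k ^+ 2 <= C * Phi k) ->
    \sum_(0 <= k < K) delta * (u k ^+ 2 + M k) <= C'.
Proof.
(* v0 is at least 1 and at least M0, hence M 0 <= v0^2 and the excess Q starts at 0. *)
pose v0 := M0 + 1; have v0p : 0 < v0 by rewrite ltr_wpDl.
pose rho := 1 - theta / 4.
have rho0 : 0 < rho by rewrite /rho; move: theta1; lra.
have rho1 : rho <= 1 by rewrite /rho; move: theta0; lra.
pose C2 := 1 / 2 + C + 2 * C ^+ 2 * v0.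
have C20 : 0 <= C2.
  by rewrite /C2; nonneg.
pose C3 := C / a0 + C ^+ 2 + 2 * C.
have C30 : 0 <= C3.
  by rewrite /C3; nonneg.
(* B solves B rho + B1 = B, so that the weight [expR (B * vp k)] decreases just enough per step to
   absorb the factor 1 + B1 vp k. *)
pose B1 := C2 * (1 + C); pose B := 4 * B1 / theta.
have B10 : 0 <= B1 by rewrite /B1; nonneg.
have B0 : 0 <= B by rewrite /B; nonneg.
have BE : B * rho + B1 = B by rewrite /B /rho; field; rewrite gt_eqF.
pose E := expR (B * v0).
have E0 : 0 < E by exact: expR_gt0.
pose S1 := 4 / a0 * (E * (1 + `|Phi0|) + E * C3 * C).
have S10 : 0 <= S1.
  by rewrite /S1; nonneg.
pose S2 := theta^-1 * (M0 + C / 4 * S1 + C * C).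
have S20 : 0 <= S2.
  by rewrite /S2; nonneg.
exists (S1 + S2 + 1); first by rewrite ltr_wpDl// addr_ge0.
move=> K delta a Phi M D u G d0 d1 Kd aC P0 MM0 Phi_ge0 M_ge0 G_ge0 h1 h2 h3 h4 h5 h6.
pose vp k := rho ^+ k * v0.
have vp0 k : 0 < vp k by rewrite mulr_gt0// exprn_gt0.
have vp1 k : vp k <= v0.
  by rewrite ler_piMl ?(ltW v0p)// exprn_ile1// ltW.
pose Q k := Num.max (M k - vp k ^+ 2) 0.
pose V k := delta * Phi k + Q k.
have Q_ge0 k : 0 <= Q k by rewrite le_max lexx orbT.
have step k : (k < K)%N -> V k.+1 <= V k - a0 / 4 * delta ^+ 2 * u k ^+ 2
    + delta * (C2 * vp k * (1 + u k ^+ 2)) + C3 * delta ^+ 4.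
  move=> kK; have /andP[ak1 ak2] := aC k.
  have vpS : vp k.+1 = (1 - theta / 4) * vp k by rewrite /vp exprS mulrA.
  rewrite /V /Q vpS.
  by apply: (@descent_step delta (a k) (Phi k) (Phi k.+1) (M k) (M k.+1) (D k)
    (u k) (G k)) => //; auto.
(* After division by delta, u^2 <= C Phi <= C w turns the transient term into a relative
   perturbation of w, geometric in k. This is possible because V 0 = delta Phi 0. *)
pose w k := 1 + V k / delta.
have w1 k : 1 <= w k.
  by rewrite lerDl divr_ge0 ?(ltW d0)// addr_ge0// mulr_ge0// ltW.
have wu k : 1 + u k ^+ 2 <= (1 + C) * w k.
  have : Phi k <= V k / delta.
    by rewrite ler_pdivlMr// /V mulrC lerDl.
  move=> /(ler_wpM2l C0); have := h6 k; rewrite /w.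
  have : 0 <= V k / delta.
    by rewrite divr_ge0 ?(ltW d0)// addr_ge0// mulr_ge0// ltW.
  move: C0; lra.
have wstep k : (k < K)%N -> w k.+1 <= (1 + B1 * vp k) * w k + C3 * delta ^+ 3
    - a0 / 4 * delta * u k ^+ 2.
  move=> kK; have := step k kK.
  have Vw j : V j = delta * (w j - 1) by rewrite /w; field; rewrite gt_eqF.
  have := ler_wpM2l (mulr_ge0 C20 (ltW (vp0 k))) (wu k).
  rewrite !Vw => a1 a2; rewrite -(ler_pM2l d0).
  have := ler_wpM2l (ltW d0) a1; rewrite /B1; lra.
pose U k := expR (B * vp k) * w k.
have Ustep k : (k < K)%N -> U k.+1 + a0 / 4 * (delta * u k ^+ 2)
    <= U k + E * C3 * delta ^+ 3.
  move=> kK; set mk := expR (B * vp k.+1).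
  have mk0 : 0 < mk by exact: expR_gt0.
  have mk1 : 1 <= mk.
    by have := expR_ge1Dx (B * vp k.+1); apply: le_trans; rewrite lerDl mulr_ge0// ltW.
  have mkE : mk <= E by rewrite ler_expR ler_wpM2l.
  have m1 : mk * (1 + B1 * vp k) <= expR (B * vp k).
    apply: le_trans (ler_wpM2l (ltW mk0) (expR_ge1Dx (B1 * vp k))) _.
    rewrite -expRD ler_expR /vp exprS.
    have -> : B * (rho * rho ^+ k * v0) + B1 * (rho ^+ k * v0)
      = (B * rho + B1) * (rho ^+ k * v0) by ring.
    by rewrite BE.
  have du : 0 <= a0 / 4 * (delta * u k ^+ 2).
    by rewrite mulr_ge0 ?divr_ge0 ?(ltW a00)// mulr_ge0 ?sqr_ge0// ltW.
  have := ler_wpM2l (ltW mk0) (wstep k kK).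
  have w0 : 0 <= w k by exact: le_trans (w1 k).
  have := ler_wpM2r w0 m1.
  have := ler_wpM2r du mk1.
  have c3 : 0 <= C3 * delta ^+ 3 by rewrite mulr_ge0// exprn_ge0// ltW.
  have := ler_wpM2r c3 mkE.
  rewrite /U -/mk; lra.
have := telescope_sum Ustep.
have U0 : U 0%N <= E * (1 + `|Phi0|).
  rewrite /U /vp expr0 mul1r -/E ler_wpM2l ?(ltW E0)// /w lerD2l.
  have -> : V 0%N = delta * Phi 0%N.
    rewrite /V /Q (max_idPr _) ?addr0// /vp expr0 mul1r subr_le0.
    apply: le_trans MM0 _; rewrite /v0.
    by have := sqr_ge0 M0; move: M00; rewrite sqrrD1; lra.
  rewrite mulrC mulKf ?gt_eqF//; apply: le_trans P0 _; exact: ler_norm.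
have UK : 0 <= U K by rewrite mulr_ge0 ?expR_ge0// (le_trans ler01).
have KC : K%:R * (E * C3 * delta ^+ 3) <= E * C3 * C.
  by rewrite mulrCA ler_wpM2l// mulr_ge0// ltW.
move=> tel; rewrite -mulr_sumr in tel.
have s1 : \sum_(0 <= k < K) delta * u k ^+ 2 <= S1.
  rewrite /S1 -(ler_pM2l (_ : 0 < a0 / 4)) ?divr_gt0//.
  have -> : a0 / 4 * (4 / a0 * (E * (1 + `|Phi0|) + E * C3 * C))
     = E * (1 + `|Phi0|) + E * C3 * C by field; rewrite gt_eqF.
  apply: le_trans (lerD U0 KC); apply: le_trans tel.
  by rewrite lerDr.
(* With the gradients summed, the original recursion for M is summed with weight delta; there
   delta^2 <= 1 suffices in front of u^2. *)
have Mstep k : (k < K)%N -> delta * M k.+1 + (theta * (delta * M k)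
    - C / 4 * (delta * u k ^+ 2)) <= delta * M k + C * delta ^+ 3.
  move=> kK; have := ler_wpM2l (ltW d0) (le_trans (h1 k kK) (lerD (lerD (lerB (lexx _) (h3 k kK)) (lexx _)) (lexx _))).
  have du : 0 <= delta * u k ^+ 2 by rewrite mulr_ge0 ?sqr_ge0// ltW.
  have /andP[ak1 ak2] := aC k.
  have d2 : delta ^+ 2 <= 1 by rewrite exprn_ile1// ltW.
  have e1 : a k * delta ^+ 2 * (delta * u k ^+ 2) <= C * (delta * u k ^+ 2).
    rewrite ler_wpM2r//; apply: le_trans (ler_wpM2r (sqr_ge0 _) ak2) _.
    by rewrite ler_piMr.
  have e2 : C * (delta ^+ 2 * delta ^+ 3) <= C * delta ^+ 3.
    by rewrite ler_wpM2l// ler_piMl// exprn_ge0// ltW.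
  lra.
have tel2 := telescope_sum Mstep.
have E2 : \sum_(0 <= k < K) (theta * (delta * M k) - C / 4 * (delta * u k ^+ 2)) =
    theta * (\sum_(0 <= k < K) delta * M k)
    - C / 4 * \sum_(0 <= k < K) delta * u k ^+ 2.
  by rewrite sumrB -!mulr_sumr.
rewrite E2 in tel2.
have MK : 0 <= delta * M K by rewrite mulr_ge0// ltW.
have M0d : delta * M 0%N <= M0.
  by apply: le_trans MM0; rewrite ler_piMl.
have KC2 : K%:R * (C * delta ^+ 3) <= C * C by rewrite mulrCA ler_wpM2l.
have s2 : \sum_(0 <= k < K) delta * M k <= S2.
  rewrite /S2 ler_pdivlMl//.
  have : C / 4 * \sum_(0 <= k < K) delta * u k ^+ 2 <= C / 4 * S1.
    by rewrite ler_wpM2l// divr_ge0.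
  lra.
rewrite (eq_bigr (fun k => delta * u k ^+ 2 + delta * M k)); last first.
  by move=> k _; rewrite mulrDr.
rewrite big_split /=; lra.
Qed.

End DescentSequence.


(** * The Lyapunov function of gap, consensus and tracking errors *)

Section Lyapunov.
Context {R : realType}.
Variables (N L mu c e a al au bl bu s sx sy sz phi f : R).
Let kk := (L / mu) ^+ 2.
(** The weights are fixed backwards. The contraction e of [lyap_S] repays the tracking error in the
    gap recursions; [lyap_D] repays the consensus error there and, by its second summand, the
    movement E passed on to tracking. [lyap_T] is the total weight with which Th + s^2 S2 enters. *)
Definition lyap_S : R := 400 * (L / mu) ^+ 2 * au / (N * e).
Definition lyap_D : R := 600 * (L / mu) ^+ 2 * au * L ^+ 2 / (al * c)
  + 40 * lyap_S * L ^+ 2 / (e * bl * a * al).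
Definition lyap_T : R :=
  lyap_D * (2 * au * bu / c) + lyap_S * (20 * L ^+ 2 * bu / (e * bl)).
Let Ab := lyap_T.
Hypotheses (N0 : 0 < N) (L0 : 0 < L) (mu0 : 0 < mu) (muL : mu <= L).
Hypotheses (c0 : 0 < c) (e0 : 0 < e) (a0 : 0 < a) (al0 : 0 < al) (au0 : 0 < au).
Hypotheses (bl0 : 0 < bl) (bu0 : 0 < bu) (sx0 : 0 < sx) (sy0 : 0 < sy) (sz0 : 0 < sz).
Hypotheses (sxs : sx <= s) (phi0 : 0 < phi) (f0 : 0 < f).
Hypotheses (f_le : f <= N * phi) (phi_le : phi <= au).
Hypothesis small_gain : 256 * Ab * N ^+ 2 * s ^+ 2 <= f.
Hypothesis ratio : (L / mu) ^+ 4 * (sx ^+ 2 / sy ^+ 2 + sx ^+ 2 / sz ^+ 2) <= 1 / 1536.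

Variables (D2 S2 p2 r2 E Th du2 g2 Dx2 D2' S2' p2' r2' b4 : R).
Hypotheses (D20 : 0 <= D2) (S20 : 0 <= S2) (p20 : 0 <= p2) (r20 : 0 <= r2).
Hypotheses (du20 : 0 <= du2) (g20 : 0 <= g2) (b40 : 0 <= b4).
Hypothesis R1 : D2' <= D2 - E / 2 + 2 * au * bu / c * (Th + s ^+ 2 * S2).
Hypothesis R1b : 2 * c * D2 <= E.
Hypothesis R2 : S2' <= (1 - e) * S2
  + 20 * L ^+ 2 / (e * bl) * (E / (a * al) + bu * (Th + s ^+ 2 * S2)).
Hypothesis R3 : p2' / sy <= p2 / sy - phi * N * mu * p2
  + 9 * (L / mu) ^+ 2 * Dx2 / (sy ^+ 2 * phi * N * mu)
  + 15 * phi * L ^+ 2 * D2 / (al * mu) + 12 * au * S2 / (N * mu).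
Hypothesis R4 : r2' / sz <= r2 / sz - phi * N * mu * r2
  + 9 * (L / mu) ^+ 2 * Dx2 / (sz ^+ 2 * phi * N * mu)
  + 15 * phi * L ^+ 2 * D2 / (al * mu) + 12 * au * S2 / (N * mu).
Hypothesis R5 : Dx2 <= 2 * sx ^+ 2 * (phi ^+ 2 * N ^+ 2 * du2 + g2).
Hypothesis R6 : g2 <= phi ^+ 2 * (40 * N * L ^+ 2 * D2 / al
  + 10 * N ^+ 2 * L ^+ 2 * (p2 + r2) + 8 * N ^+ 2 * b4) + 2 * au * phi * S2.
Hypothesis R7 : Th <= 2 * sx ^+ 2 * N ^+ 2 * du2 + s ^+ 2 *
  (25 / 2 * N ^+ 2 * L ^+ 2 * (p2 + r2) + 45 * N * L ^+ 2 * D2 / al + 8 * N ^+ 2 * b4).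

(** p2 and r2 are the squared gaps of y and z to their minimizers, D2 and S2 the consensus and
    tracking errors. The gaps contract at rates proportional to sy and sz; dividing by these makes
    their decrease independent of the step sizes. *)
Definition lyap p2 r2 D2 S2 : R :=
  16 * sx * L ^+ 2 / mu * (p2 / sy + r2 / sz) + sx * lyap_D * D2 + sx * lyap_S * S2.

Let X := sx * phi * N * du2.
Let Y := sx * phi * N * L ^+ 2 * (p2 + r2).
Let ZD := sx * (L / mu) ^+ 2 * au * L ^+ 2 / al * D2.
Let ZS := sx * (L / mu) ^+ 2 * au / N * S2.
Let Z4 := sx * phi * N * b4.
Let G0 := sx * g2 / (phi * N).

(** Y, ZD and ZS measure gap, consensus and tracking errors in the units of the gradient source X;
    the bias source is Z4. The coefficients stay below what [lyap_step] has left after the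
    couplings. *)
Definition dissipation : R := 14 * Y + 100 * ZD + 10 * ZS.

Let kk1 : 1 <= (L / mu) ^+ 2.
Proof. by rewrite exprn_ege1// ler_pdivlMr// mul1r. Qed.

Let X0 : 0 <= X. Proof. by rewrite /X; nonneg. Qed.
Let Y0 : 0 <= Y. Proof. by rewrite /Y; nonneg. Qed.
Let ZD0 : 0 <= ZD. Proof. by rewrite /ZD; nonneg. Qed.
Let ZS0 : 0 <= ZS. Proof. by rewrite /ZS; nonneg. Qed.
Let Z40 : 0 <= Z4. Proof. by rewrite /Z4; nonneg. Qed.

Let ZDphi : sx * phi * L ^+ 2 * D2 / al <= ZD.
Proof.
rewrite /ZD.
have -> : sx * phi * L ^+ 2 * D2 / al = (sx * L ^+ 2 * D2 / al) * (1 * phi) by ring.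
have -> : sx * (L / mu) ^+ 2 * au * L ^+ 2 / al * D2
  = (sx * L ^+ 2 * D2 / al) * ((L / mu) ^+ 2 * au) by ring.
by apply: ler_wpM2l; [nonneg | apply: ler_pM => //; nonneg].
Qed.

Let ZSau : sx * au / N * S2 <= ZS.
Proof.
rewrite /ZS.
have -> : sx * au / N * S2 = (sx * au / N * S2) * 1 by ring.
have -> : sx * (L / mu) ^+ 2 * au / N * S2 = (sx * au / N * S2) * (L / mu) ^+ 2 by ring.
by apply: ler_wpM2l; [nonneg|].
Qed.

Lemma drift_error_le : G0 <= 10 * Y + 40 * ZD + 2 * ZS + 8 * Z4.
Proof.
rewrite /G0 ler_pdivrMr ?mulr_gt0//.
apply: le_trans (ler_wpM2l (ltW sx0) R6) _.
have -> : sx * (phi ^+ 2 * (40 * N * L ^+ 2 * D2 / al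
  + 10 * N ^+ 2 * L ^+ 2 * (p2 + r2) + 8 * N ^+ 2 * b4) + 2 * au * phi * S2)
  = (40 * (sx * phi * L ^+ 2 * D2 / al) + 10 * Y + 8 * Z4 + 2 * (sx * au / N * S2))
    * (phi * N).
  by rewrite /Y /Z4; field; rewrite !gt_eqF.
apply: ler_wpM2r; first by nonneg.
by move: ZDphi ZSau; lra.
Qed.

Let gap_part : 16 * sx * L ^+ 2 / mu * (p2' / sy + r2' / sz) <=
  16 * sx * L ^+ 2 / mu * (p2 / sy + r2 / sz) - 16 * Y
  + 3 / 16 * (X + G0) + 480 * ZD + 384 * ZS.
Proof.
have w0 : 0 <= 16 * sx * L ^+ 2 / mu by nonneg.
apply: le_trans (ler_wpM2l w0 (lerD R3 R4)) _.
have e1 : 16 * sx * L ^+ 2 / mu * (phi * N * mu * p2 + phi * N * mu * r2) = 16 * Y.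
  by rewrite /Y; field; rewrite !gt_eqF.
have e2 : 16 * sx * L ^+ 2 / mu * (15 * phi * L ^+ 2 * D2 / (al * mu)) <= 240 * ZD.
  have -> : 16 * sx * L ^+ 2 / mu * (15 * phi * L ^+ 2 * D2 / (al * mu))
    = 240 * (sx * (L / mu) ^+ 2 * L ^+ 2 / al * D2) * phi.
    by field; rewrite !gt_eqF.
  have -> : 240 * ZD = 240 * (sx * (L / mu) ^+ 2 * L ^+ 2 / al * D2) * au.
    by rewrite /ZD; ring.
  by apply: ler_wpM2l; [nonneg|].
have e3 : 16 * sx * L ^+ 2 / mu * (12 * au * S2 / (N * mu)) = 192 * ZS.
  by rewrite /ZS; field; rewrite !gt_eqF.
have e4 : 16 * sx * L ^+ 2 / mu * (9 * (L / mu) ^+ 2 * Dx2 / (sy ^+ 2 * phi * N * mu)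
   + 9 * (L / mu) ^+ 2 * Dx2 / (sz ^+ 2 * phi * N * mu)) <= 3 / 16 * (X + G0).
  pose k := 144 * sx * (L / mu) ^+ 4 / (phi * N) * (1 / sy ^+ 2 + 1 / sz ^+ 2).
  have k0 : 0 <= k by rewrite /k; nonneg.
  have -> : 16 * sx * L ^+ 2 / mu * (9 * (L / mu) ^+ 2 * Dx2 / (sy ^+ 2 * phi * N * mu)
   + 9 * (L / mu) ^+ 2 * Dx2 / (sz ^+ 2 * phi * N * mu)) = k * Dx2.
    by rewrite /k; field; rewrite !gt_eqF.
  apply: le_trans (ler_wpM2l k0 R5) _.
  (* 288 / 1536 = 3 / 16: [ratio] keeps the displacement of the minimizers caused by the x-step
     small. *)
  have -> : k * (2 * sx ^+ 2 * (phi ^+ 2 * N ^+ 2 * du2 + g2)) =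
    288 * ((L / mu) ^+ 4 * (sx ^+ 2 / sy ^+ 2 + sx ^+ 2 / sz ^+ 2)) * (X + G0).
    by rewrite /k /X /G0; field; rewrite !gt_eqF.
  apply: ler_wpM2r; last by move: ratio; lra.
  by apply: addr_ge0 => //; rewrite /G0; nonneg.
move: e1 e2 e3 e4.
set w := 16 * sx * L ^+ 2 / mu; lra.
Qed.

Let sg0 : 0 <= lyap_S. Proof. by rewrite /lyap_S; nonneg. Qed.
Let om0 : 0 <= lyap_D. Proof. by rewrite /lyap_D; nonneg. Qed.
Let Ab0 : 0 <= lyap_T. Proof. by rewrite /lyap_T; nonneg. Qed.

(** The squared steps contain all the errors again, which closes a feedback loop. By [small_gain]
    its gain is at most N phi / 256, so every error returns with a small coefficient. *)
Let forcing_part : sx * lyap_T * (Th + s ^+ 2 * S2) <=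
  1 / 128 * X + 1 / 16 * Y + 1 / 5 * ZD + 1 / 32 * Z4 + 1 / 256 * ZS.
Proof.
have k0 : 0 <= sx * lyap_T by nonneg.
have s0 : 0 <= s by apply: le_trans sxs; exact: ltW.
have sx2 : sx ^+ 2 <= s ^+ 2 by rewrite ler_pXn2r// nnegrE ltW.
have Th' : Th <= s ^+ 2 * (2 * N ^+ 2 * du2 + (25 / 2 * N ^+ 2 * L ^+ 2 * (p2 + r2)
    + 45 * N * L ^+ 2 * D2 / al + 8 * N ^+ 2 * b4)).
  apply: le_trans R7 _; rewrite [leRHS]mulrDr lerD2r.
  have -> : 2 * sx ^+ 2 * N ^+ 2 * du2 = sx ^+ 2 * (2 * N ^+ 2 * du2) by ring.
  by apply: ler_wpM2r; [nonneg|].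
apply: le_trans (ler_wpM2l k0 (lerD Th' (lexx _))) _.
pose B := 2 * (sx * du2) + 25 / 2 * (sx * L ^+ 2 * (p2 + r2))
  + 45 * (sx * L ^+ 2 * D2 / al / N) + 8 * (sx * b4) + sx * S2 / N ^+ 2.
have B0 : 0 <= B by rewrite /B; nonneg.
have -> : sx * lyap_T * (s ^+ 2 * (2 * N ^+ 2 * du2 + (25 / 2 * N ^+ 2 * L ^+ 2 * (p2 + r2)
    + 45 * N * L ^+ 2 * D2 / al + 8 * N ^+ 2 * b4)) + s ^+ 2 * S2)
  = (256 * lyap_T * N ^+ 2 * s ^+ 2) * (B / 256).
  by rewrite /B; field; rewrite !gt_eqF.
have B1 : 0 <= B / 256 by nonneg.
apply: le_trans (ler_wpM2r B1 small_gain) _.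
apply: le_trans (ler_wpM2r B1 f_le) _.
have EB : N * phi * (B / 256) = 1 / 128 * X + 25 / 512 * Y
   + 45 / 256 * (sx * phi * L ^+ 2 * D2 / al) + 1 / 32 * Z4 + 1 / 256 * (sx * phi / N * S2).
  by rewrite /B /X /Y /Z4; field; rewrite !gt_eqF.
have : sx * phi / N * S2 <= sx * au / N * S2.
  have -> : sx * phi / N * S2 = (sx / N * S2) * phi by ring.
  have -> : sx * au / N * S2 = (sx / N * S2) * au by ring.
  by apply: ler_wpM2l; [nonneg|].
rewrite EB; move: ZDphi ZSau Y0 ZD0; lra.
Qed.

Let drop_part : 600 * ZD + sx * lyap_S * (20 * L ^+ 2 / (e * bl) * (E / (a * al)))
  <= sx * lyap_D * (E / 2).
Proof.
have -> : sx * lyap_D * (E / 2) =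
  300 * (sx * (L / mu) ^+ 2 * au * L ^+ 2 / (al * c)) * E
  + sx * lyap_S * (20 * L ^+ 2 / (e * bl) * (E / (a * al))).
  by rewrite /lyap_D; field; rewrite !gt_eqF.
rewrite lerD2r.
have -> : 600 * ZD = 300 * (sx * (L / mu) ^+ 2 * au * L ^+ 2 / (al * c)) * (2 * c * D2).
  by rewrite /ZD; field; rewrite !gt_eqF.
by apply: ler_wpM2l; [nonneg|].
Qed.

(** A budget: the contractions provide 16 Y, 600 ZD and 400 ZS; the gap recursions take back 480 ZD,
    384 ZS and 3/16 (X + G0), the forcing takes small fractions. *)
Lemma lyap_step : lyap p2' r2' D2' S2' <=
  lyap p2 r2 D2 S2 - dissipation + 15 / 64 * X + 2 * Z4.
Proof.
have q3 := ler_wpM2l (mulr_ge0 (ltW sx0) om0) R1.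
have q4 := ler_wpM2l (mulr_ge0 (ltW sx0) sg0) R2.
have eS : sx * lyap_S * (e * S2) = 400 * ZS.
  by rewrite /lyap_S /ZS; field; rewrite !gt_eqF.
have eT : sx * lyap_D * (2 * au * bu / c * (Th + s ^+ 2 * S2))
   + sx * lyap_S * (20 * L ^+ 2 / (e * bl) * (bu * (Th + s ^+ 2 * S2)))
   = sx * lyap_T * (Th + s ^+ 2 * S2).
  by rewrite /lyap_T; ring.
have := gap_part; have := drop_part; have := forcing_part; have := drift_error_le.
move: q3 q4 eS eT X0 Y0 ZD0 ZS0 Z40; rewrite /lyap /dissipation.
set w := 16 * sx * L ^+ 2 / mu; set T := Th + _.
clearbody X Y ZD ZS Z4 G0.
set k1 := sx * lyap_D; set k2 := sx * lyap_S; set k3 := 2 * au * bu / c.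
set k4 := 20 * L ^+ 2 / (e * bl); set F := E / (a * al).
set pp := p2 / sy + _; set pp' := p2' / sy + _.
lra.
Qed.

(** The drift has to be paid by half of the dissipation. The factor is 11/20 = 8/15 + 1/60: 8/15
    from (2 a)^-1 with a = 15/16 sx phi N, and 1/60 as room for the second-order term delta C. *)
Lemma dissipation_drift : 11 / 20 * G0 <= dissipation / 2 + 5 * Z4.
Proof.
have := drift_error_le; rewrite /dissipation.
move: X0 Y0 ZD0 ZS0 Z40; clearbody X Y ZD ZS Z4 G0; lra.
Qed.

End Lyapunov.

(** * One push-pull step *)

Section PushPullStep.
Context {R : realType} {n : nat}.
Variables (e : rel 'I_n) (A B : 'M[R]_n) (p q bt bt' : 'I_n -> R).
Variables (omA pmA omB pmB a al au bl bu c ee : R).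
Hypothesis e_conn : forall i j, connect e i j.
Hypothesis A_ge0 : forall i j, 0 <= A i j.
Hypothesis A_sum : forall i, \sum_j A i j = 1.
Hypothesis B_ge0 : forall i j, 0 <= B i j.
Hypothesis B_sum : forall j, \sum_i B i j = 1.
Hypotheses (p_sum : \sum_i p i = 1) (q_sum : \sum_i q i = 1).
Hypotheses (b_sum : \sum_i bt i = 1) (b'_sum : \sum_i bt' i = 1).
Hypotheses (p_ge : forall i, al <= p i) (q_ge : forall i, al <= q i).
Hypotheses (q_le : forall i, q i <= au).
Hypotheses (b_ge : forall i, bl <= bt i) (b'_ge : forall i, bl <= bt' i).
Hypotheses (b_le : forall i, bt i <= bu).
Hypotheses (al0 : 0 < al) (bl0 : 0 < bl) (a0 : 0 < a).
Hypothesis qA : forall j, \sum_i q i * A i j = p j.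
Hypothesis Bb : forall i, \sum_j B i j * bt j = bt' i.
Hypotheses (omA0 : 0 <= omA) (omB0 : 0 <= omB).
Hypothesis omA_le : forall i j, e j i -> omA <= q i * A i i * A i j.
Hypothesis omB_le : forall i j, e j i ->
  omB <= B i i * B i j * bt i * bt j / bt' i.
Hypotheses (pmA_ge : forall i, p i <= pmA) (pmB_ge : forall i, bt i <= pmB).
Hypothesis cA : c * (pmA ^+ 2 * (diameter e)%:R * (max_utility e)%:R) <= omA.
Hypothesis cB : ee * (pmB ^+ 2 * (diameter e)%:R * (max_utility e)%:R) <= omB.
Hypotheses (c0 : 0 < c) (c1 : c <= 1) (ee0 : 0 < ee) (ee1 : ee <= 1).
Hypothesis A_diag : forall i, a <= A i i.

Let p0 i : 0 <= p i. Proof. exact: le_trans (ltW al0) (p_ge i). Qed.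
Let q0 i : 0 <= q i. Proof. exact: le_trans (ltW al0) (q_ge i). Qed.
Let b0 i : 0 < bt i. Proof. exact: lt_le_trans bl0 (b_ge i). Qed.
Let b'0 i : 0 < bt' i. Proof. exact: lt_le_trans bl0 (b'_ge i). Qed.

(* In the variables t_i / beta_i the column-stochastic push B becomes a
   row-stochastic averaging, of which beta' is the left weight vector. *)
Definition pushW : 'M[R]_n := \matrix_(i, j) (B i j * bt j / bt' i).

Let pushW_ge0 i j : 0 <= pushW i j.
Proof. by rewrite mxE divr_ge0 ?mulr_ge0// ltW. Qed.

Let pushW_sum i : \sum_j pushW i j = 1.
Proof.
rewrite (eq_bigr (fun j => B i j * bt j / bt' i)); last by move=> j _; rewrite mxE.
by rewrite -mulr_suml Bb divff ?gt_eqF.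
Qed.

Let pushW_left j : \sum_i bt' i * pushW i j = bt j.
Proof.
rewrite (eq_bigr (fun i => B i j * bt j)); last first.
  by move=> i _; rewrite mxE; field; rewrite gt_eqF.
by rewrite -mulr_suml B_sum mul1r.
Qed.

Let pushW_omega i j : e j i -> omB <= bt' i * pushW i i * pushW i j.
Proof.
move=> /omB_le; rewrite !mxE.
suff -> : bt' i * (B i i * bt i / bt' i) * (B i j * bt j / bt' i)
  = B i i * B i j * bt i * bt j / bt' i by [].
by field; rewrite gt_eqF.
Qed.

Context {d : nat}.
Variables (s : R) (xi xi' t t' g g' : 'I_n -> 'rV[R]_d).
Hypothesis s0 : 0 <= s.
Hypothesis xiE : forall i, xi' i = \sum_j A i j *: xi j - s *: t i.
Hypothesis tE : forall i, t' i = \sum_j B i j *: t j + g' i - g i.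

Definition ratio_of (w : 'I_n -> R) (u : 'I_n -> 'rV[R]_d) (i : 'I_n) : 'rV[R]_d :=
  (w i)^-1 *: u i.

Let v := ratio_of bt t.
Let v' := ratio_of bt' t'.
Let T := \sum_i t i.

Lemma wmean_ratio (w : 'I_n -> R) (u : 'I_n -> 'rV[R]_d) :
  (forall i, 0 < w i) -> wmean w (ratio_of w u) = \sum_i u i.
Proof.
move=> w0; apply: eq_bigr => i _.
by rewrite /ratio_of scalerA mulfV ?gt_eqF// scale1r.
Qed.

Let tvE i : t i = bt i *: v i.
Proof. by rewrite /v /ratio_of scalerA mulfV ?gt_eqF// scale1r. Qed.

Lemma tracking_energy : \sum_i bt i * sq (v i) = sq T + wvar bt v.
Proof.
have := wvar_decomp v 0 b_sum; rewrite subr0 wmean_ratio// -/T => <-.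
by apply: eq_bigr => i _; rewrite subr0.
Qed.

Lemma consensus_step : wvar q xi' <= wvar p xi - mix_drop A p q xi / 2
  + 2 * au * bu / c * (s ^+ 2 * (sq T + wvar bt v)).
Proof.
apply: le_trans (@mix_step _ _ e A p q omA pmA c _ _ _ _ _ _ _ _ _ _ _ _ _
   xi xi' (fun i => - (s *: t i)) _ _ _) _ => //; first exact: ltW.
rewrite lerD2l.
have -> : 2 * au * bu / c * (s ^+ 2 * (sq T + wvar bt v))
  = 2 / c * (s ^+ 2 * (au * bu) * (sq T + wvar bt v)) by ring.
rewrite ler_wpM2l ?divr_ge0 ?(ltW c0)// -tracking_energy mulr_sumr.
apply: ler_sum => i _; rewrite sqN sqZ {1}tvE sqZ.
have -> : q i * (s ^+ 2 * (bt i ^+ 2 * sq (v i)))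
  = s ^+ 2 * (q i * bt i) * (bt i * sq (v i)) by ring.
rewrite ler_wpM2r ?mulr_ge0 ?sq_ge0 ?(ltW (b0 _))//.
by rewrite ler_wpM2l ?sqr_ge0// ler_pM// ltW.
Qed.

Lemma tracking_step : wvar bt' v' <= (1 - ee) * wvar bt v
  + 2 / (ee * bl) * \sum_i sq (g' i - g i).
Proof.
have b0' i : 0 <= bt i by exact: ltW.
have b'0' i : 0 <= bt' i by exact: ltW.
have vE i : v' i = mix pushW v i + (bt' i)^-1 *: (g' i - g i).
  rewrite /v' /ratio_of tE -addrA scalerDr; congr (_ + _).
  rewrite /mix scaler_sumr; apply: eq_bigr => j _.
  rewrite mxE /v /ratio_of !scalerA; congr (_ *: _).
  by field; rewrite !gt_eqF.
apply: le_trans (@mix_step _ _ e pushW bt bt' omB pmB ee _ _ _ _ _ _ _ _ _ _ _ _ _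
   v v' (fun i => (bt' i)^-1 *: (g' i - g i)) _ _ _) _ => //; first exact: ltW.
have drop : 2 * ee * wvar bt v <= mix_drop pushW bt bt' v.
  by apply: (@mix_drop_var _ _ e _ _ _ omB pmB) => //; exact: ltW.
apply: lerD; first by lra.
rewrite !mulr_sumr; apply: ler_sum => i _; rewrite sqZ.
have -> : 2 / ee * (bt' i * ((bt' i)^-1 ^+ 2 * sq (g' i - g i)))
   = 2 / ee * sq (g' i - g i) * (bt' i)^-1.
  by field; rewrite !gt_eqF.
have -> : 2 / (ee * bl) * sq (g' i - g i) = 2 / ee * sq (g' i - g i) * bl^-1.
  by field; rewrite !gt_eqF.
rewrite ler_wpM2l ?mulr_ge0 ?sq_ge0 ?invr_ge0 ?(ltW ee0)//.
by rewrite lef_pV2 ?posrE.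
Qed.

Lemma movement_step : \sum_i sq (xi' i - xi i) <=
  2 / (a * al) * mix_drop A p q xi + 2 * s ^+ 2 * bu * (sq T + wvar bt v).
Proof.
have E i : xi' i - xi i = (mix A xi i - xi i) - s *: t i.
  by rewrite xiE addrAC.
have mv : a * (\sum_i q i * sq (mix A xi i - xi i)) <= mix_drop A p q xi.
  exact: mix_move_le.
apply: le_trans (_ : 2 * (\sum_i sq (mix A xi i - xi i))
   + 2 * \sum_i sq (s *: t i) <= _).
  rewrite !mulr_sumr -big_split; apply: ler_sum => i _ /=.
  by rewrite E sqB_le2.
apply: lerD.
  have -> : 2 / (a * al) * mix_drop A p q xi = 2 * (mix_drop A p q xi / (a * al)).
    by ring.
  rewrite ler_wpM2l// ler_pdivlMr ?mulr_gt0// mulrC.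
  apply: le_trans mv; rewrite -mulrA ler_wpM2l ?(ltW a0)// mulr_sumr.
  by apply: ler_sum => i _; rewrite ler_wpM2r ?sq_ge0.
rewrite -!mulrA ler_wpM2l// -tracking_energy !mulr_sumr.
apply: ler_sum => i _; rewrite sqZ (mulrA s) -expr2 ler_wpM2l ?sqr_ge0//.
by rewrite tvE sqZ expr2 -mulrA ler_wpM2r// mulr_ge0 ?sq_ge0// ltW.
Qed.

(** The share of the total tracker that reaches the q-weighted mean when each t_i is exactly beta_i
    times that total. *)
Definition mixing_weight : R := \sum_i q i * bt i.

Lemma mixing_weight_ge : bl <= mixing_weight.
Proof.
rewrite -[bl]mul1r -q_sum mulr_suml; apply: ler_sum => i _.
by rewrite ler_wpM2l.
Qed.

Lemma mixing_weight_le : mixing_weight <= au.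
Proof.
rewrite -[au]mulr1 -b_sum mulr_sumr; apply: ler_sum => i _.
by rewrite ler_wpM2r// ltW.
Qed.

(** Mixing leaves the weighted mean fixed, since q A = p. In t_i = beta_i v_i only the deviation of
    v_i from T is an error; rho collects these deviations, estimated by Cauchy-Schwarz with weights
    beta. *)
Lemma mean_step : exists2 rho,
  wmean q xi' = wmean p xi - s *: (mixing_weight *: T + rho) &
  sq rho <= au * mixing_weight * wvar bt v.
Proof.
exists (\sum_i (q i * bt i) *: (v i - T)).
  rewrite /wmean (eq_bigr (fun i => q i *: mix A xi i - s *: (q i *: t i))); last first.
    by move=> i _; rewrite xiE scalerBr; congr (_ - _); rewrite !scalerA mulrC.
  rewrite sumrB -scaler_sumr; congr (_ - _ *: _).
    rewrite /mix; under eq_bigr do rewrite scaler_sumr.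
    rewrite exchange_big /=; apply: eq_bigr => j _.
    rewrite (eq_bigr (fun i => (q i * A i j) *: xi j)); last by move=> i _; rewrite scalerA.
    by rewrite -scaler_suml qA.
  rewrite /mixing_weight scaler_suml -big_split; apply: eq_bigr => i _ /=.
  by rewrite -scalerDr subrKC tvE !scalerA.
apply: le_trans (sq_sum_weighted _ _ b0) _.
have -> : wvar bt v = \sum_i bt i * sq (v i - T).
  by rewrite /wvar wmean_ratio.
rewrite ler_wpM2r; first by [].
  by apply: sumr_ge0 => i _; rewrite mulr_ge0 ?sq_ge0// ltW.
rewrite /mixing_weight mulr_sumr; apply: ler_sum => i _.
have -> : (q i * bt i) ^+ 2 / bt i = q i * (q i * bt i) by field; rewrite gt_eqF.
by rewrite ler_wpM2r// mulr_ge0// ltW.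
Qed.

Lemma tracking_sum : \sum_i t' i = T + \sum_i g' i - \sum_i g i.
Proof.
rewrite (eq_bigr _ (fun i _ => tE i)) sumrB big_split /=; congr (_ + _ - _).
rewrite exchange_big /=; apply: eq_bigr => j _.
by rewrite -scaler_suml B_sum scale1r.
Qed.

End PushPullStep.

(** * The bilevel problem *)

Section PartialGradients.
Context {R : realType} {dx dy : nat}.
Implicit Types (h : 'rV[R]_dx -> 'rV[R]_dy -> R) (x : 'rV[R]_dx) (y : 'rV[R]_dy).

Lemma joint_row_mx h x y : joint h (row_mx x y) = h x y.
Proof. by rewrite /joint row_mxKl row_mxKr. Qed.

Lemma is_derive_joint_l h x y u : differentiable (joint h) (row_mx x y) ->
  is_derive x u (h ^~ y) (dot (lsubmx (grad (joint h) (row_mx x y))) u).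
Proof.
move=> dh.
have E : (fun t : R => t^-1 *: ((joint h \o shift (row_mx x y)) (t *: row_mx u 0)
     - joint h (row_mx x y)))
  = (fun t : R => t^-1 *: (((h ^~ y) \o shift x) (t *: u) - h x y)).
  apply/funext => t /=; rewrite scale_row_mx add_row_mx !joint_row_mx.
  by rewrite scaler0 add0r.
have := @diff_derivable _ _ _ _ _ (row_mx u 0) dh; have := derive_grad (row_mx u 0) dh.
rewrite dot_row_mxr dot0r addr0 /derivable /derive E => <- D.
by apply: DeriveDef.
Qed.

Lemma is_derive_joint_r h x y v : differentiable (joint h) (row_mx x y) ->
  is_derive y v (h x) (dot (rsubmx (grad (joint h) (row_mx x y))) v).
Proof.
move=> dh.
have E : (fun t : R => t^-1 *: ((joint h \o shift (row_mx x y)) (t *: row_mx 0 v)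
     - joint h (row_mx x y)))
  = (fun t : R => t^-1 *: ((h x \o shift y) (t *: v) - h x y)).
  apply/funext => t /=; rewrite scale_row_mx add_row_mx !joint_row_mx.
  by rewrite scaler0 add0r.
have := @diff_derivable _ _ _ _ _ (row_mx 0 v) dh; have := derive_grad (row_mx 0 v) dh.
rewrite dot_row_mxr dot0r add0r /derivable /derive E => <- D.
by apply: DeriveDef.
Qed.

Lemma dot_delta d (g : 'rV[R]_d) i : dot g (delta_mx 0 i) = g 0 i.
Proof.
rewrite /dot (bigD1 i)//= mxE !eqxx mulr1 big1 ?addr0// => j ji.
by rewrite mxE (negbTE ji) andbF mulr0.
Qed.

Lemma grad_is_derive d (h : 'rV[R]_d -> R) (x g : 'rV[R]_d) :
  (forall u, is_derive x u h (dot g u)) -> grad h x = g.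
Proof.
move=> H; apply/rowP => i; rewrite mxE.
by rewrite (@derive_val _ _ _ _ _ _ _ (H (delta_mx 0 i))) dot_delta.
Qed.

End PartialGradients.

Section ProblemFacts.
Context {R : realType} {n dx dy : nat}.
Variables (P : problem R n dx dy).
Hypotheses (hn : (0 < n)%N) (hdy : (0 < dy)%N) (hP : problem_assumptions P).
Implicit Types (x : 'rV[R]_dx) (y z : 'rV[R]_dy) (w : 'rV[R]_(dx + dy)).

Definition gradf (i : 'I_n) w := grad (joint (fobj P i)) w.
Definition gradg (i : 'I_n) w := grad (joint (gobj P i)) w.

Lemma dirxE lambda i x y z : dirx P lambda i x y z =
  lsubmx (gradf i (row_mx x y))
  + lambda *: (lsubmx (gradg i (row_mx x y)) - lsubmx (gradg i (row_mx x z))).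
Proof.
apply: grad_is_derive => u; rewrite dotDl dotZl dotBl.
have [df _] := f_lipschitz_gradient hP i; have [dg _] := g_lipschitz_gradient hP i.
have D1 := is_derive_joint_l u (df (row_mx x y)).
have D2 := is_derive_joint_l u (dg (row_mx x y)).
have D3 := is_derive_joint_l u (dg (row_mx x z)).
exact: (is_deriveD _ (is_deriveZ lambda (is_deriveB D2 D3))).
Qed.

Lemma diryE lambda i x y z : diry P lambda i x y z =
  rsubmx (gradf i (row_mx x y)) + lambda *: rsubmx (gradg i (row_mx x y)).
Proof.
apply: grad_is_derive => u; rewrite dotDl dotZl -[dot (rsubmx (gradg _ _)) u]subr0.
have [df _] := f_lipschitz_gradient hP i; have [dg _] := g_lipschitz_gradient hP i.
have D1 := is_derive_joint_r u (df (row_mx x y)).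
have D2 := is_derive_joint_r u (dg (row_mx x y)).
exact: (is_deriveD _ (is_deriveZ lambda (is_deriveB D2 (is_derive_cst (gobj P i x z) y u)))).
Qed.

Lemma dirzE lambda i x y z : dirz P lambda i x y z =
  lambda *: rsubmx (gradg i (row_mx x z)).
Proof.
rewrite /dirz -[RHS]opprK; congr (- _).
apply: grad_is_derive => u.
have -> : dot (- (lambda *: rsubmx (gradg i (row_mx x z)))) u =
    0 + lambda * (0 - dot (rsubmx (gradg i (row_mx x z))) u).
  by rewrite dotNl dotZl add0r sub0r mulrN.
have [dg _] := g_lipschitz_gradient hP i.
have D2 := is_derive_joint_r u (dg (row_mx x z)).
exact: (is_deriveD (is_derive_cst (fobj P i x y) z u)
  (is_deriveZ lambda (is_deriveB (is_derive_cst (gobj P i x y) z u) D2))).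
Qed.

Let N0 : 0 < n%:R :> R. Proof. by rewrite ltr0n. Qed.

Definition avg (V : lmodType R) (F : 'I_n -> V) : V := n%:R^-1 *: \sum_i F i.

Lemma dot_avg d (F : 'I_n -> 'rV[R]_d) v :
  dot (avg F) v = n%:R^-1 * \sum_i dot (F i) v.
Proof. by rewrite dotZl dot_suml. Qed.

Lemma avg_le (F : 'I_n -> R) (c : R) : (forall i, F i <= c) ->
  n%:R^-1 * \sum_i F i <= c.
Proof.
move=> H; rewrite ler_pdivrMl//; apply: le_trans (ler_sum _ (fun i _ => H i)) _.
by rewrite sumr_const card_ord mulr_natl.
Qed.

Lemma avg_ge (F : 'I_n -> R) (c : R) : (forall i, c <= F i) ->
  c <= n%:R^-1 * \sum_i F i.
Proof.
move=> H; rewrite ler_pdivlMl//; apply: le_trans (ler_sum _ (fun i _ => H i)).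
by rewrite sumr_const card_ord mulr_natl.
Qed.

Lemma avg_abs_le (F : 'I_n -> R) (c : R) : (forall i, `|F i| <= c) ->
  `|n%:R^-1 * \sum_i F i| <= c.
Proof.
move=> H; rewrite ler_norml avg_ge ?avg_le// => i.
  by have := H i; rewrite ler_norml => /andP[].
by have := H i; rewrite ler_norml => /andP[].
Qed.

Lemma enorm_avg_le d (F : 'I_n -> 'rV[R]_d) (c : R) :
  (forall i, enorm (F i) <= c) -> enorm (avg F) <= c.
Proof.
move=> H; rewrite enormZ ger0_norm ?invr_ge0 ?(ltW N0)//.
apply: le_trans (avg_le H); rewrite ler_wpM2l ?invr_ge0 ?(ltW N0)//.
exact: enorm_sum.
Qed.

Lemma avgB (V : lmodType R) (F G : 'I_n -> V) :
  avg F - avg G = avg (fun i => F i - G i).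
Proof. by rewrite /avg -scalerBr sumrB. Qed.

Definition Favg w : R := n%:R^-1 * \sum_i joint (fobj P i) w.
Definition Gavg w : R := n%:R^-1 * \sum_i joint (gobj P i) w.
Definition gFavg w : 'rV[R]_(dx + dy) := avg (gradf^~ w).
Definition gGavg w : 'rV[R]_(dx + dy) := avg (gradg^~ w).
Definition JGavg w : 'M[R]_(dx + dy) := avg (fun i => 'J (gradg i) w).

Let quad_avg (h : 'I_n -> 'rV[R]_(dx + dy) -> R) (L : R) w v :
  (forall i, lipschitz_gradient L (h i)) ->
  `|n%:R^-1 * \sum_i h i (w + v) - n%:R^-1 * \sum_i h i w
    - dot (avg (fun i => grad (h i) w)) v| <= `|L| * sq v.
Proof.
move=> H; rewrite dot_avg -!mulrBr -!sumrB.
by apply: avg_abs_le => i; exact: taylor_lipschitz_gradient.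
Qed.

Let lip_avg (h : 'I_n -> 'rV[R]_(dx + dy) -> R) (L : R) w w' :
  (forall i, lipschitz_gradient L (h i)) ->
  enorm (avg (fun i => grad (h i) w) - avg (fun i => grad (h i) w'))
    <= `|L| * enorm (w - w').
Proof.
move=> H; rewrite avgB; apply: enorm_avg_le => i; have [_ Li] := H i.
by apply: le_trans (Li _ _) _; rewrite ler_wpM2r ?enorm_ge0// ler_norm.
Qed.

Lemma F_quad w v : `|Favg (w + v) - Favg w - dot (gFavg w) v| <= `|Lf1 P| * sq v.
Proof. exact: quad_avg (f_lipschitz_gradient hP). Qed.

Lemma gF_lip w w' : enorm (gFavg w - gFavg w') <= `|Lf1 P| * enorm (w - w').
Proof. exact: lip_avg (f_lipschitz_gradient hP). Qed.

Lemma gG_taylor w v :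
  enorm (gGavg (w + v) - gGavg w - v *m JGavg w) <= `|Lg2 P| * sq v.
Proof.
have -> : v *m JGavg w = avg (fun i => v *m 'J (gradg i) w).
  by rewrite /JGavg /avg -scalemxAr mulmx_sumr.
rewrite !avgB; apply: enorm_avg_le => i.
exact: taylor_lipschitz_hessian (g_lipschitz_hessian hP i).
Qed.

Lemma JG_sym w u v : dot (u *m JGavg w) v = dot (v *m JGavg w) u.
Proof.
have E a b : dot (a *m JGavg w) b = n%:R^-1 * \sum_i dot (a *m 'J (gradg i) w) b.
  by rewrite /JGavg /avg -scalemxAr mulmx_sumr dotZl dot_suml.
rewrite !E; congr (_ * _); apply: eq_bigr => i _.
exact: jacobian_grad_sym (g_lipschitz_gradient hP i) (g_lipschitz_hessian hP i).
Qed.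

(** The Lipschitz condition on values is divided by t along the increment t y; the O(t^2) Taylor
    error disappears in [le_of_small]. *)
Lemma gradf_lip_y i w y : dot (gradf i w) (row_mx 0 y) <= `|Lf0 P| * enorm y.
Proof.
apply: (@le_of_small _ _ _ (`|Lf1 P| * sq y) 1) => t /andP[t0 t1].
have := taylor_lipschitz_gradient w (t *: row_mx 0 y) (f_lipschitz_gradient hP i).
rewrite sqZ sq_row_0mx dotZr ler_norml => /andP[_ H].
have := f_lipschitz_y hP i (lsubmx w) (rsubmx w + t *: y) (rsubmx w).
rewrite -!(joint_row_mx (fobj P i)) hsubmxK.
have -> : row_mx (lsubmx w) (rsubmx w + t *: y) = w + t *: row_mx 0 y :> 'rV_(dx + dy).
  by rewrite -[in RHS](hsubmxK w) scale_row_mx add_row_mx scaler0 addr0.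
rewrite addrAC subrr add0r enormZ (gtr0_norm t0) ler_norml => /andP[H2 H3].
have H4 : Lf0 P * (t * enorm y) <= `|Lf0 P| * (t * enorm y).
  by rewrite ler_wpM2r ?ler_norm// mulr_ge0 ?enorm_ge0// ltW.
have := taylor_lipschitz_gradient w (t *: row_mx 0 y) (f_lipschitz_gradient hP i).
rewrite sqZ sq_row_0mx dotZr ler_norml => /andP[H5 H6].
rewrite /gradf expr1; lra.
Qed.

Lemma F_lip_y w y : dot (gFavg w) (row_mx 0 y) <= `|Lf0 P| * enorm y.
Proof. by rewrite dot_avg; apply: avg_le => i; exact: gradf_lip_y. Qed.

(** First-order form of strong convexity: the defining inequality on the segment is divided by t,
    and its t^2 part joins the Taylor error. *)
Lemma gradg_convex i x y y' : gobj P i x y +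
    dot (gradg i (row_mx x y)) (row_mx 0 (y' - y)) + mu P / 2 * sq (y' - y)
  <= gobj P i x y'.
Proof.
set v := y' - y.
suff : dot (gradg i (row_mx x y)) (row_mx 0 v) + mu P / 2 * sq v
  <= gobj P i x y' - gobj P i x y by lra.
apply: (@le_of_small _ _ _ ((`|Lg1 P| + mu P / 2) * sq v) 1) => t /andP[t0 t1].
have := taylor_lipschitz_gradient (row_mx x y) (t *: row_mx 0 v) (g_lipschitz_gradient hP i).
have -> : row_mx x y + t *: row_mx 0 v = row_mx x (t *: y' + (1 - t) *: y) :> 'rV_(dx + dy).
  rewrite scale_row_mx add_row_mx scaler0 addr0; congr row_mx.
  by rewrite /v scalerBr scalerBl scale1r addrCA addrA.
rewrite !joint_row_mx sqZ sq_row_0mx dotZr ler_norml => /andP[H1 _].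
have := g_strongly_convex hP i x y' y (t := t); rewrite (ltW t0) t1 => /(_ isT).
rewrite enorm_sq -/v /gradg expr1; move: H1; lra.
Qed.

Lemma G_convex x y y' : Gavg (row_mx x y) +
    dot (gGavg (row_mx x y)) (row_mx 0 (y' - y)) + mu P / 2 * sq (y' - y)
  <= Gavg (row_mx x y').
Proof.
rewrite dot_avg -mulrDr -big_split /= addrC -lerBrDr -mulrBr -sumrB.
apply: avg_ge => i; rewrite !joint_row_mx.
have := gradg_convex i x y y'; lra.
Qed.

(** A unit vector exists because dy > 0; along it strong monotonicity is compared with the Lipschitz
    bound of one g_i. *)
Lemma mu_le_Lg1 : mu P <= Lg1 P.
Proof.
pose i0 := Ordinal hn; pose v : 'rV[R]_dy := delta_mx 0 (Ordinal hdy).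
have sv : sq v = 1 by rewrite /sq dot_delta mxE !eqxx.
have := gradg_convex i0 0 0 v; have := gradg_convex i0 0 v 0.
rewrite subr0 sub0r sqN sv.
have -> : row_mx 0 (- v) = - row_mx 0 v :> 'rV[R]_(dx + dy).
  by rewrite opp_row_mx oppr0.
rewrite dotNr => h1 h2.
have [_ /(_ (row_mx 0 v) (row_mx 0 0))] := g_lipschitz_gradient hP i0.
rewrite sub_row_mx !subr0 enorm_row_0mx => h3.
have := dot_le_enorm (gradg i0 (row_mx 0 v) - gradg i0 (row_mx 0 0)) (row_mx 0 v).
have nv : enorm v = 1 by rewrite enormE sv sqrtr1.
rewrite enorm_row_0mx nv dotBl mulr1 ler_norml => /andP[_ h4].
rewrite nv mulr1 in h3; rewrite /gradg in h4.
move: h1 h2 h3 h4; rewrite /gradg; lra.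
Qed.

Lemma Lg1_gt0 : 0 < Lg1 P.
Proof. exact: lt_le_trans (mu_gt0 hP) mu_le_Lg1. Qed.

Lemma G_quad w v : `|Gavg (w + v) - Gavg w - dot (gGavg w) v| <= Lg1 P * sq v.
Proof.
rewrite -[Lg1 P]gtr0_norm ?Lg1_gt0//; exact: quad_avg (g_lipschitz_gradient hP).
Qed.

Lemma gG_lip w w' : enorm (gGavg w - gGavg w') <= Lg1 P * enorm (w - w').
Proof.
rewrite -[Lg1 P]gtr0_norm ?Lg1_gt0//; exact: lip_avg (g_lipschitz_gradient hP).
Qed.

Lemma Favg_bounded : exists m, forall w, m <= Favg w.
Proof.
have H i : exists m : R, forall w, m <= joint (fobj P i) w.
  by have [m hm] := f_bounded_below hP i; exists m => w; exact: hm.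
have [f hf] := choice H.
exists (n%:R^-1 * \sum_i f i) => w; rewrite ler_wpM2l ?invr_ge0 ?(ltW N0)//.
by apply: ler_sum => i _; exact: hf.
Qed.

Definition yreg (delta : R) x : 'rV[R]_dy := ydel Favg Gavg delta x.

Lemma ystarE x : ystar P x = yreg 0 x.
Proof.
rewrite /ystar /yreg /ydel; congr argmin; apply/funext => y.
rewrite /psi mul0r add0r /Gavg /Gobj; congr (_ * _).
by apply: eq_bigr => i _; rewrite joint_row_mx.
Qed.

Lemma FstarE x : Fstar P x = Favg (row_mx x (yreg 0 x)).
Proof.
rewrite /Fstar ystarE /Fobj /Favg; congr (_ * _).
by apply: eq_bigr => i _; rewrite joint_row_mx.
Qed.

Let lF0 := normr_ge0 (Lf1 P).
Let hG0 := normr_ge0 (Lg2 P).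
Let l00 := normr_ge0 (Lf0 P).

Ltac bilevel_side := first [done | exact: mu_gt0 | exact: mu_le_Lg1 | exact: F_quad
  | exact: G_quad | exact: gF_lip | exact: gG_lip | exact: gG_taylor | exact: JG_sym
  | exact: F_lip_y | exact: G_convex].

Lemma yreg_stationary (delta : R) x : 0 <= delta ->
  \sum_i (delta *: rsubmx (gradf i (row_mx x (yreg delta x)))
    + rsubmx (gradg i (row_mx x (yreg delta x)))) = 0.
Proof.
move=> d0; have [m hm] := Favg_bounded.
apply: sq_eq0.
set u := \sum_i _; have := @ydel_stationary R dx dy Favg Gavg gFavg gGavg
  `|Lf1 P| (Lg1 P) m (mu P) (mu_gt0 hP) hm F_quad G_quad G_convex delta x u d0.
rewrite -/(yreg delta x) !dot_avg mulrCA -mulrDr mulr_sumr -big_split /= => /eqP.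
rewrite mulf_eq0 invr_eq0 gt_eqF//= => /eqP H; rewrite /sq {1}/u dot_suml -[RHS]H.
apply: eq_bigr => i _; rewrite dotDl dotZl !dot_row_mxr !dot0r !add0r //.
Qed.

Lemma yreg_lipschitz (delta : R) x x' : 0 <= delta ->
  10 * (delta * `|Lf1 P|) <= mu P ->
  sq (yreg delta x' - yreg delta x) <= 3 / 2 * (Lg1 P / mu P) ^+ 2 * sq (x' - x).
Proof.
have [m hm] := Favg_bounded.
by apply: (@ydel_lipschitz R dx dy Favg Gavg gFavg gGavg `|Lf1 P| (Lg1 P) m (mu P))
  ; bilevel_side.
Qed.

Lemma yreg_near (delta : R) x : 0 <= delta ->
  enorm (yreg delta x - yreg 0 x) <= delta * `|Lf0 P| / mu P.
Proof.
have [m hm] := Favg_bounded.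
by apply: (@ydel_near_ystar R dx dy Favg Gavg gFavg gGavg `|Lf1 P| (Lg1 P) `|Lf0 P| m (mu P))
  ; bilevel_side.
Qed.

Lemma Fstar_quad : exists2 C, 0 < C & forall x v,
  `|Fstar P (x + v) - Fstar P x - dot (grad (Fstar P) x) v| <= C * sq v.
Proof.
have [m hm] := Favg_bounded.
have [H [C HC]] : exists (H : 'rV[R]_dx -> 'rV[R]_dx) (C : R), forall x v,
   `|Fstar P (x + v) - Fstar P x - dot (H x) v| <= C * sq v.
  exists (hypergrad Favg Gavg gFavg JGavg); eexists => x v; rewrite !FstarE.
  apply: (@hyper_quad R dx dy Favg Gavg gFavg gGavg JGavg `|Lf1 P| (Lg1 P) `|Lg2 P| `|Lf0 P| m (mu P))
  ; bilevel_side.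
exists (`|C| + 1); first by rewrite ltr_wpDl.
move=> x v; rewrite (grad_quadratic (HC x)); apply: le_trans (HC x v) _.
by rewrite ler_wpM2r ?sq_ge0//; have := ler_norm C; lra.
Qed.

(** delta^4 is the square of delta^2: one factor delta is the scaling of the directions, the other
    is the penalty bias of the gradient. *)
Lemma Fstar_bias : exists2 C, 0 <= C & forall (delta : R) x, 0 < delta ->
  sq (\sum_i (delta *: lsubmx (gradf i (row_mx x (yreg delta x)))
     + (lsubmx (gradg i (row_mx x (yreg delta x)))
        - lsubmx (gradg i (row_mx x (yreg 0 x)))))
     - (n%:R * delta) *: grad (Fstar P) x) <= n%:R ^+ 2 * (C * delta ^+ 4).
Proof.
have [m hm] := Favg_bounded.
pose B := biasH `|Lf1 P| (Lg1 P) `|Lg2 P| `|Lf0 P| (mu P).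
exists (B ^+ 2); first exact: sqr_ge0.
move=> delta x d0.
have gE : grad (Fstar P) x = hypergrad Favg Gavg gFavg JGavg x.
  apply: grad_quadratic => v; rewrite !FstarE.
  apply: (@hyper_quad R dx dy Favg Gavg gFavg gGavg JGavg `|Lf1 P| (Lg1 P) `|Lg2 P| `|Lf0 P| m (mu P))
  ; bilevel_side.
have : enorm (hypergrad_del Favg Gavg gFavg gGavg delta x
   - hypergrad Favg Gavg gFavg JGavg x) <= delta * B.
  apply: (@hypergrad_del_bias R dx dy Favg Gavg gFavg gGavg JGavg `|Lf1 P| (Lg1 P) `|Lg2 P| `|Lf0 P| m (mu P))
  ; bilevel_side.
rewrite -gE => H.
set lhs := _ - _.
have E : lhs = (n%:R * delta) *: (hypergrad_del Favg Gavg gFavg gGavg delta x - grad (Fstar P) x).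
  rewrite /lhs scalerBr; congr (_ - _).
  have lA (F : 'I_n -> 'rV[R]_(dx + dy)) : lsubmx (avg F) = avg (fun i => lsubmx (F i)).
    by rewrite /avg linearZ linear_sum.
  rewrite /hypergrad_del -/(yreg delta x) -/(yreg 0 x) !lA avgB /avg.
  rewrite !scalerDr !scalerA big_split /=; congr (_ + _).
    rewrite -scaler_sumr mulrAC mulfV ?mul1r// gt_eqF//.
  have -> : n%:R * delta / delta / n%:R = 1 :> R by field; rewrite !gt_eqF.
  by rewrite scale1r.
rewrite E sqZ exprMn -mulrA ler_wpM2l ?sqr_ge0//.
have -> : B ^+ 2 * delta ^+ 4 = delta ^+ 2 * (delta * B) ^+ 2 by ring.
rewrite ler_wpM2l ?sqr_ge0//; apply: enorm_le_sq => //.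
exact: le_trans (enorm_ge0 _) H.
Qed.

End ProblemFacts.


(** * Perturbed gradient steps on the regularized lower level *)

Section StepEstimates.
Context {R : realType} {n dx dy : nat}.
Variables (P : problem R n dx dy).
Hypotheses (hn : (0 < n)%N) (hdy : (0 < dy)%N) (hP : problem_assumptions P).
Implicit Types (x : 'rV[R]_dx) (y z : 'rV[R]_dy) (w : 'rV[R]_(dx + dy)).
Let L := Lg1 P.
Let m := mu P.
Let N : R := n%:R.
Let N0 : 0 < N. Proof. by rewrite ltr0n. Qed.
Let m0 : 0 < m. Proof. exact: mu_gt0. Qed.
Let mL : m <= L. Proof. exact: mu_le_Lg1. Qed.
Let L0 : 0 < L. Proof. exact: lt_le_trans m0 mL. Qed.

(** The joint gradient of delta f_i + g_i. With delta = 0 it also serves z, whose target is y*, so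
    one set of estimates covers both lower-level variables. *)
Definition reg (delta : R) i w : 'rV[R]_(dx + dy) :=
  delta *: gradf P i w + gradg P i w.

Definition regx delta i x y z : 'rV[R]_dx :=
  lsubmx (reg delta i (row_mx x y)) - lsubmx (reg 0 i (row_mx x z)).

Definition regy delta i x y : 'rV[R]_dy := rsubmx (reg delta i (row_mx x y)).

Section Delta.
Variable delta : R.
Hypotheses (d0 : 0 <= delta) (dm : 10 * (delta * `|Lf1 P|) <= m).

Lemma reg_lip i w w' :
  sq (reg delta i w - reg delta i w') <= 5 / 4 * L ^+ 2 * sq (w - w').
Proof.
have E : reg delta i w - reg delta i w' =
    delta *: (gradf P i w - gradf P i w') + (gradg P i w - gradg P i w').
  by rewrite /reg scalerBr opprD addrACA.
have [_ Lf] := f_lipschitz_gradient hP i; have [_ Lg] := g_lipschitz_gradient hP i.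
have H : enorm (reg delta i w - reg delta i w') <= 11 / 10 * L * enorm (w - w').
  rewrite E; apply: le_trans (enormD _ _) _; rewrite enormZ ger0_norm//.
  have f1 : enorm (gradf P i w - gradf P i w') <= `|Lf1 P| * enorm (w - w').
    by apply: le_trans (Lf _ _) _; rewrite ler_wpM2r ?enorm_ge0// ler_norm.
  apply: le_trans (lerD (ler_wpM2l d0 f1) (Lg w w')) _.
  rewrite mulrA -mulrDl ler_wpM2r ?enorm_ge0// -/L.
  by clear f1 E Lf Lg; move: dm mL; lra.
have e0 := enorm_ge0 (w - w').
apply: le_trans (enorm_le_sq _ H) _; first by nonneg.
rewrite exprMn enorm_sq ler_wpM2r ?sq_ge0//.
by rewrite exprMn ler_wpM2r ?sqr_ge0// expr2; lra.
Qed.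

Lemma sq_lsubmx w : sq (lsubmx w) <= sq w.
Proof. by rewrite -[in leRHS](hsubmxK w) sq_row_mx lerDl sq_ge0. Qed.

Lemma sq_rsubmx w : sq (rsubmx w) <= sq w.
Proof. by rewrite -[in leRHS](hsubmxK w) sq_row_mx lerDr sq_ge0. Qed.

Lemma regy_lip i x y x' y' : sq (regy delta i x y - regy delta i x' y') <=
  5 / 4 * L ^+ 2 * (sq (x - x') + sq (y - y')).
Proof.
rewrite /regy -linearB; apply: le_trans (sq_rsubmx _) _.
by apply: le_trans (reg_lip _ _ _) _; rewrite sub_row_mx sq_row_mx.
Qed.

Lemma sq_sum_le d (F : 'I_n -> 'rV[R]_d) : sq (\sum_i F i) <= N * \sum_i sq (F i).
Proof.
have := @sq_sum_weighted R n d (fun=> 1) (fun=> 1) F (fun=> ltr01).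
rewrite (eq_bigr F); last by move=> i _; rewrite scale1r.
rewrite (eq_bigr (fun=> 1)); last by move=> i _; rewrite expr1n divr1.
rewrite sumr_const card_ord (eq_bigr (fun i => sq (F i))) // => i _.
by rewrite mul1r.
Qed.

Lemma sum_regy_monotone x y y' : 9 / 10 * N * m * sq (y' - y) <=
  dot (\sum_i regy delta i x y' - \sum_i regy delta i x y) (y' - y).
Proof.
rewrite -sumrB dot_suml.
have -> : 9 / 10 * N * m * sq (y' - y) = \sum_(i < n) 9 / 10 * m * sq (y' - y).
  by rewrite sumr_const card_ord -mulr_natr -/N; ring.
apply: ler_sum => i _; set v := y' - y.
have E z : dot (regy delta i x z) v =
   delta * dot (gradf P i (row_mx x z)) (row_mx 0 v)
   + dot (gradg P i (row_mx x z)) (row_mx 0 v).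
  rewrite /regy /reg linearD linearZ /= dotDl dotZl !dot_row_mxr !dot0r !add0r.
  by [].
rewrite dotBl !E.
have := gradg_convex hP i x y y'; have := gradg_convex hP i x y' y.
have -> : row_mx 0 (y - y') = - row_mx 0 (y' - y) :> 'rV[R]_(dx + dy).
  by rewrite opp_row_mx oppr0 opprB.
rewrite (sqBC y) dotNr -/v -/m => g1 g2.
have [_ /(_ (row_mx x y') (row_mx x y))] := f_lipschitz_gradient hP i.
rewrite sub_row_mx subrr enorm_row_0mx -/v => f1.
have := dot_le_enorm (gradf P i (row_mx x y') - gradf P i (row_mx x y)) (row_mx 0 v).
rewrite enorm_row_0mx dotBl ler_norml => /andP[f2 _].
have f3 : enorm (gradf P i (row_mx x y') - gradf P i (row_mx x y)) * enorm v
   <= `|Lf1 P| * sq v.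
  rewrite -enorm_sq expr2 mulrA ler_wpM2r ?enorm_ge0//.
  by apply: le_trans f1 _; rewrite ler_wpM2r ?enorm_ge0// ler_norm.
have := ler_wpM2l d0 (le_trans f3 (lexx _)).
have := ler_wpM2l d0 f2.
have : 0 <= (m / 10 - delta * `|Lf1 P|) * sq v.
  by rewrite mulr_ge0 ?sq_ge0// subr_ge0; clear f1 f2 f3 g1 g2 E; move: dm; lra.
move: g1 g2; clear f1 f2 f3 E.
move: (dot (gradf P i (row_mx x y')) (row_mx 0 v)) (dot (gradf P i (row_mx x y)) (row_mx 0 v)).
move: (dot (gradg P i (row_mx x y')) (row_mx 0 v)) (dot (gradg P i (row_mx x y)) (row_mx 0 v)).
move: (gobj P i x y) (gobj P i x y') (sq v) (`|Lf1 P|).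
intros; lra.
Qed.

Let yd := yreg P delta.

Lemma sum_regy_yreg x : \sum_i regy delta i x (yd x) = 0.
Proof.
rewrite -[RHS](yreg_stationary hn hdy hP x d0); apply: eq_bigr => i _.
by rewrite /regy /reg linearD linearZ.
Qed.

Lemma sq_sum_regy x y : sq (\sum_i regy delta i x y) <=
  5 / 4 * N ^+ 2 * L ^+ 2 * sq (y - yd x).
Proof.
have -> : \sum_i regy delta i x y = \sum_i (regy delta i x y - regy delta i x (yd x)).
  rewrite [RHS]sumrB -[LHS]subr0; congr (_ - _); exact: esym (sum_regy_yreg x).
apply: le_trans (sq_sum_le _) _.
have -> : 5 / 4 * N ^+ 2 * L ^+ 2 * sq (y - yd x)
   = N * \sum_(i < n) 5 / 4 * L ^+ 2 * sq (y - yd x).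
  by rewrite sumr_const card_ord -mulr_natr -/N; ring.
rewrite ler_wpM2l ?(ltW N0)//; apply: ler_sum => i _.
by apply: le_trans (regy_lip _ _ _ _ _) _; rewrite subrr sq0 add0r.
Qed.

(** Strong monotonicity gives - 9/5 h N m, and the square of the step at most 5/4 h^2 N^2 L^2 <=
    3/10 h N m by the bound on h: together - 3/2 h N m. *)
Lemma gap_contraction (h : R) x y : 0 <= h -> h * N * L ^+ 2 <= 6 / 25 * m ->
  sq (y - h *: (\sum_i regy delta i x y) - yd x)
    <= (1 - 3 / 2 * (h * N * m)) * sq (y - yd x).
Proof.
move=> h0 hL; set g := \sum_i _; set v := y - yd x.
have -> : y - h *: g - yd x = v - h *: g by rewrite addrAC.
have M := sum_regy_monotone x (yd x) y.
have Z : dot (\sum_i regy delta i x (yd x)) v = 0 by rewrite sum_regy_yreg dot0l.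
rewrite dotBl [X in _ <= _ - X]Z subr0 -/g -/v in M.
have S := sq_sum_regy x y; rewrite -/g -/v in S.
rewrite sqB dotZr sqZ (dotC v).
have := ler_wpM2l h0 M; have := ler_wpM2l (sqr_ge0 h) S.
have hN : 0 <= h * N * sq v by rewrite mulr_ge0 ?sq_ge0// mulr_ge0// ltW.
have := ler_wpM2l hN hL; lra.
Qed.

(** An exact gradient step is separated from its perturbations (disagreement, tracking error, moving
    minimizer) by Young's inequality with parameter q / 2, q = s phi N m. Then (1 + q/2)(1 - 3q/2)
    <= 1 - q, and q <= 1 leaves 3/q on the perturbations. *)
Lemma gap_step (s phi al au D2 S2 : R) (xh xh' : 'rV[R]_dx) (yh yh' T rho : 'rV[R]_dy) :
  0 < s -> 0 < phi -> 0 < al -> s * phi * N * L ^+ 2 <= 6 / 25 * m ->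
  yh' = yh - s *: (phi *: T + rho) ->
  sq (T - \sum_i regy delta i xh yh) <= 5 / 4 * N * L ^+ 2 * D2 / al ->
  sq rho <= au * phi * S2 ->
  sq (yh' - yd xh') / s <= sq (yh - yd xh) / s - phi * N * m * sq (yh - yd xh)
    + 9 * (L / m) ^+ 2 * sq (xh' - xh) / (s ^+ 2 * phi * N * m)
    + 15 * phi * L ^+ 2 * D2 / (al * m) + 12 * au * S2 / (N * m).
Proof.
move=> s0 phi0 al0 hL yE TE rE.
set g := \sum_i regy delta i xh yh in TE.
set p2 := sq (yh - yd xh).
have h0 : 0 <= s * phi by nonneg.
pose a := yh - (s * phi) *: g - yd xh.
have aC : sq a <= (1 - 3 / 2 * (s * phi * N * m)) * p2 by exact: gap_contraction.
pose b := (- s) *: (phi *: (T - g) + rho) + (yd xh - yd xh').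
have abE : yh' - yd xh' = a + b.
  rewrite yE /a /b !scalerDr !scalerN !scaleNr !scalerA.
  apply/rowP => j; rewrite !mxE; ring.
pose q := s * phi * N * m.
have q0 : 0 < q by rewrite /q !mulr_gt0.
have q1 : q <= 1.
  rewrite /q -(ler_pM2r m0) mul1r -[leLHS]mulrA -expr2.
  apply: le_trans (_ : s * phi * N * L ^+ 2 <= _).
    rewrite ler_wpM2l//; first by nonneg.
    by rewrite ler_pXn2r// nnegrE ltW.
  by move: hL m0; lra.
have bB : sq b <= 3 * (L / m) ^+ 2 * sq (xh' - xh)
   + 4 * s ^+ 2 * (phi ^+ 2 * (5 / 4 * N * L ^+ 2 * D2 / al) + au * phi * S2).
  apply: le_trans (sqD_le2 _ _) _; rewrite addrC; apply: lerD.
    have := yreg_lipschitz hn hdy hP xh xh' d0 dm.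
    by rewrite -/yd sqBC -/L -/m; lra.
  rewrite sqZ sqrrN.
  have := sqD_le2 (phi *: (T - g)) rho; rewrite sqZ => H.
  have H1 := ler_wpM2l (sqr_ge0 phi) TE.
  have H2 : sq (phi *: (T - g) + rho) <=
     2 * (phi ^+ 2 * (5 / 4 * N * L ^+ 2 * D2 / al) + au * phi * S2).
    by move: H H1 rE; lra.
  have := ler_wpM2l (sqr_ge0 s) H2; lra.
have main : sq (yh' - yd xh') <= (1 - q) * p2 + 3 / q * sq b.
  have q20 : 0 < q / 2 by rewrite divr_gt0.
  rewrite abE; apply: le_trans (sqD_young a b q20) _.
  have a1 : 0 <= 1 + q / 2 by nonneg.
  have k1 : (1 + q / 2) * sq a <= (1 - q) * p2.
    apply: le_trans (ler_wpM2l a1 aC) _; rewrite -/q mulrA.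
    rewrite ler_wpM2r ?sq_ge0//; have := sqr_ge0 q; lra.
  have k2 : (1 + (q / 2)^-1) * sq b <= 3 / q * sq b.
    rewrite ler_wpM2r ?sq_ge0// invf_div ler_pdivlMr// mulrDl divfK ?gt_eqF//.
    by move: q1; lra.
  exact: lerD k1 k2.
have k3 : 0 <= 3 / q by nonneg.
have := le_trans main (lerD (lexx _) (ler_wpM2l k3 bB)).
rewrite -(ler_pM2r (_ : 0 < s^-1)) ?invr_gt0// => H.
apply: le_trans H _; rewrite le_eqVlt; apply/orP; left; apply/eqP.
by rewrite /q /p2; field; rewrite !gt_eqF.
Qed.

End Delta.
End StepEstimates.


(** * Variation of the local directions and of their sums *)

Section DriftEstimates.
Context {R : realType} {n dx dy : nat}.
Variables (P : problem R n dx dy).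
Hypotheses (hn : (0 < n)%N) (hdy : (0 < dy)%N) (hP : problem_assumptions P).
Implicit Types (x : 'rV[R]_dx) (y z : 'rV[R]_dy).
Let L := Lg1 P.
Let N : R := n%:R.
Let N0 : 0 < N. Proof. by rewrite ltr0n. Qed.
Let L0 : 0 < L. Proof. exact: Lg1_gt0. Qed.
Variable delta : R.
Hypotheses (d0 : 0 < delta) (dm : 10 * (delta * `|Lf1 P|) <= mu P).

Let dm0 : 10 * (0 * `|Lf1 P|) <= mu P.
Proof. by rewrite mul0r mulr0 ltW// mu_gt0. Qed.

Let subrACA (V : zmodType) (a b c e : V) : a - b - (c - e) = a - c - (b - e).
Proof. by rewrite !opprB addrACA [RHS]addrACA [- c - b]addrC. Qed.

Let sq_split (a b : 'rV[R]_(dx + dy)) :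
  sq (lsubmx a - lsubmx b) + sq (rsubmx a) + sq (rsubmx b) <= 2 * sq a + 2 * sq b.
Proof.
have sE (w : 'rV[R]_(dx + dy)) : sq w = sq (lsubmx w) + sq (rsubmx w).
  by rewrite -sq_row_mx hsubmxK.
rewrite (sE a) (sE b).
have := sqB_le2 (lsubmx a) (lsubmx b).
have := sq_ge0 (rsubmx a); have := sq_ge0 (rsubmx b); lra.
Qed.

Let reg_lip_pair (e : R) i x x' y y' : 0 <= e -> 10 * (e * `|Lf1 P|) <= mu P ->
  sq (reg P e i (row_mx x y) - reg P e i (row_mx x' y')) <=
  5 / 4 * L ^+ 2 * (sq (x - x') + sq (y - y')).
Proof.
move=> e0 em; apply: le_trans (reg_lip hn hdy hP e0 em _ _ _) _.
by rewrite sub_row_mx sq_row_mx.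
Qed.

Let two_ge0 : 0 <= 2 :> R. Proof. by []. Qed.

(** The three directions are blocks of two joint gradient differences a and b: x uses the difference
    of their x-blocks, y and z their y-blocks. Treated together they cost only 2 |a|^2 + 2 |b|^2. *)
Lemma directions_lip i x y z x' y' z' :
  sq (regx P delta i x y z - regx P delta i x' y' z')
  + sq (regy P delta i x y - regy P delta i x' y')
  + sq (regy P 0 i x z - regy P 0 i x' z')
  <= 5 * L ^+ 2 * (sq (x - x') + sq (y - y') + sq (z - z')).
Proof.
pose a := reg P delta i (row_mx x y) - reg P delta i (row_mx x' y').
pose b := reg P 0 i (row_mx x z) - reg P 0 i (row_mx x' z').
have E1 : regx P delta i x y z - regx P delta i x' y' z' = lsubmx a - lsubmx b.
  by rewrite /regx subrACA; congr (_ - _); exact: esym (linearB _ _ _).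
have E2 : regy P delta i x y - regy P delta i x' y' = rsubmx a.
  exact: esym (linearB _ _ _).
have E3 : regy P 0 i x z - regy P 0 i x' z' = rsubmx b.
  exact: esym (linearB _ _ _).
rewrite E1 E2 E3; apply: le_trans (sq_split _ _) _.
apply: le_trans (lerD (ler_wpM2l two_ge0 (reg_lip_pair i x x' y y' (ltW d0) dm))
  (ler_wpM2l two_ge0 (reg_lip_pair i x x' z z' (lexx _) dm0))) _.
clear E1 E2 E3 a b.
have := mulr_ge0 (sqr_ge0 L) (sq_ge0 (y - y')).
have := mulr_ge0 (sqr_ge0 L) (sq_ge0 (z - z')).
by move: (sq (x - x')) (sq (y - y')) (sq (z - z')) => X Y Z; lra.
Qed.

Section Weighted.
Variables (p : 'I_n -> R) (al : R).
Hypotheses (p_sum : \sum_i p i = 1) (al0 : 0 < al) (p_ge : forall i, al <= p i).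

Lemma dispersion_le d (xi : 'I_n -> 'rV[R]_d) :
  \sum_i sq (xi i - wmean p xi) <= wvar p xi / al.
Proof.
rewrite ler_pdivlMr// mulr_suml; apply: ler_sum => i _.
by rewrite mulrC ler_wpM2r ?sq_ge0.
Qed.

Variables (x : 'I_n -> 'rV[R]_dx) (y z : 'I_n -> 'rV[R]_dy).
Let xh := wmean p x.
Let yh := wmean p y.
Let zh := wmean p z.
Let D2 := wvar p x + wvar p y + wvar p z.

Lemma regx_consensus :
  sq (\sum_i regx P delta i (x i) (y i) (z i) - \sum_i regx P delta i xh yh zh)
  <= 5 * N * L ^+ 2 * D2 / al.
Proof.
rewrite -[X in sq X]sumrB; apply: le_trans (sq_sum_le _) _.
have -> : 5 * N * L ^+ 2 * D2 / al = N * (5 * L ^+ 2 *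
   (wvar p x / al + wvar p y / al + wvar p z / al)) by rewrite /D2; ring.
rewrite ler_wpM2l ?(ltW N0)//.
apply: le_trans (_ : 5 * L ^+ 2 * (\sum_i (sq (x i - xh) + sq (y i - yh) + sq (z i - zh))) <= _).
  rewrite mulr_sumr; apply: ler_sum => i _.
  apply: le_trans _ (directions_lip i _ _ _ _ _ _).
  by rewrite -[leRHS]addrA lerDl addr_ge0 ?sq_ge0.
apply: ler_wpM2l; first by nonneg.
by rewrite !big_split /= !lerD ?dispersion_le.
Qed.

Lemma regy_consensus (e : R) (u : 'I_n -> 'rV[R]_dy) :
  0 <= e -> 10 * (e * `|Lf1 P|) <= mu P -> wvar p x + wvar p u <= D2 ->
  sq (\sum_i regy P e i (x i) (u i) - \sum_i regy P e i xh (wmean p u))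
  <= 5 / 4 * N * L ^+ 2 * D2 / al.
Proof.
move=> e0 em uD; rewrite -[X in sq X]sumrB; apply: le_trans (sq_sum_le _) _.
have -> : 5 / 4 * N * L ^+ 2 * D2 / al = N * (5 / 4 * L ^+ 2 * (D2 / al)) by ring.
rewrite ler_wpM2l ?(ltW N0)//.
apply: le_trans (_ : 5 / 4 * L ^+ 2 * (\sum_i (sq (x i - xh) + sq (u i - wmean p u))) <= _).
  rewrite mulr_sumr; apply: ler_sum => i _.
  exact: (regy_lip hn hdy hP e0 em).
apply: ler_wpM2l; first by nonneg.
rewrite big_split /=; apply: le_trans (lerD (dispersion_le x) (dispersion_le u)) _.
by rewrite -mulrDl ler_wpM2r// invr_ge0 ltW.
Qed.

End Weighted.

Let yd := yreg P delta.
Let ys := yreg P 0.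

Lemma regx_gap xh yh zh :
  sq (\sum_i regx P delta i xh yh zh - \sum_i regx P delta i xh (yd xh) (ys xh))
  <= 5 / 2 * N ^+ 2 * L ^+ 2 * (sq (yh - yd xh) + sq (zh - ys xh)).
Proof.
rewrite -[X in sq X]sumrB; apply: le_trans (sq_sum_le _) _.
have -> : 5 / 2 * N ^+ 2 * L ^+ 2 * (sq (yh - yd xh) + sq (zh - ys xh))
  = N * \sum_(i < n) 5 / 2 * L ^+ 2 * (sq (yh - yd xh) + sq (zh - ys xh)).
  by rewrite sumr_const card_ord -mulr_natr -/N; ring.
rewrite ler_wpM2l ?(ltW N0)//; apply: ler_sum => i _.
pose a := reg P delta i (row_mx xh yh) - reg P delta i (row_mx xh (yd xh)).
pose b := reg P 0 i (row_mx xh zh) - reg P 0 i (row_mx xh (ys xh)).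
have E1 : regx P delta i xh yh zh - regx P delta i xh (yd xh) (ys xh) = lsubmx a - lsubmx b.
  by rewrite /regx subrACA; congr (_ - _); exact: esym (linearB _ _ _).
rewrite E1; apply: le_trans (sqB_le2 _ _) _.
have A : sq (lsubmx a) <= 5 / 4 * L ^+ 2 * sq (yh - yd xh).
  apply: le_trans (sq_lsubmx _) _.
  apply: le_trans (reg_lip_pair i xh xh yh (yd xh) (ltW d0) dm) _.
  by rewrite subrr sq0 add0r.
have B : sq (lsubmx b) <= 5 / 4 * L ^+ 2 * sq (zh - ys xh).
  apply: le_trans (sq_lsubmx _) _.
  apply: le_trans (reg_lip_pair i xh xh zh (ys xh) (lexx _) dm0) _.
  by rewrite subrr sq0 add0r.
apply: le_trans (lerD (ler_wpM2l two_ge0 A) (ler_wpM2l two_ge0 B)) _.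
clear A B E1 a b.
by move: (sq (yh - yd xh)) (sq (zh - ys xh)) => X Y; lra.
Qed.

End DriftEstimates.

(** * Network constants *)

Section Entries.
Context {R : realType} {n : nat}.
Implicit Types v : 'cV[R]_n.

Lemma minentry_le v i : minentry v <= v i 0.
Proof.
apply: ge_inf; last by exists i.
exists (- \sum_j `|v j 0|) => _ [j _ <-]; rewrite lerNl.
apply: le_trans (ler_norm _) _; rewrite normrN.
by rewrite (bigD1 j)//= lerDl sumr_ge0.
Qed.

Lemma maxentry_ge v i : v i 0 <= maxentry v.
Proof.
apply: ub_le_sup; last by exists i.
exists (\sum_j `|v j 0|) => _ [j _ <-].
apply: le_trans (ler_norm _) _.
by rewrite (bigD1 j)//= lerDl sumr_ge0.
Qed.

Lemma minentry_ge v (c : R) : (0 < n)%N -> (forall i, c <= v i 0) -> c <= minentry v.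
Proof.
move=> n0 H; apply: lb_le_inf; first by exists (v (Ordinal n0) 0); exists (Ordinal n0).
by move=> _ [j _ <-].
Qed.

Lemma maxentry_le v (c : R) : (0 < n)%N -> (forall i, v i 0 <= c) -> maxentry v <= c.
Proof.
move=> n0 H; apply: ge_sup; first by exists (v (Ordinal n0) 0); exists (Ordinal n0).
by move=> _ [j _ <-].
Qed.

End Entries.

Section NetworkFacts.
Context {R : realType} {n : nat}.
Variable N : network R n.
Hypotheses (hn : (2 <= n)%N) (hN : network_assumptions N).

Let n0 : (0 < n)%N. Proof. exact: ltnW. Qed.
Let nR : 0 < n%:R :> R. Proof. by rewrite ltr0n. Qed.
Let o : 'I_n := Ordinal n0.

Let nsumE (r : R) : r * n%:R = \sum_(i < n) r.
Proof. by rewrite sumr_const card_ord mulr_natr. Qed.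

Let a := a_lb N.
Let b := b_lb N.
Let a0 : 0 < a. Proof. exact: a_lb_gt0. Qed.
Let b0 : 0 < b. Proof. exact: b_lb_gt0. Qed.

Lemma alpha_lo_gt0 : 0 < alpha_lo N. Proof. exact: exprn_gt0. Qed.
Lemma beta_lo_gt0 : 0 < beta_lo N. Proof. exact: exprn_gt0. Qed.

Lemma A_diag_lb k i : a <= Amx N k i i.
Proof.
apply: (A_lb hN); apply/eqP => h.
by have := A_pattern hN k i i; rewrite h ltxx eqxx orbT.
Qed.

Lemma B_diag_lb k i : b <= Bmx N k i i.
Proof.
apply: (B_lb hN); apply/eqP => h.
by have := B_pattern hN k i i; rewrite h ltxx eqxx orbT.
Qed.

Lemma A_edge_lb k i j : edge N k j i -> a <= Amx N k i j.
Proof.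
move=> e; apply: (A_lb hN); apply/eqP => h.
by have := A_pattern hN k i j; rewrite h ltxx e.
Qed.

Lemma B_edge_lb k i j : edge N k j i -> b <= Bmx N k i j.
Proof.
move=> e; apply: (B_lb hN); apply/eqP => h.
by have := B_pattern hN k j i; rewrite h ltxx e.
Qed.

Lemma a_lb_le1 : a <= 1.
Proof.
apply: le_trans (A_diag_lb 0 o) _; rewrite -(A_row_stochastic hN 0 o).
by rewrite (bigD1 o)//= lerDl sumr_ge0// => j _; exact: A_ge0.
Qed.

(** Connectivity with n >= 2 gives agent 0 an out-neighbour, so its column has two entries of size
    at least b and sum 1. The resulting [beta_lo] <= 1/4 supplies numerical margin for the
    admissible bounds. *)
Lemma b_lb_le_half : b <= 1 / 2.
Proof.
have [j ji e] := exists_out_edge (strongly_connected hN 0) hn o.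
have := B_column_stochastic hN 0 o; rewrite (bigD1 o)//= (bigD1 j)//=.
have := B_diag_lb 0 o; have := B_edge_lb e.
have : 0 <= \sum_(i < n | (i != o) && (i != j)) Bmx N 0 i o.
  by apply: sumr_ge0 => i _; exact: B_ge0.
lra.
Qed.

Lemma alpha_lo_le_a : alpha_lo N <= a.
Proof.
have H : {homo GRing.exp a : k l / (l <= k)%N >-> k <= l}.
  by apply: ler_wiXn2l; [exact: ltW | exact: a_lb_le1].
exact: (H n 1%N n0).
Qed.

Lemma alpha_lo_le1 : alpha_lo N <= 1.
Proof. exact: le_trans alpha_lo_le_a a_lb_le1. Qed.

Lemma beta_lo_le : beta_lo N <= 1 / 4.
Proof.
have b1 : b <= 1 by have := b_lb_le_half; lra.
apply: le_trans (_ : b ^+ 2 <= _).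
  have H : {homo GRing.exp b : k l / (l <= k)%N >-> k <= l}.
    by apply: ler_wiXn2l => //; exact: ltW.
  exact: (H n 2%N hn).
have -> : 1 / 4 = (1 / 2) ^+ 2 :> R by rewrite expr2; lra.
by rewrite ler_pXn2r ?nnegrE ?(ltW b0) ?b_lb_le_half// divr_ge0.
Qed.

Definition al : R := alpha_lo N / n%:R.
Definition au : R := alpha_up N / n%:R.
Definition bl : R := beta_lo N / n%:R.
Definition bu : R := beta_up N / n%:R.

Lemma al_gt0 : 0 < al. Proof. by rewrite divr_gt0 ?alpha_lo_gt0. Qed.
Lemma bl_gt0 : 0 < bl. Proof. by rewrite divr_gt0 ?beta_lo_gt0. Qed.
Lemma alpha_ge k i : al <= alpha N k i 0. Proof. by have /andP[] := alpha_bounds hN k i. Qed.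
Lemma alpha_le k i : alpha N k i 0 <= au. Proof. by have /andP[] := alpha_bounds hN k i. Qed.
Lemma beta_ge k i : bl <= beta N k i 0. Proof. by have /andP[] := beta_bounds hN k i. Qed.
Lemma beta_le k i : beta N k i 0 <= bu. Proof. by have /andP[] := beta_bounds hN k i. Qed.

Lemma alpha_sum k : \sum_i alpha N k i 0 = 1.
Proof. by have [] := alpha_stochastic hN k. Qed.
Lemma beta_sum k : \sum_i beta N k i 0 = 1.
Proof. by have [] := beta_stochastic hN k. Qed.

Lemma alpha_up_ge1 : 1 <= alpha_up N.
Proof.
rewrite -(alpha_sum 0); apply: le_trans (ler_sum _ (fun i _ => alpha_le 0 i)) _.
by rewrite sumr_const card_ord -mulr_natr /au divfK ?gt_eqF.
Qed.

Lemma beta_up_ge1 : 1 <= beta_up N.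
Proof.
rewrite -(beta_sum 0); apply: le_trans (ler_sum _ (fun i _ => beta_le 0 i)) _.
by rewrite sumr_const card_ord -mulr_natr /bu divfK ?gt_eqF.
Qed.

Lemma au_gt0 : 0 < au.
Proof. by rewrite divr_gt0//; apply: lt_le_trans alpha_up_ge1. Qed.
Lemma bu_gt0 : 0 < bu.
Proof. by rewrite divr_gt0//; apply: lt_le_trans beta_up_ge1. Qed.

Lemma alpha_left k j : \sum_i alpha N k.+1 i 0 * Amx N k i j = alpha N k j 0.
Proof.
have := congr1 (fun M : 'rV[R]_n => M 0 j) (alpha_rec hN k); rewrite !mxE => <-.
by apply: eq_bigr => i _; rewrite mxE.
Qed.

Lemma beta_next k i : \sum_j Bmx N k i j * beta N k j 0 = beta N k.+1 i 0.
Proof. by rewrite (beta_rec hN) mxE. Qed.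

(** The edge weights that [mix_drop_edges] asks for, [omegaA] for the matrix A and [omegaB] for
    [pushW]. Divided by the Poincare factor they are [c_seq] and [e_seq]. *)
Definition omegaA k : R := minentry (alpha N k.+1) * a ^+ 2.
Definition omegaB k : R := minentry (beta N k) ^+ 2 * b ^+ 2 / maxentry (beta N k.+1).

Let minA k : al <= minentry (alpha N k).
Proof. by apply: minentry_ge => // i; exact: alpha_ge. Qed.
Let minB k : bl <= minentry (beta N k).
Proof. by apply: minentry_ge => // i; exact: beta_ge. Qed.
Let maxA_gt0 k : 0 < maxentry (alpha N k).
Proof. by apply: lt_le_trans (maxentry_ge _ o); apply: lt_le_trans (alpha_ge k o); exact: al_gt0. Qed.
Let maxB_gt0 k : 0 < maxentry (beta N k).
Proof. by apply: lt_le_trans (maxentry_ge _ o); apply: lt_le_trans (beta_ge k o); exact: bl_gt0. Qed.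
Let maxA_le1 k : maxentry (alpha N k) <= 1.
Proof. by apply: maxentry_le => // i; apply: le_trans (alpha_le k i) (alpha_up_le hN). Qed.
Let maxB_le1 k : maxentry (beta N k) <= 1.
Proof. by apply: maxentry_le => // i; apply: le_trans (beta_le k i) (beta_up_le hN). Qed.
Let minA_gt0 k : 0 < minentry (alpha N k).
Proof. exact: lt_le_trans al_gt0 (minA k). Qed.
Let minB_gt0 k : 0 < minentry (beta N k).
Proof. exact: lt_le_trans bl_gt0 (minB k). Qed.

Lemma omegaA_gt0 k : 0 < omegaA k.
Proof. by rewrite mulr_gt0 ?exprn_gt0. Qed.

Lemma omegaB_gt0 k : 0 < omegaB k.
Proof. by rewrite divr_gt0// mulr_gt0 ?exprn_gt0. Qed.

Lemma omegaA_le k i j : edge N k j i ->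
  omegaA k <= alpha N k.+1 i 0 * Amx N k i i * Amx N k i j.
Proof.
move=> e; rewrite /omegaA expr2 mulrA; apply: ler_pM; rewrite ?(ltW a0)//.
- by rewrite mulr_ge0 ?ltW.
- by apply: ler_pM; rewrite ?(ltW a0) ?(ltW (minA_gt0 _)) ?minentry_le ?A_diag_lb.
- exact: A_edge_lb.
Qed.

Lemma omegaB_le k i j : edge N k j i -> omegaB k <=
  Bmx N k i i * Bmx N k i j * beta N k i 0 * beta N k j 0 / beta N k.+1 i 0.
Proof.
move=> e; have bp l m : 0 < beta N l m 0 by apply: lt_le_trans (beta_ge l m); exact: bl_gt0.
have m0 := ltW (minB_gt0 k).
apply: ler_pM.
- by rewrite mulr_ge0 ?exprn_ge0// ltW.
- by rewrite invr_ge0 ltW.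
- have -> : minentry (beta N k) ^+ 2 * b ^+ 2 =
    b * b * minentry (beta N k) * minentry (beta N k) by ring.
  have bb : 0 <= b := ltW b0.
  apply: ler_pM; rewrite ?minentry_le ?mulr_ge0//.
  apply: ler_pM; rewrite ?minentry_le ?mulr_ge0//.
  by apply: ler_pM => //; [exact: B_diag_lb | exact: B_edge_lb].
- by rewrite lef_pV2 ?posrE// maxentry_ge.
Qed.

Let DK k : 0 < (diameter (edge N k))%:R * (max_utility (edge N k))%:R :> R.
Proof. exact: diameter_utility_gt0 hn (strongly_connected hN k). Qed.

Let DK_le k : (diameter (edge N k))%:R * (max_utility (edge N k))%:R <= n%:R ^+ 3 :> R.
Proof.
have -> : n%:R ^+ 3 = n%:R * (n%:R * n%:R) :> R by ring.
apply: ler_pM => //; first by rewrite ler_nat diameter_le.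
by rewrite -natrM ler_nat max_utility_le.
Qed.

Lemma c_seqE k : c_seq N k = omegaA k /
  (maxentry (alpha N k) ^+ 2 * (diameter (edge N k))%:R * (max_utility (edge N k))%:R).
Proof. by []. Qed.

Lemma e_seqE k : e_seq N k = omegaB k /
  (maxentry (beta N k) ^+ 2 * (diameter (edge N k))%:R * (max_utility (edge N k))%:R).
Proof.
have /pmulr_rgt0 := DK k; have := DK k.
move=> dk _; have d0 : (diameter (edge N k))%:R != 0 :> R.
  by apply/eqP => h; rewrite h mul0r ltxx in dk.
have u0 : (max_utility (edge N k))%:R != 0 :> R.
  by apply/eqP => h; rewrite h mulr0 ltxx in dk.
rewrite /e_seq /omegaB -/b; field.
by rewrite d0 u0 !gt_eqF.
Qed.

Let c_lb k : al * a ^+ 2 / n%:R ^+ 3 <= c_seq N k.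
Proof.
rewrite c_seqE; apply: ler_pM.
- by rewrite mulr_ge0 ?sqr_ge0// ltW// al_gt0.
- by rewrite invr_ge0 exprn_ge0// ltW.
- by rewrite ler_wpM2r ?sqr_ge0.
- rewrite lef_pV2 ?posrE ?exprn_gt0//; last by rewrite -mulrA mulr_gt0 ?exprn_gt0.
  rewrite -mulrA; apply: le_trans (DK_le k); rewrite ler_piMl ?(ltW (DK k))//.
  by rewrite exprn_ile1// ltW.
Qed.

Let e_lb k : bl ^+ 2 * b ^+ 2 / n%:R ^+ 3 <= e_seq N k.
Proof.
rewrite e_seqE; apply: ler_pM.
- by rewrite mulr_ge0 ?sqr_ge0.
- by rewrite invr_ge0 exprn_ge0// ltW.
- rewrite /omegaB ler_pdivlMr//.
  apply: le_trans (_ : bl ^+ 2 * b ^+ 2 <= _).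
    by rewrite ler_piMr ?maxB_le1// mulr_ge0 ?sqr_ge0.
  rewrite ler_wpM2r ?sqr_ge0// ler_pXn2r ?nnegrE ?(ltW bl_gt0) ?(ltW (minB_gt0 _))//.
- rewrite lef_pV2 ?posrE ?exprn_gt0//; last by rewrite -mulrA mulr_gt0 ?exprn_gt0.
  rewrite -mulrA; apply: le_trans (DK_le k); rewrite ler_piMl ?(ltW (DK k))//.
  by rewrite exprn_ile1// ltW.
Qed.

Let range_nonempty (f : nat -> R) : range f !=set0.
Proof. by exists (f 0%N); exists 0%N. Qed.

Lemma c_inf_gt0 : 0 < c_inf N.
Proof.
apply: lt_le_trans (_ : al * a ^+ 2 / n%:R ^+ 3 <= _).
  by rewrite divr_gt0 ?exprn_gt0// mulr_gt0 ?exprn_gt0 ?al_gt0.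
by apply: lb_le_inf => // _ [k _ <-].
Qed.

Lemma e_inf_gt0 : 0 < e_inf N.
Proof.
apply: lt_le_trans (_ : bl ^+ 2 * b ^+ 2 / n%:R ^+ 3 <= _).
  by rewrite divr_gt0 ?exprn_gt0// mulr_gt0 ?exprn_gt0 ?bl_gt0.
by apply: lb_le_inf => // _ [k _ <-].
Qed.

Lemma c_inf_le k : c_inf N <= c_seq N k.
Proof.
apply: ge_inf; last by exists k.
by exists (al * a ^+ 2 / n%:R ^+ 3) => _ [l _ <-].
Qed.

Lemma e_inf_le k : e_inf N <= e_seq N k.
Proof.
apply: ge_inf; last by exists k.
by exists (bl ^+ 2 * b ^+ 2 / n%:R ^+ 3) => _ [l _ <-].
Qed.

Lemma c_inf_rate k : c_inf N * (maxentry (alpha N k) ^+ 2 *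
  (diameter (edge N k))%:R * (max_utility (edge N k))%:R) <= omegaA k.
Proof.
by rewrite -ler_pdivlMr -?c_seqE ?c_inf_le// -mulrA mulr_gt0 ?exprn_gt0.
Qed.

Lemma e_inf_rate k : e_inf N * (maxentry (beta N k) ^+ 2 *
  (diameter (edge N k))%:R * (max_utility (edge N k))%:R) <= omegaB k.
Proof.
by rewrite -ler_pdivlMr -?e_seqE ?e_inf_le// -mulrA mulr_gt0 ?exprn_gt0.
Qed.

Lemma c_inf_le_half : c_inf N <= 1 / 2.
Proof.
apply: le_trans (c_inf_le 0) _; rewrite c_seqE.
have pa k i : 0 < alpha N k i 0 by apply: lt_le_trans (alpha_ge k i); exact: al_gt0.
apply: (@mix_rate_le _ _ (edge N 0) (Amx N 0) (fun i => alpha N 0 i 0)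
  (fun i => alpha N 1 i 0)) => //.
- exact: strongly_connected.
- exact: A_ge0.
- exact: A_row_stochastic.
- exact: alpha_sum.
- by move=> i; exact: ltW.
- exact: alpha_left.
- exact: ltW (omegaA_gt0 0).
- exact: omegaA_le.
- by move=> i; exact: maxentry_ge.
Qed.

Let beta_gt0 k i : 0 < beta N k i 0.
Proof. by apply: lt_le_trans (beta_ge k i); exact: bl_gt0. Qed.

Lemma e_inf_le_half : e_inf N <= 1 / 2.
Proof.
apply: le_trans (e_inf_le 0) _; rewrite e_seqE.
apply: (@mix_rate_le _ _ (edge N 0)
  (pushW (Bmx N 0) (fun i => beta N 0 i 0) (fun i => beta N 1 i 0))
  (fun i => beta N 0 i 0) (fun i => beta N 1 i 0)) => //.
- exact: strongly_connected.
- move=> i j; rewrite mxE divr_ge0 ?mulr_ge0// ?(ltW (beta_gt0 _ _))//.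
  exact: B_ge0.
- move=> i; rewrite (eq_bigr (fun j => Bmx N 0 i j * beta N 0 j 0 / beta N 1 i 0)).
    by rewrite -mulr_suml beta_next divff ?gt_eqF.
  by move=> j _; rewrite mxE.
- exact: beta_sum.
- by move=> i; exact: ltW.
- move=> j; rewrite (eq_bigr (fun i => Bmx N 0 i j * beta N 0 j 0)).
    by rewrite -mulr_suml (B_column_stochastic hN) mul1r.
  by move=> i _; rewrite mxE; field; rewrite gt_eqF.
- exact: ltW (omegaB_gt0 0).
- move=> i j e; apply: le_trans (omegaB_le e) _; rewrite !mxE.
  rewrite le_eqVlt; apply/orP; left; apply/eqP; field; rewrite gt_eqF//.
- by move=> i; exact: maxentry_ge.
Qed.

(** The smallest entry of a stochastic vector is at most 1/n, so its inverse contributes another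
    n. *)
Lemma gamma_sup_ge : 2 * n%:R <= gamma_sup N.
Proof.
apply: le_trans (_ : n%:R + (minentry (beta N 1))^-1 <= _).
  rewrite mulr_natl mulr2n lerD2l -[leLHS]invrK lef_pV2 ?posrE ?invr_gt0//.
  rewrite -(ler_pM2r nR) mulVf ?gt_eqF//.
  rewrite nsumE; apply: le_trans (_ : \sum_i beta N 1 i 0 <= _); last by rewrite beta_sum.
  by apply: ler_sum => i _; exact: minentry_le.
apply: ub_le_sup; last by exists 0%N.
exists (n%:R + bl^-1) => _ [k _ <-]; rewrite lerD2l.
by rewrite lef_pV2 ?posrE ?bl_gt0.
Qed.

Context {dx dy : nat}.
Variable P : problem R n dx dy.
Hypotheses (mu0 : 0 < mu P) (muL : mu P <= Lg1 P).

Lemma q_inf_ge : beta_lo N * mu P <= q_inf P N.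
Proof.
apply: lb_le_inf => // _ [k _ <-].
have e : beta_lo N = n%:R * bl by rewrite /bl mulrC divfK ?gt_eqF.
rewrite e le_min; apply/andP; split; apply: ler_pM => //; try exact: ltW;
  by [rewrite mulr_ge0// ltW ?bl_gt0 | rewrite ler_pM2l].
Qed.

Lemma q_inf_gt0 : 0 < q_inf P N.
Proof. by apply: lt_le_trans q_inf_ge; rewrite mulr_gt0 ?beta_lo_gt0. Qed.

(** Stated for any w above the smallest entry, in order to serve both the average 1/n and the mixing
    weight [phik]. *)
Lemma q_inf_le k (w : R) : minentry (beta N k) <= w -> q_inf P N <= n%:R * w * mu P.
Proof.
move=> h; apply: le_trans (_ : n%:R * minentry (beta N k) * mu P <= _).
  apply: le_trans (_ : Num.min (n%:R * minentry (beta N k) * mu P)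
    (n%:R * minentry (beta N k) * Lg1 P) <= _); last by rewrite ge_min lexx.
  apply: ge_inf; last by exists k.
  exists 0 => _ [l _ <-]; rewrite le_min; apply/andP; split;
    rewrite mulr_ge0 ?mulr_ge0 ?(ltW (minB_gt0 _)) ?(ltW mu0)//.
  exact: le_trans (ltW mu0) muL.
by rewrite ler_wpM2r ?(ltW mu0)// ler_wpM2l.
Qed.

Lemma q_inf_le_mu : q_inf P N <= mu P.
Proof.
apply: le_trans (q_inf_le (k := 0) (w := n%:R^-1) _) _; last first.
  by rewrite mulfV ?mul1r// gt_eqF.
rewrite -(ler_pM2r nR) mulVf ?gt_eqF//.
rewrite nsumE; apply: le_trans (_ : \sum_i beta N 0 i 0 <= _); last by rewrite beta_sum.
by apply: ler_sum => i _; exact: minentry_le.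
Qed.

End NetworkFacts.


(** * One push-pull step in terms of the network constants *)

Section NetworkStep.
Context {R : realType} {n : nat}.
Variable N : network R n.
Hypotheses (hn : (2 <= n)%N) (hN : network_assumptions N).

Definition wA k (i : 'I_n) : R := alpha N k i 0.
Definition wB k (i : 'I_n) : R := beta N k i 0.
Definition phik k : R := mixing_weight (wA k.+1) (wB k).

(** The interface between network and optimization for one of the variables x, y, z. E stands for
    [mix_drop], so that the three drops can later be added as plain numbers. *)
Record step_bounds d k (s : R) (xi xi' t t' g g' : 'I_n -> 'rV[R]_d) (E : R)
    (rho : 'rV[R]_d) : Prop := StepBounds {
  sb_drop : 2 * c_inf N * wvar (wA k) xi <= E;
  sb_cons : wvar (wA k.+1) xi' <= wvar (wA k) xi - E / 2
    + 2 * au N * bu N / c_inf N *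
      (s ^+ 2 * (sq (\sum_i t i) + wvar (wB k) (ratio_of (wB k) t)));
  sb_track : wvar (wB k.+1) (ratio_of (wB k.+1) t') <=
    (1 - e_inf N) * wvar (wB k) (ratio_of (wB k) t)
    + 2 / (e_inf N * bl N) * \sum_i sq (g' i - g i);
  sb_move : \sum_i sq (xi' i - xi i) <= 2 / (a_lb N * al N) * E
    + 2 * s ^+ 2 * bu N * (sq (\sum_i t i) + wvar (wB k) (ratio_of (wB k) t));
  sb_mean : wmean (wA k.+1) xi' =
    wmean (wA k) xi - s *: (phik k *: (\sum_i t i) + rho);
  sb_rho : sq rho <= au N * phik k * wvar (wB k) (ratio_of (wB k) t);
  sb_sum : \sum_i t' i = \sum_i t i + \sum_i g' i - \sum_i g i
}.

Let half (c : R) : c <= 1 / 2 -> c <= 1. Proof. by move=> h; lra. Qed.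

Lemma network_step d k (s : R) (xi xi' t t' g g' : 'I_n -> 'rV[R]_d) : 0 <= s ->
  (forall i, xi' i = \sum_j Amx N k i j *: xi j - s *: t i) ->
  (forall i, t' i = \sum_j Bmx N k i j *: t j + g' i - g i) ->
  exists E rho, step_bounds k s xi xi' t t' g g' E rho.
Proof.
move=> s0 xiE tE.
have ec := strongly_connected hN k.
have A0 := A_ge0 hN k. have A1 := A_row_stochastic hN k.
have B0 := B_ge0 hN k. have B1 := B_column_stochastic hN k.
have pa := alpha_sum hN k. have qa := alpha_sum hN k.+1.
have pb := beta_sum hN k. have qb := beta_sum hN k.+1.
have lp := alpha_ge hN k. have lq := alpha_ge hN k.+1. have uq := alpha_le hN k.+1.
have lb := beta_ge hN k. have lb' := beta_ge hN k.+1. have ub := beta_le hN k.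
have al0 := al_gt0 hn hN. have bl0 := bl_gt0 hn hN. have a0 := a_lb_gt0 hN.
have qA := alpha_left hN k. have Bb := beta_next hN k.
have oA := ltW (omegaA_gt0 hn hN k). have oB := ltW (omegaB_gt0 hn hN k).
have oAl := @omegaA_le _ _ _ hn hN k. have oBl := @omegaB_le _ _ _ hn hN k.
have mA := @maxentry_ge _ _ (alpha N k). have mB := @maxentry_ge _ _ (beta N k).
have cA := c_inf_rate hn hN k. have cB := e_inf_rate hn hN k.
have c0 := c_inf_gt0 hn hN. have c1 := half (c_inf_le_half hn hN).
have e0 := e_inf_gt0 hn hN. have e1 := half (e_inf_le_half hn hN).
have ad := A_diag_lb hN k.
have [rho mE rE] : exists2 rho,
    wmean (wA k.+1) xi' = wmean (wA k) xi - s *: (phik k *: (\sum_i t i) + rho) &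
    sq rho <= au N * phik k * wvar (wB k) (ratio_of (wB k) t).
  by apply: (mean_step (A := Amx N k) (al := al N) (bl := bl N)); eassumption.
have dr : 2 * c_inf N * wvar (wA k) xi <= mix_drop (Amx N k) (wA k) (wA k.+1) xi.
  apply: (mix_drop_var (e := edge N k) (omega := omegaA N k)
    (pmax := maxentry (alpha N k))); try eassumption.
  - by move=> i; exact: le_trans (ltW al0) (lp i).
  - by move=> i; exact: le_trans (ltW al0) (lq i).
  - exact: ltW.
exists (mix_drop (Amx N k) (wA k) (wA k.+1) xi), rho; split => //.
- by apply: (consensus_step (e := edge N k) (omA := omegaA N k)
    (pmA := maxentry (alpha N k)) (al := al N) (bl := bl N)); eassumption.
- by apply: (tracking_step (e := edge N k) (B := Bmx N k) (omB := omegaB N k)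
    (pmB := maxentry (beta N k)) (bl := bl N)); eassumption.
- by apply: (movement_step (al := al N) (bl := bl N)); eassumption.
- by apply: (tracking_sum (B := Bmx N k)); eassumption.
Qed.

End NetworkStep.

(** * One step of the algorithm *)

Section StepArithmetic.
Context {R : realType}.
Variables (n L c e a al au bl bu s sx sy sz phi : R).
Variables (Dx Dy Dz Dx' Dy' Dz' Sx Sy Sz Sx' Sy' Sz' Ex Ey Ez Tx Ty Tz : R).
Variables (vx vy vz wx wy wz p2 r2 du2 b4 ex rx g2 : R).
Hypotheses (n0 : 0 < n) (c0 : 0 < c) (e0 : 0 < e) (a0 : 0 < a) (al0 : 0 < al).
Hypotheses (au0 : 0 < au) (bl0 : 0 < bl) (bu0 : 0 < bu) (phi0 : 0 < phi).
Hypotheses (sxs : sx ^+ 2 <= s ^+ 2) (sys : sy ^+ 2 <= s ^+ 2) (szs : sz ^+ 2 <= s ^+ 2).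
Hypotheses (Dx0 : 0 <= Dx) (Dy0 : 0 <= Dy) (Dz0 : 0 <= Dz).
Hypotheses (Sx0 : 0 <= Sx) (Sy0 : 0 <= Sy) (Sz0 : 0 <= Sz).
Hypotheses (p20 : 0 <= p2) (r20 : 0 <= r2) (b40 : 0 <= b4).
Let D2 := Dx + Dy + Dz.
Let S2 := Sx + Sy + Sz.
Let E := Ex + Ey + Ez.
Let Th := sx ^+ 2 * Tx + sy ^+ 2 * Ty + sz ^+ 2 * Tz.

Lemma forcing_le : sx ^+ 2 * (Tx + Sx) + sy ^+ 2 * (Ty + Sy) + sz ^+ 2 * (Tz + Sz)
    <= Th + s ^+ 2 * S2.
Proof.
rewrite /Th /S2; have := ler_wpM2r Sx0 sxs; have := ler_wpM2r Sy0 sys.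
by have := ler_wpM2r Sz0 szs; lra.
Qed.

Lemma consensus_le :
  Dx' <= Dx - Ex / 2 + 2 * au * bu / c * (sx ^+ 2 * (Tx + Sx)) ->
  Dy' <= Dy - Ey / 2 + 2 * au * bu / c * (sy ^+ 2 * (Ty + Sy)) ->
  Dz' <= Dz - Ez / 2 + 2 * au * bu / c * (sz ^+ 2 * (Tz + Sz)) ->
  Dx' + Dy' + Dz' <= D2 - E / 2 + 2 * au * bu / c * (Th + s ^+ 2 * S2).
Proof.
have K0 : 0 <= 2 * au * bu / c by nonneg.
have := ler_wpM2l K0 forcing_le; rewrite /D2 /E.
move: (2 * au * bu / c) => k; lra.
Qed.

Lemma tracking_le :
  Sx' <= (1 - e) * Sx + 2 / (e * bl) * wx ->
  Sy' <= (1 - e) * Sy + 2 / (e * bl) * wy ->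
  Sz' <= (1 - e) * Sz + 2 / (e * bl) * wz ->
  wx + wy + wz <= 5 * L ^+ 2 * (vx + vy + vz) ->
  vx <= 2 / (a * al) * Ex + 2 * sx ^+ 2 * bu * (Tx + Sx) ->
  vy <= 2 / (a * al) * Ey + 2 * sy ^+ 2 * bu * (Ty + Sy) ->
  vz <= 2 / (a * al) * Ez + 2 * sz ^+ 2 * bu * (Tz + Sz) ->
  Sx' + Sy' + Sz' <= (1 - e) * S2
    + 20 * L ^+ 2 / (e * bl) * (E / (a * al) + bu * (Th + s ^+ 2 * S2)).
Proof.
move=> hx hy hz V mx my mz.
pose k2 := 2 / (e * bl).
have k20 : 0 <= k2 by rewrite /k2; nonneg.
have b20 : 0 <= 2 * bu by nonneg.
have T2 := ler_wpM2l b20 forcing_le.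
have L20 : 0 <= 5 * L ^+ 2 by nonneg.
have V2 : wx + wy + wz <= 5 * L ^+ 2 * (2 * (E / (a * al) + bu * (Th + s ^+ 2 * S2))).
  apply: le_trans V _; apply: ler_wpM2l => //.
  have -> : E / (a * al) = Ex / (a * al) + Ey / (a * al) + Ez / (a * al).
    by rewrite /E; ring.
  have EE q : 2 / (a * al) * q = 2 * (q / (a * al)) by ring.
  by move: mx my mz; rewrite !EE; move: T2; lra.
have := ler_wpM2l k20 V2; move: hx hy hz; rewrite -/k2 /S2.
have -> : 20 * L ^+ 2 / (e * bl) = 10 * L ^+ 2 * k2 by rewrite /k2; ring.
move: (E / (a * al) + _) => q.
by lra.
Qed.

Hypothesis drift : ex <= 20 * n * L ^+ 2 * D2 / al
  + 5 * n ^+ 2 * L ^+ 2 * (p2 + r2) + 4 * n ^+ 2 * b4.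

Lemma drift_le : g2 <= 2 * (phi ^+ 2 * ex) + 2 * rx -> rx <= au * phi * Sx ->
  g2 <= phi ^+ 2 * (40 * n * L ^+ 2 * D2 / al
    + 10 * n ^+ 2 * L ^+ 2 * (p2 + r2) + 8 * n ^+ 2 * b4) + 2 * au * phi * S2.
Proof.
move=> g2le rle; have := ler_wpM2l (sqr_ge0 phi) drift.
have : au * phi * Sx <= au * phi * S2.
  by apply: ler_wpM2l; [nonneg | rewrite /S2; move: Sy0 Sz0; lra].
move: g2le rle; lra.
Qed.

Lemma total_direction_le : Tx <= 2 * (n ^+ 2 * du2) + 2 * ex ->
  Ty <= 5 / 2 * n ^+ 2 * L ^+ 2 * p2 + 5 / 2 * n * L ^+ 2 * D2 / al ->
  Tz <= 5 / 2 * n ^+ 2 * L ^+ 2 * r2 + 5 / 2 * n * L ^+ 2 * D2 / al ->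
  Th <= 2 * sx ^+ 2 * n ^+ 2 * du2 + s ^+ 2 *
    (25 / 2 * n ^+ 2 * L ^+ 2 * (p2 + r2) + 45 * n * L ^+ 2 * D2 / al + 8 * n ^+ 2 * b4).
Proof.
move=> hx hy hz.
have D20 : 0 <= D2 by rewrite /D2; nonneg.
have tX : Tx <= 2 * n ^+ 2 * du2 + (40 * n * L ^+ 2 * D2 / al
   + 10 * n ^+ 2 * L ^+ 2 * (p2 + r2) + 8 * n ^+ 2 * b4) by move: hx drift; lra.
have W0 : 0 <= 40 * n * L ^+ 2 * D2 / al
   + 10 * n ^+ 2 * L ^+ 2 * (p2 + r2) + 8 * n ^+ 2 * b4 by nonneg.
have Wy : 0 <= 5 / 2 * n ^+ 2 * L ^+ 2 * p2 + 5 / 2 * n * L ^+ 2 * D2 / al by nonneg.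
have Wz : 0 <= 5 / 2 * n ^+ 2 * L ^+ 2 * r2 + 5 / 2 * n * L ^+ 2 * D2 / al by nonneg.
have t1 := ler_wpM2l (sqr_ge0 sx) tX.
have t2 := ler_wpM2l (sqr_ge0 sy) hy.
have t3 := ler_wpM2l (sqr_ge0 sz) hz.
have u1 := ler_wpM2r W0 sxs.
have u2 := ler_wpM2r Wy sys.
have u3 := ler_wpM2r Wz szs.
rewrite /Th; move: t1 t2 t3 u1 u2 u3; clearbody D2; lra.
Qed.

End StepArithmetic.

Lemma perturbed_descent {R : realType} d (h : 'rV[R]_d -> R) (x x' G gam : 'rV[R]_d)
    (C sx st : R) : 0 <= sx ->
  `|h (x + (x' - x)) - h x - dot G (x' - x)| <= C * sq (x' - x) ->
  x' - x = (- sx) *: (st *: G + gam) ->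
  h x' <= h x - sx * st * sq G + enorm G * (sx * Num.sqrt (sq gam))
    + `|C| * sq (x' - x).
Proof.
move=> sx0; rewrite subrKC ler_norml => /andP[_ F1] E.
have F2 : C * sq (x' - x) <= `|C| * sq (x' - x).
  by rewrite ler_wpM2r ?ler_norm// sq_ge0.
have F3 : dot G (x' - x) <= - (sx * st * sq G) + enorm G * (sx * Num.sqrt (sq gam)).
  rewrite E dotZr dotDr dotZr -/(sq G).
  have := dot_le_enorm G gam; rewrite (enormE gam) ler_norml => /andP[q _].
  by have := ler_wpM2l sx0 q; lra.
by move: F1 F2 F3; lra.
Qed.

Section OneStep.
Context {R : realType} {n dx dy : nat}.
Variables (P : problem R n dx dy) (N : network R n).
Hypotheses (hn : (2 <= n)%N) (hdy : (0 < dy)%N).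
Hypotheses (hP : problem_assumptions P) (hN : network_assumptions N).
Variables (delta sx sy sz s CF Cb : R).
Hypotheses (d0 : 0 < delta) (dm : 10 * (delta * `|Lf1 P|) <= mu P).
Hypotheses (sx0 : 0 < sx) (sy0 : 0 < sy) (sz0 : 0 < sz).
Hypotheses (sxs : sx <= s) (sys : sy <= s) (szs : sz <= s).
Hypothesis step_small : s * au N * n%:R * Lg1 P ^+ 2 <= 6 / 25 * mu P.
Hypothesis small_gain : 256 * lyap_T n%:R (Lg1 P) (mu P) (c_inf N) (e_inf N)
  (a_lb N) (al N) (au N) (bl N) (bu N) * n%:R ^+ 2 * s ^+ 2 <= q_inf P N / mu P.
Hypothesis ratio : (Lg1 P / mu P) ^+ 4 * (sx ^+ 2 / sy ^+ 2 + sx ^+ 2 / sz ^+ 2)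
  <= 1 / 1536.
Hypothesis CF_quad : forall x v,
  `|Fstar P (x + v) - Fstar P x - dot (grad (Fstar P) x) v| <= CF * sq v.
Hypothesis Cb0 : 0 <= Cb.
Hypothesis bias : forall x,
  sq (\sum_i (delta *: lsubmx (gradf P i (row_mx x (yreg P delta x)))
     + (lsubmx (gradg P i (row_mx x (yreg P delta x)))
        - lsubmx (gradg P i (row_mx x (yreg P 0 x)))))
     - (n%:R * delta) *: grad (Fstar P) x) <= n%:R ^+ 2 * (Cb * delta ^+ 4).

Let n0 : (0 < n)%N. Proof. exact: ltnW. Qed.
Let n1 : 0 < n%:R :> R. Proof. by rewrite ltr0n. Qed.
Let m0 : 0 < mu P. Proof. exact: mu_gt0. Qed.
Let mL : mu P <= Lg1 P. Proof. exact: mu_le_Lg1. Qed.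
Let L0 : 0 < Lg1 P. Proof. exact: Lg1_gt0. Qed.
Let al0 : 0 < al N. Proof. exact: al_gt0. Qed.
Let au0 : 0 < au N. Proof. exact: au_gt0. Qed.
Let bl0 : 0 < bl N. Proof. exact: bl_gt0. Qed.
Let bu0 : 0 < bu N. Proof. exact: bu_gt0. Qed.
Let c0 : 0 < c_inf N. Proof. exact: c_inf_gt0. Qed.
Let e0 : 0 < e_inf N. Proof. exact: e_inf_gt0. Qed.
Let a0 : 0 < a_lb N. Proof. exact: a_lb_gt0. Qed.
Let s0 : 0 < s. Proof. exact: lt_le_trans sx0 sxs. Qed.

Lemma phik_ge k : q_inf P N / mu P <= n%:R * phik N k.
Proof.
rewrite ler_pdivrMr//; apply: (@q_inf_le _ _ N hn hN _ _ P m0 mL k).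
exact: (mixing_weight_ge (alpha_sum hN k.+1) (alpha_ge hN k.+1)
  (minentry_le (beta N k)) al0).
Qed.

Lemma phik_le k : phik N k <= au N.
Proof.
exact: (mixing_weight_le (beta_sum hN k) (alpha_le hN k.+1) (beta_ge hN k) bl0).
Qed.

Lemma phik_gt0 k : 0 < phik N k.
Proof.
rewrite -(pmulr_rgt0 _ n1); apply: lt_le_trans (phik_ge k).
by rewrite divr_gt0// (q_inf_gt0 hn hN m0 mL).
Qed.

Section At.
Variable k : nat.
Variables (x x' : 'I_n -> 'rV[R]_dx) (y y' z z' : 'I_n -> 'rV[R]_dy).
Variables (tx tx' : 'I_n -> 'rV[R]_dx) (ty ty' tz tz' : 'I_n -> 'rV[R]_dy).
Let gx i := regx P delta i (x i) (y i) (z i).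
Let gx' i := regx P delta i (x' i) (y' i) (z' i).
Let gy i := regy P delta i (x i) (y i).
Let gy' i := regy P delta i (x' i) (y' i).
Let gz i := regy P 0 i (x i) (z i).
Let gz' i := regy P 0 i (x' i) (z' i).
Hypothesis xE : forall i, x' i = \sum_j Amx N k i j *: x j - sx *: tx i.
Hypothesis yE : forall i, y' i = \sum_j Amx N k i j *: y j - sy *: ty i.
Hypothesis zE : forall i, z' i = \sum_j Amx N k i j *: z j - sz *: tz i.
Hypothesis txE : forall i, tx' i = \sum_j Bmx N k i j *: tx j + gx' i - gx i.
Hypothesis tyE : forall i, ty' i = \sum_j Bmx N k i j *: ty j + gy' i - gy i.
Hypothesis tzE : forall i, tz' i = \sum_j Bmx N k i j *: tz j + gz' i - gz i.
Hypothesis sumx : \sum_i tx i = \sum_i gx i.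
Hypothesis sumy : \sum_i ty i = \sum_i gy i.
Hypothesis sumz : \sum_i tz i = \sum_i gz i.

Definition consensus_err k (x : 'I_n -> 'rV[R]_dx) (y z : 'I_n -> 'rV[R]_dy) : R :=
  wvar (wA N k) x + wvar (wA N k) y + wvar (wA N k) z.
Definition tracking_err k (x : 'I_n -> 'rV[R]_dx) (y z : 'I_n -> 'rV[R]_dy) : R :=
  wvar (wB N k) (ratio_of (wB N k) x) + wvar (wB N k) (ratio_of (wB N k) y)
  + wvar (wB N k) (ratio_of (wB N k) z).
Definition gap_err e k (x : 'I_n -> 'rV[R]_dx) (y : 'I_n -> 'rV[R]_dy) : R :=
  sq (wmean (wA N k) y - yreg P e (wmean (wA N k) x)).

Let phi := phik N k.
Let xh := wmean (wA N k) x.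
Let xh' := wmean (wA N k.+1) x'.
Let G := grad (Fstar P) xh.
Let D2 := consensus_err k x y z.
Let S2 := tracking_err k tx ty tz.
Let p2 := gap_err delta k x y.
Let r2 := gap_err 0 k x z.
Let b4 := Cb * delta ^+ 4.

Let wA0 l i : 0 <= wA N l i.
Proof. exact: le_trans (ltW al0) (alpha_ge hN l i). Qed.
Let wB0 l i : 0 <= wB N l i.
Proof. exact: le_trans (ltW bl0) (beta_ge hN l i). Qed.
Let vA d l (u : 'I_n -> 'rV[R]_d) : 0 <= wvar (wA N l) u.
Proof. exact: wvar_ge0. Qed.
Let vB d l (u : 'I_n -> 'rV[R]_d) : 0 <= wvar (wB N l) u.
Proof. exact: wvar_ge0. Qed.

Let Tx := \sum_i tx i.
Let Ty := \sum_i ty i.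
Let Tz := \sum_i tz i.

Let dm0 : 10 * (0 * `|Lf1 P|) <= mu P.
Proof. by rewrite mul0r mulr0 ltW. Qed.

Let sq_chain d (X1 X2 X3 v : 'rV[R]_d) (q1 q2 q3 : R) :
  sq (X1 - X2) <= q1 -> sq (X2 - X3) <= q2 -> sq (X3 - v) <= q3 ->
  sq (X1 - v) <= 4 * q1 + 2 * q2 + 4 * q3.
Proof.
have -> : X1 - v = (X2 - X3) + ((X1 - X2) + (X3 - v)).
  by apply/rowP => j; rewrite !mxE; ring.
have := sqD_le2 (X2 - X3) ((X1 - X2) + (X3 - v)).
have := sqD_le2 (X1 - X2) (X3 - v); lra.
Qed.

Let sq_two d (X1 X2 : 'rV[R]_d) (q1 q2 : R) :
  sq (X1 - X2) <= q1 -> sq X2 <= q2 -> sq X1 <= 2 * q2 + 2 * q1.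
Proof. by have := sqD_le2 X2 (X1 - X2); rewrite subrKC; lra. Qed.

(** The total tracker equals the sum of the local directions. It is compared in turn with the sum at
    the weighted means (consensus), at the exact lower-level solutions (gap), and with n delta grad
    F* (bias). *)
Let driftx : sq (Tx - (n%:R * delta) *: G) <= 20 * n%:R * Lg1 P ^+ 2 * D2 / al N
  + 5 * n%:R ^+ 2 * Lg1 P ^+ 2 * (p2 + r2) + 4 * n%:R ^+ 2 * b4.
Proof.
have A := regx_consensus n0 hdy hP d0 dm al0 (alpha_ge hN k) x y z.
have B := regx_gap n0 hdy hP d0 dm xh (wmean (wA N k) y) (wmean (wA N k) z).
have C := bias xh.
have Z : \sum_i regx P delta i xh (yreg P delta xh) (yreg P 0 xh)
   = \sum_i (delta *: lsubmx (gradf P i (row_mx xh (yreg P delta xh)))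
     + (lsubmx (gradg P i (row_mx xh (yreg P delta xh)))
        - lsubmx (gradg P i (row_mx xh (yreg P 0 xh))))).
  apply: eq_bigr => i _; rewrite /regx /reg scale0r add0r linearD linearZ /=.
  by rewrite addrA.
rewrite -Z -/G in C; rewrite /Tx sumx.
apply: le_trans (sq_chain A B C) _.
rewrite -/(wA N k) -/(consensus_err k x y z) -/D2 -/b4.
rewrite -/(gap_err delta k x y) -/(gap_err 0 k x z) -/p2 -/r2.
clear A B C Z; clearbody D2 p2 r2 b4; lra.
Qed.

Let drifty (e : R) u (tu gu : 'I_n -> 'rV[R]_dy) : 0 <= e -> 10 * (e * `|Lf1 P|) <= mu P ->
  wvar (wA N k) x + wvar (wA N k) u <= D2 ->
  \sum_i tu i = \sum_i gu i -> (forall i, gu i = regy P e i (x i) (u i)) ->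
  sq (\sum_i tu i - \sum_i regy P e i xh (wmean (wA N k) u))
    <= 5 / 4 * n%:R * Lg1 P ^+ 2 * D2 / al N /\
  sq (\sum_i tu i) <= 5 / 2 * n%:R ^+ 2 * Lg1 P ^+ 2 * gap_err e k x u
    + 5 / 2 * n%:R * Lg1 P ^+ 2 * D2 / al N.
Proof.
move=> eps0 em uD -> gE.
have -> : \sum_i gu i = \sum_i regy P e i (x i) (u i) by apply: eq_bigr => i _.
have A : sq (\sum_i regy P e i (x i) (u i) - \sum_i regy P e i xh (wmean (wA N k) u))
    <= 5 / 4 * n%:R * Lg1 P ^+ 2 * D2 / al N.
  exact: (regy_consensus n0 hdy hP al0 (alpha_ge hN k) eps0 em uD).
have B := sq_sum_regy n0 hdy hP eps0 em xh (wmean (wA N k) u).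
split; first exact: A.
apply: le_trans (sq_two A B) _.
rewrite /gap_err -/xh; move: (sq (wmean (wA N k) u - yreg P e xh)) => q.
clear A B; clearbody D2; lra.
Qed.

Let xD : wvar (wA N k) x + wvar (wA N k) y <= D2.
Proof. by rewrite /D2 /consensus_err lerDl. Qed.
Let zD : wvar (wA N k) x + wvar (wA N k) z <= D2.
Proof. by rewrite /D2 /consensus_err addrAC lerDl. Qed.

Lemma one_step : exists g2 Dx2 : R, [/\ 0 <= g2,
  lyap n%:R (Lg1 P) (mu P) (c_inf N) (e_inf N) (a_lb N) (al N) (au N) (bl N)
    sx sy sz (gap_err delta k.+1 x' y') (gap_err 0 k.+1 x' z')
    (consensus_err k.+1 x' y' z') (tracking_err k.+1 tx' ty' tz') <=
  lyap n%:R (Lg1 P) (mu P) (c_inf N) (e_inf N) (a_lb N) (al N) (au N) (bl N)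
    sx sy sz p2 r2 D2 S2
  - dissipation n%:R (Lg1 P) (mu P) (al N) (au N) sx phi D2 S2 p2 r2
  + 15 / 64 * (sx * phi * n%:R * (delta ^+ 2 * sq G)) + 2 * (sx * phi * n%:R * b4),
  11 / 20 * (sx * g2 / (phi * n%:R)) <=
    dissipation n%:R (Lg1 P) (mu P) (al N) (au N) sx phi D2 S2 p2 r2 / 2
    + 5 * (sx * phi * n%:R * b4),
  Dx2 <= 2 * sx ^+ 2 * (phi ^+ 2 * n%:R ^+ 2 * (delta ^+ 2 * sq G) + g2) &
  Fstar P xh' <= Fstar P xh - sx * phi * n%:R * delta * sq G
    + enorm G * (sx * Num.sqrt g2) + `|CF| * Dx2].
Proof.
have [Ex [rx bx]] := network_step hn hN (ltW sx0) xE txE.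
have [Ey [ry by_]] := network_step hn hN (ltW sy0) yE tyE.
have [Ez [rz bz]] := network_step hn hN (ltW sz0) zE tzE.
have [Dy Ny] := drifty (ltW d0) dm xD sumy (fun i => erefl).
have [Dz Nz] := drifty (lexx 0) dm0 zD sumz (fun i => erefl).
have phi0 : 0 < phi by exact: phik_gt0.
have phil : phi <= au N by exact: phik_le.
have ss : sx ^+ 2 <= s ^+ 2 by rewrite ler_pXn2r// nnegrE ltW.
have ssy : sy ^+ 2 <= s ^+ 2 by rewrite ler_pXn2r// nnegrE ltW.
have ssz : sz ^+ 2 <= s ^+ 2 by rewrite ler_pXn2r// nnegrE ltW.
pose Sx := wvar (wB N k) (ratio_of (wB N k) tx).
pose Sy := wvar (wB N k) (ratio_of (wB N k) ty).
pose Sz := wvar (wB N k) (ratio_of (wB N k) tz).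
have Sx0 : 0 <= Sx := vB k _.
have Sy0 : 0 <= Sy := vB k _.
have Sz0 : 0 <= Sz := vB k _.
have S20 : 0 <= S2 by exact: addr_ge0 (addr_ge0 Sx0 Sy0) Sz0.
have D20 : 0 <= D2 by exact: addr_ge0 (addr_ge0 (vA k _) (vA k _)) (vA k _).
have p20 : 0 <= p2 by exact: sq_ge0.
have r20 : 0 <= r2 by exact: sq_ge0.
have b40 : 0 <= b4 by rewrite mulr_ge0// exprn_ge0// ltW.
pose du2 := delta ^+ 2 * sq G.
have du20 : 0 <= du2 by rewrite mulr_ge0 ?sqr_ge0 ?sq_ge0.
(* The whole error of the descent direction: the drift of the total direction, seen through phi, and
   the tracking residue [rx] of the weighted mean. *)
pose gam := phi *: (Tx - (n%:R * delta) *: G) + rx.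
pose g2 := sq gam.
pose Dx2 := sq (xh' - xh).
have moveE : xh' - xh = (- sx) *: ((phi * n%:R * delta) *: G + gam).
  rewrite /xh' (sb_mean bx) -/xh -/Tx -/phi /gam; apply/rowP => j; rewrite !mxE; ring.
have R5 : Dx2 <= 2 * sx ^+ 2 * (phi ^+ 2 * n%:R ^+ 2 * du2 + g2).
  rewrite /Dx2 moveE sqZ sqrrN.
  have -> : 2 * sx ^+ 2 * (phi ^+ 2 * n%:R ^+ 2 * du2 + g2)
    = sx ^+ 2 * (2 * ((phi * n%:R * delta) ^+ 2 * sq G) + 2 * g2) by rewrite /du2; ring.
  rewrite ler_wpM2l ?sqr_ge0// -sqZ; exact: sqD_le2.
have R6 : g2 <= phi ^+ 2 * (40 * n%:R * Lg1 P ^+ 2 * D2 / al N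
    + 10 * n%:R ^+ 2 * Lg1 P ^+ 2 * (p2 + r2) + 8 * n%:R ^+ 2 * b4)
    + 2 * au N * phi * S2.
  apply: (drift_le au0 phi0 Sy0 Sz0 driftx _ (sb_rho bx)).
  by rewrite -sqZ; exact: sqD_le2.
have TxE : sq Tx <= 2 * (n%:R ^+ 2 * du2) + 2 * sq (Tx - (n%:R * delta) *: G).
  have := sqD_le2 ((n%:R * delta) *: G) (Tx - (n%:R * delta) *: G).
  by rewrite subrKC sqZ exprMn -(mulrA (n%:R ^+ 2)).
have R7 := total_direction_le n1 al0 ss ssy ssz (vA k x) (vA k y) (vA k z) p20 r20 b40
  driftx TxE Ny Nz.
have R1b : 2 * c_inf N * D2 <= Ex + Ey + Ez.
  have -> : 2 * c_inf N * D2 = 2 * c_inf N * wvar (wA N k) x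
    + 2 * c_inf N * wvar (wA N k) y + 2 * c_inf N * wvar (wA N k) z.
    by rewrite /D2 /consensus_err; ring.
  by apply: lerD (sb_drop bz); exact: lerD (sb_drop bx) (sb_drop by_).
have R1 := consensus_le c0 au0 bu0 ss ssy ssz Sx0 Sy0 Sz0
  (sb_cons bx) (sb_cons by_) (sb_cons bz).
have V : \sum_i sq (gx' i - gx i) + \sum_i sq (gy' i - gy i) + \sum_i sq (gz' i - gz i)
  <= 5 * Lg1 P ^+ 2 * (\sum_i sq (x' i - x i) + \sum_i sq (y' i - y i)
     + \sum_i sq (z' i - z i)).
  rewrite -!big_split mulr_sumr /=; apply: ler_sum => i _.
  exact: (directions_lip n0 hdy hP d0 dm).
have R2 := tracking_le e0 bl0 bu0 ss ssy ssz Sx0 Sy0 Sz0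
  (sb_track bx) (sb_track by_) (sb_track bz) V (sb_move bx) (sb_move by_) (sb_move bz).
have hstep t : 0 < t -> t <= s -> t * phi * n%:R * Lg1 P ^+ 2 <= 6 / 25 * mu P.
  move=> t0 ts; apply: le_trans step_small.
  do 2! (apply: ler_wpM2r; first by nonneg).
  by apply: ler_pM => //; exact: ltW.
have Syl : Sy <= S2 by rewrite /S2 /tracking_err -/Sx -/Sy -addrA addrCA lerDl addr_ge0.
have Szl : Sz <= S2 by rewrite /S2 /tracking_err -/Sz lerDr addr_ge0.
have aS q : q <= S2 -> au N * phi * q <= au N * phi * S2.
  by move=> h; apply: ler_wpM2l => //; nonneg.
have R3 := gap_step n0 hdy hP (ltW d0) dm xh' sy0 phi0 al0 (hstep sy sy0 sys)
  (sb_mean by_) Dy (le_trans (sb_rho by_) (aS _ Syl)).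
have R4 := gap_step n0 hdy hP (lexx 0) dm0 xh' sz0 phi0 al0 (hstep sz sz0 szs)
  (sb_mean bz) Dz (le_trans (sb_rho bz) (aS _ Szl)).
have fl := phik_ge k; rewrite -/phi in fl.
exists g2, Dx2; split => //.
- exact: sq_ge0.
- exact: (lyap_step n1 L0 m0 mL c0 e0 a0 al0 au0 bl0 bu0 sx0 sy0 sz0 sxs phi0 fl phil
   small_gain ratio D20 S20 p20 r20 du20 (sq_ge0 gam) b40 R1 R1b R2 R3 R4 R5 R6 R7).
- exact: (dissipation_drift n1 m0 mL al0 au0 sx0 phi0 phil D20 S20 p20 r20 du20 b40 R6).
have := perturbed_descent (ltW sx0) (CF_quad xh (xh' - xh)) moveE.
by rewrite !mulrA.
Qed.

End At.
End OneStep.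

(** * Admissible parameters *)

Ltac pos := lazymatch goal with
  | |- is_true (0 < _ + _) => apply: addr_gt0; pos
  | |- is_true (0 < _ * _) => apply: mulr_gt0; pos
  | |- is_true (0 < _^-1) => rewrite invr_gt0; pos
  | |- is_true (0 < _ ^+ _) => apply: exprn_gt0; pos
  | |- is_true (0 < 1) => exact: ltr01
  | |- is_true (0 < _%:R) => first [assumption | exact: ltr0Sn]
  | |- _ => assumption
  end.

Section AdmissibleArithmetic.
Context {R : realType}.
Variables (n L m c e a A U B V q g s : R).
Hypotheses (n2 : 2 <= n) (L0 : 0 < L) (m0 : 0 < m) (mL : m <= L).
Hypotheses (c0 : 0 < c) (c1 : c <= 1) (e0 : 0 < e) (a0 : 0 < a).
Hypotheses (A0 : 0 < A) (Aa : A <= a) (A1 : A <= 1) (B0 : 0 < B) (B1 : B <= 1 / 4).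
Hypotheses (U1 : 1 <= U) (V1 : 1 <= V) (q0 : 0 < q) (qm : q <= m).
Hypotheses (g2n : 2 * n <= g) (s0 : 0 < s).
Let K1 : R := 4 * L ^+ 2 * n ^+ 2 * U ^+ 2 * V / (q * A * B ^+ 2).
Let K2 : R := 13 * L ^+ 2 * n ^+ 2 * U ^+ 2 * V / (q * A * B ^+ 2).
Let K3 : R := 672 * g * L ^+ 2 / (n * e).
Let K4 : R := 2 * K3 * U * V / c + 168 * g * L ^+ 2 / e.

Let n0 : 0 < n. Proof. exact: lt_le_trans n2. Qed.
Let U0 : 0 < U. Proof. exact: lt_le_trans U1. Qed.
Let V0 : 0 < V. Proof. exact: lt_le_trans V1. Qed.
Let g0 : 0 < g. Proof. by apply: lt_le_trans g2n; rewrite mulr_gt0. Qed.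
Let B1' : B <= 1. Proof. by apply: le_trans B1 _; lra. Qed.
Let W := s ^+ 2 * L ^+ 4.
Let W0 : 0 <= W. Proof. by rewrite /W; nonneg. Qed.

Section StepBounds.
Hypothesis h1 : s <= A * B * c * q * K3 / (120 * n * K1 * L ^+ 2).
Hypothesis h2 : s <= q * B * e / (20 * K2).
Hypothesis h3 : s <= A * B / (16 * n ^+ 2 * K4).

Let H1 : s * (480 * n ^+ 4 * e * U ^+ 2 * V * L ^+ 2) <= 672 * g * A ^+ 2 * B ^+ 3 * c * q ^+ 2.
Proof.
have E : A * B * c * q * K3 / (120 * n * K1 * L ^+ 2) =
  672 * g * A ^+ 2 * B ^+ 3 * c * q ^+ 2 / (480 * n ^+ 4 * e * U ^+ 2 * V * L ^+ 2).
  by rewrite /K3 /K1; field; rewrite !gt_eqF.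
have h := h1; rewrite E ler_pdivlMr in h; [exact: h | pos].
Qed.

Let H2 : s * (260 * L ^+ 2 * n ^+ 2 * U ^+ 2 * V) <= q ^+ 2 * A * B ^+ 3 * e.
Proof.
have E : q * B * e / (20 * K2) =
  q ^+ 2 * A * B ^+ 3 * e / (260 * L ^+ 2 * n ^+ 2 * U ^+ 2 * V).
  by rewrite /K2; field; rewrite !gt_eqF.
have h := h2; rewrite E ler_pdivlMr in h; [exact: h | pos].
Qed.

Let H3 : s * ((16 * 1344) * n * g * U * V * L ^+ 2) <= A * B * e * c.
Proof.
have k0 : 0 < 16 * n ^+ 2 * K4 by rewrite /K4 /K3; pos.
have := h3; rewrite ler_pdivlMr; [move=> h | exact: k0].
have E : s * (16 * n ^+ 2 * K4) * (e * c) = s * ((16 * 1344) * n * g * U * V * L ^+ 2)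
  + s * (16 * n ^+ 2 * (168 * g * L ^+ 2) * c).
  by rewrite /K4 /K3; field; rewrite !gt_eqF.
have ec0 : 0 <= e * c by nonneg.
move: h => /(ler_wpM2r ec0); rewrite E (mulrA (A * B)).
have : 0 <= s * (16 * n ^+ 2 * (168 * g * L ^+ 2) * c) by nonneg.
lra.
Qed.

(** The needed bounds concern W = s^2 L^4, so two bounds linear in s are multiplied; g and e cancel
    in this product, while in [P23] the remaining g is replaced by its lower bound 2 n. *)
Let P13 : W * ((480 * 1000) * U ^+ 3 * V ^+ 2) <= A ^+ 3 * B ^+ 4 * c ^+ 2 * q ^+ 2.
Proof.
have n5 : 32 <= n ^+ 5.
  have -> : 32 = 2 ^+ 5 :> R by rewrite -natrX.
  by rewrite ler_pXn2r// nnegrE ltW.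
have p1 : 0 <= s * (480 * n ^+ 4 * e * U ^+ 2 * V * L ^+ 2) by nonneg.
have p3 : 0 <= s * ((16 * 1344) * n * g * U * V * L ^+ 2) by nonneg.
have := ler_pM p1 p3 H1 H3.
have ge0 : 0 < 672 * g * e by pos.
have -> : s * (480 * n ^+ 4 * e * U ^+ 2 * V * L ^+ 2) *
  (s * ((16 * 1344) * n * g * U * V * L ^+ 2)) =
  (W * ((480 * 32) * n ^+ 5 * U ^+ 3 * V ^+ 2)) * (672 * g * e) by rewrite /W; ring.
have -> : 672 * g * A ^+ 2 * B ^+ 3 * c * q ^+ 2 * (A * B * e * c)
  = (A ^+ 3 * B ^+ 4 * c ^+ 2 * q ^+ 2) * (672 * g * e) by ring.
rewrite ler_pM2r// => H; apply: le_trans H.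
apply: ler_wpM2l; first exact: W0.
do 2! (apply: ler_wpM2r; first by nonneg).
by move: (n ^+ 5) n5 => r; lra.
Qed.

Let P23 : W * ((30 * 1000 * 1000) * U ^+ 3 * V ^+ 2) <= q ^+ 2 * A ^+ 2 * B ^+ 4 * e ^+ 2 * c.
Proof.
have n4 : 16 <= n ^+ 4.
  have -> : 16 = 2 ^+ 4 :> R by rewrite -natrX.
  by rewrite ler_pXn2r// nnegrE ltW.
have p1 : 0 <= s * (260 * L ^+ 2 * n ^+ 2 * U ^+ 2 * V) by nonneg.
have p3 : 0 <= s * ((16 * 1344) * n * g * U * V * L ^+ 2) by nonneg.
have := ler_pM p1 p3 H2 H3.
have -> : q ^+ 2 * A * B ^+ 3 * e * (A * B * e * c)
  = q ^+ 2 * A ^+ 2 * B ^+ 4 * e ^+ 2 * c by ring.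
apply: le_trans.
have -> : s * (260 * L ^+ 2 * n ^+ 2 * U ^+ 2 * V) * (s * ((16 * 1344) * n * g * U * V * L ^+ 2))
  = W * (260 * (16 * 1344) * n ^+ 3 * U ^+ 3 * V ^+ 2) * g by rewrite /W; ring.
have k0 : 0 <= W * (260 * (16 * 1344) * n ^+ 3 * U ^+ 3 * V ^+ 2) by nonneg.
apply: le_trans (ler_wpM2l k0 g2n).
have -> : W * (260 * (16 * 1344) * n ^+ 3 * U ^+ 3 * V ^+ 2) * (2 * n)
  = W * (2 * 260 * (16 * 1344) * n ^+ 4 * U ^+ 3 * V ^+ 2) by ring.
apply: ler_wpM2l; first exact: W0.
do 2! (apply: ler_wpM2r; first by nonneg).
by move: (n ^+ 4) n4 => r; lra.
Qed.

Let pow_le1 (r : R) k : 0 < r -> r <= 1 -> r ^+ k <= 1.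
Proof. by move=> r0 r1; rewrite exprn_ile1// ltW. Qed.

Let pow_ge1 (r : R) k : 1 <= r -> 1 <= r ^+ k.
Proof. by move=> r1; rewrite exprn_ege1. Qed.

(** Compared after squaring, since [P13] controls s^2; it gives 1/25 m^2, below (6/25)^2 m^2. *)
Lemma admissible_step_small : s * (U / n) * n * L ^+ 2 <= 6 / 25 * m.
Proof.
have -> : s * (U / n) * n * L ^+ 2 = s * U * L ^+ 2 by field; rewrite gt_eqF.
rewrite -(@ler_pXn2r _ 2)// ?nnegrE; [|by nonneg|by nonneg].
have -> : (s * U * L ^+ 2) ^+ 2 = W * U ^+ 2 by rewrite /W; ring.
have k1 : 25 * (W * U ^+ 2) <= W * ((480 * 1000) * U ^+ 3 * V ^+ 2).
  have -> : 25 * (W * U ^+ 2) = (W * U ^+ 2) * 25 by ring.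
  have -> : W * ((480 * 1000) * U ^+ 3 * V ^+ 2) = (W * U ^+ 2) * ((480 * 1000) * (U * V ^+ 2)) by ring.
  apply: ler_wpM2l; first by nonneg.
  have : 1 <= U * V ^+ 2 by rewrite -[1]mulr1 ler_pM// pow_ge1.
  lra.
have k2 : A ^+ 3 * B ^+ 4 * c ^+ 2 * q ^+ 2 <= m ^+ 2.
  apply: le_trans (_ : 1 * q ^+ 2 <= _); last first.
    by rewrite mul1r ler_pXn2r// nnegrE ltW.
  rewrite ler_wpM2r ?sqr_ge0// -[leRHS]mulr1 ler_pM ?pow_le1//; try by nonneg.
  by rewrite -[leRHS]mulr1 ler_pM ?pow_le1//; nonneg.
have := sqr_ge0 m; have := le_trans k1 (le_trans P13 k2).
rewrite exprMn; have -> : (6 / 25) ^+ 2 = 36 / 625 :> R by field.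
move: (W * U ^+ 2) (m ^+ 2) => r1 r2; lra.
Qed.

(** [lyap_T] has three terms; each is allotted a third of q^2, the first through [P13], the others
    through [P23], and q^2 <= q m. *)
Lemma admissible_small_gain :
  256 * lyap_T n L m c e a (A / n) (U / n) (B / n) (V / n) * n ^+ 2 * s ^+ 2 <= q / m.
Proof.
have T1 : 3 * (512 * 600) * (W * (U ^+ 2 * V)) <= q ^+ 2 * (A * c ^+ 2).
  have k : 3 * (512 * 600) * (W * (U ^+ 2 * V)) <= 2 * (W * ((480 * 1000) * U ^+ 3 * V ^+ 2)).
    have -> : 2 * (W * ((480 * 1000) * U ^+ 3 * V ^+ 2)) =
      (W * (U ^+ 2 * V)) * (2 * (480 * 1000) * (U * V)) by ring.
    rewrite mulrC; apply: ler_wpM2l; first by nonneg.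
    have : 1 <= U * V by rewrite -[1]mulr1 ler_pM.
    lra.
  apply: le_trans k _; apply: le_trans (ler_wpM2l _ P13) _; first by nonneg.
  have -> : 2 * (A ^+ 3 * B ^+ 4 * c ^+ 2 * q ^+ 2) =
    (q ^+ 2 * (A * c ^+ 2)) * (A ^+ 2 * (2 * B) * B ^+ 3) by ring.
  rewrite ler_piMr//; first by nonneg.
  have B2 : 2 * B <= 1 by move: B1; lra.
  rewrite -[leRHS]mulr1 ler_pM ?pow_le1//; try by nonneg.
  by rewrite -[leRHS]mulr1 ler_pM ?pow_le1//; nonneg.
have T2 : 3 * ((8 * 1024) * 1000) * (W * (U ^+ 2 * V)) <= q ^+ 2 * (c * e ^+ 2 * a * A * B).
  have k : 3 * ((8 * 1024) * 1000) * (W * (U ^+ 2 * V)) <= W * ((30 * 1000 * 1000) * U ^+ 3 * V ^+ 2).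
    have -> : W * ((30 * 1000 * 1000) * U ^+ 3 * V ^+ 2) =
      (W * (U ^+ 2 * V)) * ((30 * 1000 * 1000) * (U * V)) by ring.
    rewrite mulrC; apply: ler_wpM2l; first by nonneg.
    have : 1 <= U * V by rewrite -[1]mulr1 ler_pM.
    lra.
  apply: le_trans k _; apply: le_trans P23 _.
  have -> : q ^+ 2 * A ^+ 2 * B ^+ 4 * e ^+ 2 * c
    = (q ^+ 2 * (c * e ^+ 2 * A * B)) * (A * B ^+ 3) by ring.
  have -> : q ^+ 2 * (c * e ^+ 2 * a * A * B)
    = (q ^+ 2 * (c * e ^+ 2 * A * B)) * a by ring.
  apply: ler_wpM2l; first by nonneg.
  by apply: le_trans Aa; rewrite ler_piMr ?pow_le1// ltW.
have T3 : 3 * (2 * 1024 * 1000) * (W * (U * V)) <= q ^+ 2 * (e ^+ 2 * B).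
  have k : 3 * (2 * 1024 * 1000) * (W * (U * V)) <= W * ((30 * 1000 * 1000) * U ^+ 3 * V ^+ 2).
    have -> : W * ((30 * 1000 * 1000) * U ^+ 3 * V ^+ 2) =
      (W * (U * V)) * ((30 * 1000 * 1000) * (U ^+ 2 * V)) by ring.
    rewrite mulrC; apply: ler_wpM2l; first by nonneg.
    have : 1 <= U ^+ 2 * V by rewrite -[1]mulr1 ler_pM// pow_ge1.
    lra.
  apply: le_trans k _; apply: le_trans P23 _.
  have -> : q ^+ 2 * A ^+ 2 * B ^+ 4 * e ^+ 2 * c
    = (q ^+ 2 * (e ^+ 2 * B)) * (A ^+ 2 * B ^+ 3 * c) by ring.
  rewrite ler_piMr//; first by nonneg.
  rewrite -[leRHS]mulr1 ler_pM ?pow_le1//; try by nonneg.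
  by rewrite -[leRHS]mulr1 ler_pM ?pow_le1//; nonneg.
have -> : 256 * lyap_T n L m c e a (A / n) (U / n) (B / n) (V / n) * n ^+ 2 * s ^+ 2
  = (512 * 600 * (W * (U ^+ 2 * V)) / (A * c ^+ 2)
     + 8 * 1024 * 1000 * (W * (U ^+ 2 * V)) / (c * e ^+ 2 * a * A * B)
     + 2 * 1024 * 1000 * (W * (U * V)) / (e ^+ 2 * B)) / m ^+ 2.
  by rewrite /lyap_T /lyap_D /lyap_S /W; field; rewrite !gt_eqF.
have -> : q / m = (q * m) / m ^+ 2 by field; rewrite gt_eqF.
rewrite ler_wpM2r ?invr_ge0 ?sqr_ge0//.
have qq : q ^+ 2 <= q * m by rewrite expr2 ler_wpM2l// ltW.
have D1 : 3 * (512 * 600) * (W * (U ^+ 2 * V)) / (A * c ^+ 2) <= q ^+ 2.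
  by rewrite ler_pdivrMr; [assumption | pos].
have D2 : 3 * ((8 * 1024) * 1000) * (W * (U ^+ 2 * V)) / (c * e ^+ 2 * a * A * B) <= q ^+ 2.
  by rewrite ler_pdivrMr; [assumption | pos].
have D3 : 3 * (2 * 1024 * 1000) * (W * (U * V)) / (e ^+ 2 * B) <= q ^+ 2.
  by rewrite ler_pdivrMr; [assumption | pos].
move: D1 D2 D3 qq.
move: (A * c ^+ 2)^-1 (c * e ^+ 2 * a * A * B)^-1 (e ^+ 2 * B)^-1 => i1 i2 i3.
lra.
Qed.

End StepBounds.

(** From B <= 1/4 and n >= 2 each weighted squared ratio is at most 1 / (64 C), with C = 13 * 432
    for y and C = 48 for z; the z-part is then 1/3072, half of the allowance. *)
Lemma admissible_ratio (tx ty tz : R) : 0 < tx -> 0 < ty -> 0 < tz ->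
  tx / ty <= m / L * Num.sqrt (q / (432 * A * K2)) ->
  tx / tz <= m / L * Num.sqrt (q / (12 * A * K1)) ->
  (L / m) ^+ 4 * (tx ^+ 2 / ty ^+ 2 + tx ^+ 2 / tz ^+ 2) <= 1 / 1536.
Proof.
move=> tx0 ty0 tz0 hy hz.
have key (t k : R) : 0 < t -> 0 < k -> tx / t <= m / L * Num.sqrt k ->
    (L / m) ^+ 4 * (tx ^+ 2 / t ^+ 2) <= (L / m) ^+ 2 * k.
  move=> t0 k0 h.
  have : (tx / t) ^+ 2 <= (m / L * Num.sqrt k) ^+ 2.
    rewrite ler_pXn2r// nnegrE; first by nonneg.
    by rewrite mulr_ge0 ?sqrtr_ge0//; nonneg.
  move=> H; rewrite !exprMn sqr_sqrtr ?(ltW k0)// exprVn in H.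
  have L4 : 0 <= (L / m) ^+ 4 by nonneg.
  apply: le_trans (ler_wpM2l L4 H) _; rewrite le_eqVlt; apply/orP; left; apply/eqP.
  by field; rewrite !gt_eqF.
have K10 : 0 < K1 by rewrite /K1; pos.
have K20 : 0 < K2 by rewrite /K2; pos.
have k1 : 0 < q / (432 * A * K2) by pos.
have k2 : 0 < q / (12 * A * K1) by pos.
have bnd (C : R) : 0 < C ->
   (L / m) ^+ 2 * (q ^+ 2 * B ^+ 2 / (C * L ^+ 2 * n ^+ 2 * U ^+ 2 * V)) <= 1 / (64 * C).
  move=> C0; rewrite expr_div_n.
  have -> : L ^+ 2 / m ^+ 2 * (q ^+ 2 * B ^+ 2 / (C * L ^+ 2 * n ^+ 2 * U ^+ 2 * V))
    = (q ^+ 2 * B ^+ 2) / (m ^+ 2 * C * n ^+ 2 * U ^+ 2 * V) by field; rewrite !gt_eqF.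
  rewrite ler_pdivrMr; last by pos.
  have -> : 1 / (64 * C) * (m ^+ 2 * C * n ^+ 2 * U ^+ 2 * V)
    = m ^+ 2 * (n ^+ 2 * (U ^+ 2 * V) / 64) by field; rewrite gt_eqF.
  apply: ler_pM; rewrite ?sqr_ge0//; first by rewrite ler_pXn2r// nnegrE ltW.
  have b2 : B ^+ 2 <= 1 / 16.
    have -> : 1 / 16 = (1 / 4) ^+ 2 :> R by field.
    by rewrite ler_pXn2r// nnegrE; [exact: ltW | nonneg].
  have n4 : 4 <= n ^+ 2.
    have -> : 4 = 2 ^+ 2 :> R by rewrite -natrX.
    by rewrite ler_pXn2r// nnegrE ltW.
  have uv : 1 <= U ^+ 2 * V by rewrite -[1]mulr1 ler_pM// exprn_ege1.
  have : 4 * 1 <= n ^+ 2 * (U ^+ 2 * V) by apply: ler_pM.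
  move: b2; lra.
have E1 : q / (432 * A * K2) = q ^+ 2 * B ^+ 2 / ((13 * 432) * L ^+ 2 * n ^+ 2 * U ^+ 2 * V).
  by rewrite /K2; field; rewrite !gt_eqF.
have E2 : q / (12 * A * K1) = q ^+ 2 * B ^+ 2 / (48 * L ^+ 2 * n ^+ 2 * U ^+ 2 * V).
  by rewrite /K1; field; rewrite !gt_eqF.
have r1 := key _ _ ty0 k1 hy; have r2 := key _ _ tz0 k2 hz.
rewrite E1 in r1; rewrite E2 in r2.
have s1 := le_trans r1 (bnd (13 * 432) ltac:(pos)).
have s2 := le_trans r2 (bnd 48 ltac:(pos)).
rewrite mulrDr; apply: le_trans (lerD s1 s2) _.
lra.
Qed.

End AdmissibleArithmetic.


(** * Comparison of the Lyapunov function with its dissipation *)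

Section DescentConditions.
Context {R : realType}.

Lemma common_factor (A B C A' B' C' : R) : 0 <= A -> 0 <= B -> 0 <= C ->
  0 < A' -> 0 < B' -> 0 < C' -> exists2 t, 0 < t & t <= 1 /\
    [/\ t * A <= A', t * B <= B' & t * C <= C'].
Proof.
move=> A0 B0 C0 A'0 B'0 C'0.
have rA : 0 <= A / A' by nonneg.
have rB : 0 <= B / B' by nonneg.
have rC : 0 <= C / C' by nonneg.
pose S := 1 + A / A' + B / B' + C / C'.
have S1 : 1 <= S by rewrite /S; lra.
have S0 : 0 < S by apply: lt_le_trans S1.
have key (r r' : R) : 0 < r' -> r / r' <= S -> S^-1 * r <= r'.
  move=> r'0 h; rewrite mulrC ler_pdivrMr//.
  by rewrite -ler_pdivrMl// mulrC.
exists S^-1; first by rewrite invr_gt0.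
split; first by rewrite invf_le1.
by split; apply: key => //; rewrite /S; lra.
Qed.

Lemma small_threshold (delta X r : R) : 0 < delta -> 0 <= r -> r <= X ->
  delta <= (1 + X)^-1 -> delta * r <= 1.
Proof.
move=> d0 r0 rX h.
have X1 : 0 < 1 + X by lra.
have : delta * (1 + X) <= 1 by rewrite -ler_pdivlMr// div1r.
have := ler_wpM2l (ltW d0) rX; have := d0; rewrite mulrDr; lra.
Qed.

Lemma half_div_le1 (r : R) k : r <= 1 / 2 -> r / k.+1%:R <= 1.
Proof.
move=> r2; rewrite ler_pdivrMr// mul1r; apply: le_trans r2 _.
by apply: le_trans (_ : 1 <= _); [lra | rewrite ler1n].
Qed.

Variables (N L mu c e a al au bl sx sy sz : R).
Hypotheses (N0 : 0 < N) (L0 : 0 < L) (mu0 : 0 < mu) (muL : mu <= L).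
Hypotheses (c0 : 0 < c) (c1 : c <= 1 / 2) (e0 : 0 < e) (e1 : e <= 1 / 2).
Hypotheses (a0 : 0 < a) (al0 : 0 < al) (au0 : 0 < au) (bl0 : 0 < bl).
Hypotheses (sx0 : 0 < sx) (sy0 : 0 < sy) (sz0 : 0 < sz).
Variables (p2 r2 D2 S2 : R).
Hypotheses (p20 : 0 <= p2) (r20 : 0 <= r2) (D20 : 0 <= D2) (S20 : 0 <= S2).
Let oS := lyap_S N L mu e au.
Let oD := lyap_D N L mu c e a al au bl.
Let M := lyap N L mu c e a al au bl sx sy sz p2 r2 D2 S2.
Let D phi := dissipation N L mu al au sx phi D2 S2 p2 r2.

Lemma lyap_S_gt0 : 0 < oS.
Proof. by rewrite /oS /lyap_S; pos. Qed.

Lemma lyap_D_ge : 600 * (L / mu) ^+ 2 * au * L ^+ 2 / (al * c) <= oD.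
Proof.
rewrite /oD /lyap_D lerDl; have := lyap_S_gt0; rewrite /oS.
by move: (lyap_S N L mu e au) => r r0; nonneg.
Qed.

Lemma lyap_D_gt0 : 0 < oD.
Proof.
by apply: lt_le_trans lyap_D_ge; pos.
Qed.

Let oS0 : 0 <= oS. Proof. exact/ltW/lyap_S_gt0. Qed.
Let oD0 : 0 <= oD. Proof. exact/ltW/lyap_D_gt0. Qed.

Lemma lyap_ge0 : 0 <= M.
Proof. by rewrite /M /lyap -/oS -/oD; nonneg. Qed.

Lemma lyap_ge_consensus : sx * oD * D2 <= M.
Proof.
rewrite /M /lyap -/oS -/oD -addrA addrCA lerDl.
by nonneg.
Qed.

(** Needed to bound the drift by M itself: [dissipation_drift] controls it by the dissipation. The
    smallness of the rates and of the gap steps makes each term comparable. *)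
Lemma dissipation_le_lyap phi : 0 < phi ->
  phi * N * mu * sy <= 1 -> phi * N * mu * sz <= 1 -> D phi <= M.
Proof.
move=> phi0 hy hz; rewrite /D /M /dissipation /lyap -/oS -/oD.
have gap (t q : R) : 0 < t -> 0 <= q -> phi * N * mu * t <= 1 ->
    14 * (phi * N * q) <= 16 / mu * (q / t).
  move=> t0 q0 h.
  have : phi * N * mu * t * (q / (t * mu)) <= q / (t * mu).
    by rewrite ler_piMl//; nonneg.
  have -> : phi * N * mu * t * (q / (t * mu)) = phi * N * q.
    by field; rewrite !gt_eqF.
  have -> : 16 / mu * (q / t) = 16 * (q / (t * mu)) by field; rewrite !gt_eqF.
  have : 0 <= q / (t * mu) by nonneg.
  lra.
have w : 0 <= sx * L ^+ 2 by nonneg.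
have g1 := ler_wpM2l w (lerD (gap _ _ sy0 p20 hy) (gap _ _ sz0 r20 hz)).
have g2 : 100 * (sx * (L / mu) ^+ 2 * au * L ^+ 2 / al * D2) <= sx * oD * D2.
  rewrite mulrA; apply: ler_wpM2r => //.
  apply: le_trans (ler_wpM2l (ltW sx0) lyap_D_ge).
  have -> : 100 * (sx * (L / mu) ^+ 2 * au * L ^+ 2 / al)
     = sx * (600 * (L / mu) ^+ 2 * au * L ^+ 2 / (al * c)) * (c / 6).
    by field; rewrite !gt_eqF.
  by apply: ler_piMr; [nonneg | exact: half_div_le1].
have g3 : 10 * (sx * (L / mu) ^+ 2 * au / N * S2) <= sx * oS * S2.
  rewrite mulrA; apply: ler_wpM2r => //.
  have -> : 10 * (sx * (L / mu) ^+ 2 * au / N) = sx * oS * (e / 40).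
    by rewrite /oS /lyap_S; field; rewrite !gt_eqF.
  by apply: ler_piMr; [nonneg | exact: half_div_le1].
have E : 14 * (sx * phi * N * L ^+ 2 * (p2 + r2)) =
  sx * L ^+ 2 * (14 * (phi * N * p2) + 14 * (phi * N * r2)) by ring.
have E' : 16 * sx * L ^+ 2 / mu * (p2 / sy + r2 / sz) =
  sx * L ^+ 2 * (16 / mu * (p2 / sy) + 16 / mu * (r2 / sz)) by ring.
rewrite E E'; lra.
Qed.

Lemma dissipation_ge_lyap (theta phi f sl : R) : 0 < sl -> sl <= sy -> sl <= sz ->
  0 <= f -> f <= phi * N -> 
  theta * (16 / mu) <= 14 * f * sl ->
  theta * oD <= 100 * ((L / mu) ^+ 2 * au * L ^+ 2 / al) ->
  theta * oS <= 10 * ((L / mu) ^+ 2 * au / N) -> theta * M <= D phi.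
Proof.
move=> sl0 hy hz f0 hf t1 t2 t3; rewrite /D /M /dissipation /lyap -/oS -/oD.
have g2 := ler_wpM2r D20 (ler_wpM2l (ltW sx0) t2).
have g3 := ler_wpM2r S20 (ler_wpM2l (ltW sx0) t3).
have gap (t q : R) : sl <= t -> 0 <= q -> theta * (16 / mu) * (q / t) <= 14 * (phi * N * q).
  move=> lt q0; have t0 : 0 < t by exact: lt_le_trans lt.
  have qt : 0 <= q / t by nonneg.
  apply: le_trans (ler_wpM2r qt t1) _.
  have -> : 14 * f * sl * (q / t) = 14 * f * (sl * (q / t)) by ring.
  have k : sl * (q / t) <= q by rewrite mulrCA ler_piMr// ler_pdivrMr// mul1r.
  have f14 : 0 <= 14 * f by nonneg.
  apply: le_trans (ler_wpM2l f14 k) _.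
  have -> : 14 * f * q = 14 * (f * q) by ring.
  apply: ler_wpM2l; first by nonneg.
  exact: ler_wpM2r.
have w : 0 <= sx * L ^+ 2 by nonneg.
have g1 := ler_wpM2l w (lerD (gap _ _ hy p20) (gap _ _ hz r20)).
have E : 14 * (sx * phi * N * L ^+ 2 * (p2 + r2)) =
  sx * L ^+ 2 * (14 * (phi * N * p2) + 14 * (phi * N * r2)) by ring.
have -> : theta * (16 * sx * L ^+ 2 / mu * (p2 / sy + r2 / sz) + sx * oD * D2 + sx * oS * S2)
  = sx * L ^+ 2 * (theta * (16 / mu) * (p2 / sy) + theta * (16 / mu) * (r2 / sz))
    + sx * (theta * oD) * D2 + sx * (theta * oS) * S2 by ring.
rewrite E; lra.
Qed.

Lemma lyap_le (sl sh p3 r3 D3 S3 : R) : 0 < sl -> sl <= sy -> sl <= sz -> sx <= sh ->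
  p2 <= p3 -> r2 <= r3 -> D2 <= D3 -> S2 <= S3 ->
  M <= sh * (16 * L ^+ 2 / mu * ((p3 + r3) / sl) + oD * D3 + oS * S3).
Proof.
move=> sl0 hy hz hx hp hr hD hS.
have gap (t q q' : R) : sl <= t -> 0 <= q -> q <= q' -> q / t <= q' / sl.
  move=> lt q0 qq; have t0 : 0 < t by exact: lt_le_trans lt.
  by apply: ler_pM => //; [nonneg | rewrite lef_pV2].
have w : 0 <= 16 * L ^+ 2 / mu by nonneg.
have g1 := ler_wpM2l w (lerD (gap _ _ _ hy p20 hp) (gap _ _ _ hz r20 hr)).
have g2 := ler_wpM2l oD0 hD; have g3 := ler_wpM2l oS0 hS.
have E : M = sx * (16 * L ^+ 2 / mu * (p2 / sy + r2 / sz) + oD * D2 + oS * S2).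
  by rewrite /M /lyap -/oS -/oD; ring.
rewrite E; apply: ler_pM => //; [by nonneg | by nonneg |].
rewrite (mulrDl p3); lra.
Qed.

End DescentConditions.

(** The coefficient a gives up one sixteenth of sx phi N to absorb the curvature term CF Dx2, and a
    / 4 is then exactly the 15/64 of [lyap_step]. *)
Lemma descent_conditions {R : realType} (N sx phi delta U g2 Dx2 CF Cb M M' D F F' C H : R) :
  0 < N -> 0 < sx -> 0 < phi -> 0 < delta -> 0 <= U -> 0 <= g2 -> 0 <= CF -> 0 <= Cb ->
  sx * phi * N <= H -> 32 * CF * (delta * H) <= 1 -> 60 * C * (delta * H) <= 1 ->
  2 * CF <= C -> 5 * H * Cb <= C -> H <= C -> 10 * H ^+ 2 * Cb <= C ->
  0 <= M -> D <= M ->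
  M' <= M - D + 15 / 64 * (sx * phi * N * (delta ^+ 2 * U))
    + 2 * (sx * phi * N * (Cb * delta ^+ 4)) ->
  11 / 20 * (sx * g2 / (phi * N)) <= D / 2 + 5 * (sx * phi * N * (Cb * delta ^+ 4)) ->
  Dx2 <= 2 * sx ^+ 2 * (phi ^+ 2 * N ^+ 2 * (delta ^+ 2 * U) + g2) ->
  F' <= F - sx * phi * N * delta * U + Num.sqrt U * (sx * Num.sqrt g2) + CF * Dx2 ->
  let a := 15 / 16 * (sx * phi * N) in let G := sx * Num.sqrt g2 in
  [/\ M' <= M - D + a / 4 * delta ^+ 2 * U + C * delta ^+ 4,
      F' <= F - a * delta * U + Num.sqrt U * G + C * G ^+ 2,
      G ^+ 2 * ((2 * a)^-1 + delta * C) <= D / 2 + C * delta ^+ 4 &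
      G ^+ 2 <= C * (M + delta ^+ 4)].
Proof.
move=> N0 sx0 phi0 d0 U0 g20 CF0 Cb0 hH h32 h60 hC1 hC2 hC3 hC4 M0 DM hM hG hD hF a G.
have q0 : 0 < sx * phi * N by pos.
have H0 : 0 <= H by apply: le_trans hH; exact: ltW.
have C0 : 0 <= C by apply: le_trans hC3.
have d4 : 0 <= delta ^+ 4 by rewrite exprn_ge0// ltW.
have HC : 0 <= H * Cb by nonneg.
have Cb5 : 5 * (sx * phi * N * (Cb * delta ^+ 4)) <= C * delta ^+ 4.
  have : sx * phi * N * (Cb * delta ^+ 4) <= H * (Cb * delta ^+ 4).
    by apply: ler_wpM2r hH; nonneg.
  have := ler_wpM2r d4 hC2; lra.
have z0 : 0 <= sx * phi * N * (Cb * delta ^+ 4) by nonneg.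
have GE : G ^+ 2 = sx ^+ 2 * g2 by rewrite /G exprMn sqr_sqrtr.
split.
- have E : a / 4 * delta ^+ 2 * U = 15 / 64 * (sx * phi * N * (delta ^+ 2 * U)).
    by rewrite /a; field.
  rewrite E; lra.
- have E1 := ler_wpM2l CF0 hD.
  have dq : 32 * CF * (delta * (sx * phi * N)) <= 1.
    apply: le_trans h32; apply: ler_wpM2l; first by nonneg.
    by apply: ler_wpM2l; [nonneg | exact: hH].
  have W : 0 <= sx * phi * N * delta * U by nonneg.
  have := ler_wpM2r W dq.
  have : 2 * CF * G ^+ 2 <= C * G ^+ 2 by rewrite ler_wpM2r ?sqr_ge0.
  rewrite GE /a -/G; move: E1 hF.
  have -> : CF * (2 * sx ^+ 2 * (phi ^+ 2 * N ^+ 2 * (delta ^+ 2 * U) + g2))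
    = (32 * CF * (delta * (sx * phi * N))) * (sx * phi * N * delta * U) / 16
      + 2 * CF * (sx ^+ 2 * g2) by field.
  rewrite -/G; move: (Num.sqrt U * G) => r1; lra.
- have dC : delta * C * (sx * phi * N) <= 1 / 60.
    have : delta * C * (sx * phi * N) <= delta * C * H by rewrite ler_wpM2l//; nonneg.
    lra.
  have W : 0 <= sx * g2 / (phi * N) by nonneg.
  have := ler_wpM2r W dC; move: hG.
  have -> : G ^+ 2 * ((2 * a)^-1 + delta * C) =
    8 / 15 * (sx * g2 / (phi * N)) + delta * C * (sx * phi * N) * (sx * g2 / (phi * N)).
    by rewrite GE /a; field; rewrite !gt_eqF.
  move: (delta * C * _ * _) => r; lra.
- have qW := ler_wpM2l (ltW q0) hG.
  have E : G ^+ 2 = sx * phi * N * (sx * g2 / (phi * N)).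
    by rewrite GE; field; rewrite !gt_eqF.
  have k1 : sx * phi * N * D <= C * M.
    apply: le_trans (ler_wpM2l (ltW q0) DM) _; apply: ler_wpM2r => //.
    exact: le_trans hH hC3.
  have k2 : (sx * phi * N) * (sx * phi * N) * (Cb * delta ^+ 4) <= H ^+ 2 * (Cb * delta ^+ 4).
    rewrite expr2; apply: ler_wpM2r; first by nonneg.
    by apply: ler_pM => //; exact: ltW.
  have k3 := ler_wpM2r d4 hC4.
  have CM : 0 <= C * M by nonneg.
  rewrite E; move: qW k1 k2 k3 CM.
  move: (sx * phi * N) (sx * g2 / (phi * N)) => r1 r2.
  lra.
Qed.

(** * Summation along the trajectory *)

Section TrackingRecursion.
Context {R : realType} {n d : nat}.
Variables (N : network R n) (K : nat).
Implicit Types xi t dir : nat -> 'I_n -> 'rV[R]_d.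

Lemma tracking_rescale (r eta : R) xi t dir dir' : r != 0 ->
  (forall k i, r *: dir k i = dir' k i) ->
  tracking N K (fun=> eta) xi t dir ->
  tracking N K (fun=> eta / r) xi (fun k i => r *: t k i) dir'.
Proof.
move=> r0 E [t0 tS]; split=> [i|k i kK]; first by rewrite t0 E.
have [-> ->] := tS k i kK; split; first by rewrite scalerA divfK.
rewrite scalerBr scalerDr !E scaler_sumr; congr (_ + _ - _).
by apply: eq_bigr => j _; rewrite !scalerA mulrC.
Qed.

Lemma tracking_conserved eta xi t dir : network_assumptions N ->
  tracking N K eta xi t dir ->
  forall k, (k <= K)%N -> \sum_i t k i = \sum_i dir k i.
Proof.
move=> hN [t0 tS]; elim=> [|k IH] kK; first by apply: eq_bigr => i _; rewrite t0.
have E := tracking_sum (B_column_stochastic hN k) (fun i => (tS k i kK).2).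
by rewrite E (IH (ltnW kK)) addrAC subrr add0r.
Qed.

End TrackingRecursion.

Section InitialErrors.
Context {R : realType} {n : nat}.

(** The descent runs along weighted means, whereas the final estimate is at plain averages; their
    difference is itself an average of consensus deviations. *)
Lemma average_near d (w : 'I_n -> R) (x : 'I_n -> 'rV[R]_d) (l : R) :
  (0 < n)%N -> 0 < l -> (forall i, l <= w i) -> \sum_i w i = 1 ->
  sq (average x - wmean w x) <= wvar w x / (n%:R * l).
Proof.
move=> n0 l0 lw w1; have nR : 0 < n%:R :> R by rewrite ltr0n.
have p1 : \sum_(i < n) n%:R^-1 = 1 :> R.
  by rewrite sumr_const card_ord -[LHS]mulr_natr mulVf// gt_eqF.
have p0 (i : 'I_n) : 0 <= n%:R^-1 :> R by rewrite invr_ge0 ltW.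
have E : average x - wmean w x = wmean (fun=> n%:R^-1) (fun i => x i - wmean w x).
  rewrite /average /wmean -scaler_sumr sumrB scalerBr; congr (_ - _).
  by rewrite sumr_const card_ord -[X in _ *: X]scaler_nat scalerA mulVf ?scale1r// gt_eqF.
have := sq_wmean_le (fun i => x i - wmean w x) p0 p1; rewrite -E => h.
apply: le_trans h _; rewrite ler_pdivlMr ?mulr_gt0//.
rewrite -mulr_sumr mulrC mulrA; rewrite (mulrAC n%:R) mulfV ?gt_eqF// mul1r mulr_sumr.
by apply: ler_sum => i _; apply: ler_wpM2r (lw i); exact: sq_ge0.
Qed.

Lemma wvar_affine_bounded d (w : 'I_n -> R) (A B : 'I_n -> 'rV[R]_d) :
  (forall i, 0 <= w i) -> \sum_i w i = 1 ->
  exists2 C, 0 <= C & forall (delta : R) t, 0 <= delta -> delta <= 1 ->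
    (forall i, t i = delta *: A i + B i) -> wvar w (ratio_of w t) <= C.
Proof.
move=> w0 w1.
exists (\sum_i w i * (2 * sq ((w i)^-1 *: A i) + 2 * sq ((w i)^-1 *: B i))).
  apply: sumr_ge0 => i _; apply: mulr_ge0 => //.
  by have := sq_ge0 ((w i)^-1 *: A i); have := sq_ge0 ((w i)^-1 *: B i); lra.
move=> delta t d0 d1 tE; apply: le_trans (wvar_le _ 0 w1) _.
apply: ler_sum => i _; apply: ler_wpM2l => //.
rewrite subr0 /ratio_of tE scalerDr; apply: le_trans (sqD_le2 _ _) _.
rewrite lerD2r; apply: ler_wpM2l => //.
rewrite scalerA mulrC -scalerA sqZ ler_piMl ?sq_ge0//.
by rewrite exprn_ile1.
Qed.

End InitialErrors.

Lemma step_gap_le1 {R : realType} (N L m au s phi t : R) : 0 < N -> 0 < m -> m <= L ->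
  0 < phi -> phi <= au -> 0 < t -> t <= s -> s * au * N * L ^+ 2 <= 6 / 25 * m ->
  phi * N * m * t <= 1.
Proof.
move=> N0 m0 mL phi0 hphi t0 ts h.
have L0 : 0 < L by exact: lt_le_trans mL.
rewrite -(@ler_pM2r _ (L ^+ 2)) ?exprn_gt0// mul1r.
have k : phi * t <= au * s by apply: ler_pM => //; exact: ltW.
have w : 0 <= N * m * L ^+ 2 by nonneg.
have k1 := ler_wpM2r w k; have k2 := ler_wpM2r (ltW m0) h.
have k3 : m ^+ 2 <= L ^+ 2 by rewrite ler_pXn2r// nnegrE ltW.
have := sqr_ge0 m; move: k1 k2 k3; rewrite !expr2; lra.
Qed.

Lemma shift_le {R : realType} (F F' m p q r : R) :
  F' <= F - p + q + r -> F' - m <= F - m - p + q + r.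
Proof. by lra. Qed.

Lemma transfer_le {R : realType} (U s k v W nl so D M : R) :
  0 <= U -> 0 <= k -> 0 < nl -> 0 < so -> 0 <= M ->
  s <= k * v -> v <= W / nl -> W <= D -> so * D <= M ->
  2 * U + 2 * s <= (2 + 2 * k / (nl * so)) * (U + M).
Proof.
move=> U0 k0 nl0 so0 M0 hs hv hW hD.
have v1 : v <= M / (nl * so).
  apply: le_trans hv _; rewrite ler_pdivrMr//.
  have -> : M / (nl * so) * nl = M / so by field; rewrite !gt_eqF.
  by apply: le_trans hW _; rewrite ler_pdivlMr// mulrC.
have s1 := le_trans hs (ler_wpM2l k0 v1).
have r0 : 0 <= 2 * k / (nl * so) * U by nonneg.
have -> : (2 + 2 * k / (nl * so)) * (U + M)
  = 2 * U + 2 * (k * (M / (nl * so))) + 2 * M + 2 * k / (nl * so) * U by ring.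
lra.
Qed.

Section SumBound.
Context {R : realType} {n dx dy : nat}.
Variables (P : problem R n dx dy) (N : network R n).
Hypotheses (hn : (2 <= n)%N) (hdy : (0 < dy)%N).
Hypotheses (hP : problem_assumptions P) (hN : network_assumptions N).
Variables (x0 : 'I_n -> 'rV[R]_dx) (y0 z0 : 'I_n -> 'rV[R]_dy).

(* Uniform in delta, because the initial trackers are affine in delta. *)
Lemma tracking_err_init : exists2 C, 0 <= C & forall delta : R, 0 <= delta -> delta <= 1 ->
  tracking_err N 0 (fun i => regx P delta i (x0 i) (y0 i) (z0 i))
    (fun i => regy P delta i (x0 i) (y0 i)) (fun i => regy P 0 i (x0 i) (z0 i)) <= C.
Proof.
have w0 i : 0 <= wB N 0 i by exact: le_trans (ltW (bl_gt0 hn hN)) (beta_ge hN 0 i).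
have w1 : \sum_i wB N 0 i = 1 by exact: beta_sum.
have [Cx Cx0 hx] := wvar_affine_bounded (fun i => lsubmx (gradf P i (row_mx (x0 i) (y0 i))))
  (fun i => lsubmx (gradg P i (row_mx (x0 i) (y0 i)))
    - lsubmx (gradg P i (row_mx (x0 i) (z0 i)))) w0 w1.
have [Cy Cy0 hy] := wvar_affine_bounded (fun i => rsubmx (gradf P i (row_mx (x0 i) (y0 i))))
  (fun i => rsubmx (gradg P i (row_mx (x0 i) (y0 i)))) w0 w1.
have [Cz Cz0 hz] := wvar_affine_bounded (fun i => rsubmx (gradf P i (row_mx (x0 i) (z0 i))))
  (fun i => rsubmx (gradg P i (row_mx (x0 i) (z0 i)))) w0 w1.
exists (Cx + Cy + Cz); first by rewrite !addr_ge0.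
move=> delta d0 d1; apply: lerD; first apply: lerD.
- apply: (hx delta) => // i.
  by rewrite /regx /reg scale0r add0r linearD linearZ addrA.
- by apply: (hy delta) => // i; rewrite /regy /reg linearD linearZ.
- by apply: (hz 0) => // i; rewrite /regy /reg linearD linearZ.
Qed.

Lemma gap_err_init (delta : R) : 0 <= delta -> delta <= 1 ->
  gap_err P N delta 0 x0 y0 <= 2 * gap_err P N 0 0 x0 y0 + 2 * (`|Lf0 P| / mu P) ^+ 2.
Proof.
move=> d0 d1; have n0 : (0 < n)%N by exact: ltnW.
rewrite /gap_err; move: (wmean _ y0) (wmean _ x0) => yh xh.
have -> : yh - yreg P delta xh = (yh - yreg P 0 xh) - (yreg P delta xh - yreg P 0 xh).
  by apply/rowP => j; rewrite !mxE; ring.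
apply: le_trans (sqB_le2 _ _) _; rewrite lerD2l; apply: ler_wpM2l => //.
apply: enorm_le_sq; first by rewrite divr_ge0// ltW// mu_gt0.
apply: le_trans (yreg_near n0 hdy hP xh d0) _.
by rewrite -mulrA ler_piMl// divr_ge0// ltW// mu_gt0.
Qed.

(** C' and d1 must precede K and delta, so all constants come from the data, the initial points and
    sl, sh, c3. The steps sx, sy, sz are the rescaled ones, lambda eta. *)
Lemma fab_sum_bound (sl sh c3 : R) : 0 < sl -> 0 < sh -> 0 <= c3 ->
  exists2 C', 0 < C' & exists2 d1, 0 < d1 &
  forall (K : nat) (delta sx sy sz s : R) x y z tx ty tz,
    0 < delta -> delta <= d1 -> K%:R * delta ^+ 3 <= c3 ->
    sl <= sx <= sh -> sl <= sy -> sl <= sz -> sx <= s -> sy <= s -> sz <= s ->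
    s * au N * n%:R * Lg1 P ^+ 2 <= 6 / 25 * mu P ->
    256 * lyap_T n%:R (Lg1 P) (mu P) (c_inf N) (e_inf N) (a_lb N) (al N) (au N)
      (bl N) (bu N) * n%:R ^+ 2 * s ^+ 2 <= q_inf P N / mu P ->
    (Lg1 P / mu P) ^+ 4 * (sx ^+ 2 / sy ^+ 2 + sx ^+ 2 / sz ^+ 2) <= 1 / 1536 ->
    x 0%N = x0 -> y 0%N = y0 -> z 0%N = z0 ->
    tracking N K (fun=> sx) x tx (fun k i => regx P delta i (x k i) (y k i) (z k i)) ->
    tracking N K (fun=> sy) y ty (fun k i => regy P delta i (x k i) (y k i)) ->
    tracking N K (fun=> sz) z tz (fun k i => regy P 0 i (x k i) (z k i)) ->
    \sum_(0 <= k < K) delta * sq (grad (Fstar P) (average (x k))) <= C'.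
Proof.
move=> sl0 sh0 c30; have n0 : (0 < n)%N by exact: ltnW.
have nR : 0 < n%:R :> R by rewrite ltr0n.
have m0 := mu_gt0 hP; have mL := mu_le_Lg1 n0 hdy hP; have L0 := Lg1_gt0 n0 hdy hP.
have ci0 := c_inf_gt0 hn hN; have ci1 := c_inf_le_half hn hN.
have ei0 := e_inf_gt0 hn hN; have ei1 := e_inf_le_half hn hN.
have a0 := a_lb_gt0 hN; have al0 := al_gt0 hn hN; have au0 := au_gt0 hn hN.
have bl0 := bl_gt0 hn hN; have q0 := q_inf_gt0 hn hN m0 mL.
have [CF CF0 FQ] := Fstar_quad n0 hdy hP.
have [Cb Cb0 FB] := Fstar_bias n0 hdy hP.
have [mF mFle] := Favg_bounded n0 hP.
have mFs w : mF <= Fstar P w by rewrite FstarE.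
have [S3 S30 hS3] := tracking_err_init.
pose oD := lyap_D n%:R (Lg1 P) (mu P) (c_inf N) (e_inf N) (a_lb N) (al N) (au N) (bl N).
pose oS := lyap_S n%:R (Lg1 P) (mu P) (e_inf N) (au N).
have oD0 : 0 < oD by exact: lyap_D_gt0.
have oS0 : 0 < oS by exact: lyap_S_gt0.
pose f := q_inf P N / mu P.
have f0 : 0 < f by rewrite /f; pos.
pose kk := (Lg1 P / mu P) ^+ 2.
(* theta is a contraction rate valid for all k: the three conditions give theta M <= D term by term,
   with f as lower bound of n [phik]. *)
have [theta th0 [th1 [t1 t2 t3]]] : exists2 t, 0 < t & t <= 1 /\
    [/\ t * (16 / mu P) <= 14 * f * sl,
        t * oD <= 100 * (kk * au N * Lg1 P ^+ 2 / al N) &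
        t * oS <= 10 * (kk * au N / n%:R)].
  apply: common_factor; [by nonneg|exact: ltW|exact: ltW|by pos|by rewrite /kk; pos|].
  by rewrite /kk; pos.
pose H := sh * au N * n%:R.
have H0 : 0 <= H by rewrite /H; nonneg.
(* Each later requirement on C is met by one summand; 4 CF is the constant of [sq_grad_le_gap], and
   the terms in Cb come from the penalty bias. *)
pose C := c3 + 4 * CF + 5 * H * Cb + H + 10 * H ^+ 2 * Cb.
have HCb : 0 <= H * Cb by nonneg.
have HCb2 : 0 <= H ^+ 2 * Cb by nonneg.
have [C_c3 [C_CF [C_H [C_Cb C_Cb2]]]] :
    c3 <= C /\ 4 * CF <= C /\ H <= C /\ 5 * H * Cb <= C /\ 10 * H ^+ 2 * Cb <= C.
  by rewrite /C; move: CF0 c30 H0 HCb HCb2; clear; move=> *; lra.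
have C0 : 0 <= C by exact: le_trans C_c3.
pose p3 := 2 * gap_err P N 0 0 x0 y0 + 2 * (`|Lf0 P| / mu P) ^+ 2.
pose r3 := gap_err P N 0 0 x0 z0.
pose D3 := consensus_err N 0 x0 y0 z0.
pose M0 := sh * (16 * Lg1 P ^+ 2 / mu P * ((p3 + r3) / sl) + oD * D3 + oS * S3).
pose Phi0 := Fstar P (wmean (wA N 0) x0) - mF.
have a00 : 0 < 15 / 16 * (sl * f) by pos.
have [C1 C10 seqB] := descent_sequence Phi0 a00 th0 th1 C0 (normr_ge0 M0).
pose EE := 2 + 2 * (6 * CF) ^+ 2 / (n%:R * al N * (sl * oD)).
have EE0 : 0 < EE by rewrite /EE; pos.
exists (EE * C1); first by rewrite mulr_gt0.
(* delta <= 1 / (1 + X) yields delta <= 1 and, one per summand, the three smallness conditions: on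
   delta |Lf1|, on the curvature term and on the second-order drift term. *)
pose X := 10 * (`|Lf1 P| / mu P) + 32 * CF * H + 60 * C * H.
exists (1 + X)^-1.
  by rewrite invr_gt0 ltr_pwDl// /X; nonneg.
have X0 : 0 <= X by rewrite /X; nonneg.
move=> K delta sx sy sz s x y z tx ty tz d0 dle Kd /andP[sxl sxh] syl szl sxs sys szs.
move=> hss hsg hr x00 y00 z00 Tx Ty Tz.
have sx0 : 0 < sx by exact: lt_le_trans sxl.
have sy0 : 0 < sy by exact: lt_le_trans syl.
have sz0 : 0 < sz by exact: lt_le_trans szl.
have d1 : delta <= 1 by apply: le_trans dle _; rewrite invf_le1 ?lerDl// ltr_pwDl.
have [X10 [X20 X30]] : 0 <= 10 * (`|Lf1 P| / mu P) /\ 0 <= 32 * CF * H /\ 0 <= 60 * C * H.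
  by split; [nonneg | split; nonneg].
have dm : 10 * (delta * `|Lf1 P|) <= mu P.
  have : delta * (10 * (`|Lf1 P| / mu P)) <= 1.
    by apply: (small_threshold d0 X10 _ dle); rewrite /X -addrA lerDl addr_ge0.
  have -> : delta * (10 * (`|Lf1 P| / mu P)) = 10 * (delta * `|Lf1 P|) / mu P by ring.
  by rewrite ler_pdivrMr// mul1r.
have h32 : 32 * CF * (delta * H) <= 1.
  rewrite mulrCA; apply: (small_threshold d0 X20 _ dle).
  by rewrite /X addrAC lerDr addr_ge0.
have h60 : 60 * C * (delta * H) <= 1.
  rewrite mulrCA; apply: (small_threshold d0 X30 _ dle).
  by rewrite /X lerDr addr_ge0.
pose xh k := wmean (wA N k) (x k).
pose G k := grad (Fstar P) (xh k).
pose p2 k := gap_err P N delta k (x k) (y k).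
pose r2 k := gap_err P N 0 k (x k) (z k).
pose D2 k := consensus_err N k (x k) (y k) (z k).
pose S2 k := tracking_err N k (tx k) (ty k) (tz k).
have p20 k : 0 <= p2 k by exact: sq_ge0.
have r20 k : 0 <= r2 k by exact: sq_ge0.
have wA0 k i : 0 <= wA N k i by exact: le_trans (ltW al0) (alpha_ge hN k i).
have wB0 k i : 0 <= wB N k i by exact: le_trans (ltW bl0) (beta_ge hN k i).
have D20 k : 0 <= D2 k.
  by rewrite /D2 /consensus_err; apply: addr_ge0; [apply: addr_ge0|]; exact: wvar_ge0.
have S20 k : 0 <= S2 k.
  by rewrite /S2 /tracking_err; apply: addr_ge0; [apply: addr_ge0|]; exact: wvar_ge0.
pose M k := lyap n%:R (Lg1 P) (mu P) (c_inf N) (e_inf N) (a_lb N) (al N) (au N)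
  (bl N) sx sy sz (p2 k) (r2 k) (D2 k) (S2 k).
pose D k := dissipation n%:R (Lg1 P) (mu P) (al N) (au N) sx (phik N k)
  (D2 k) (S2 k) (p2 k) (r2 k).
have M_ge0 k : 0 <= M k by exact: lyap_ge0.
pose a k := 15 / 16 * (sx * phik N k * n%:R).
pose Phi k := Fstar P (xh k) - mF.
have phi0 k : 0 < phik N k by exact: phik_gt0 hn hdy hP hN k.
have phiu k : phik N k <= au N by exact: phik_le hn hN k.
have phif k : f <= n%:R * phik N k by exact: phik_ge hn hdy hP hN k.
have sphi k : sx * phik N k * n%:R <= H.
  rewrite /H; apply: ler_wpM2r; first by nonneg.
  by apply: ler_pM => //; exact: ltW.
have DM k : D k <= M k.
  apply: (dissipation_le_lyap nR L0 m0 ci0 ci1 ei0 ei1 a0 al0 au0 bl0 sx0 sy0 sz0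
    (p20 k) (r20 k) (D20 k) (S20 k) (phi0 k)).
    exact: (step_gap_le1 nR m0 mL (phi0 k) (phiu k) sy0 sys hss).
  exact: (step_gap_le1 nR m0 mL (phi0 k) (phiu k) sz0 szs hss).
have MD k : theta * M k <= D k.
  apply: (dissipation_ge_lyap sx0 (p20 k) (r20 k) (D20 k) (S20 k) sl0 syl szl
    (ltW f0) _ t1 t2 t3).
  by rewrite mulrC; exact: phif.
have step k : exists g2, 0 <= g2 /\ ((k < K)%N ->
    let Gk := sx * Num.sqrt g2 in let u := enorm (G k) in
    [/\ M k.+1 <= M k - D k + a k / 4 * delta ^+ 2 * u ^+ 2 + C * delta ^+ 4,
      Fstar P (xh k.+1) <= Fstar P (xh k) - a k * delta * u ^+ 2 + u * Gk + C * Gk ^+ 2,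
      Gk ^+ 2 * ((2 * a k)^-1 + delta * C) <= D k / 2 + C * delta ^+ 4 &
      Gk ^+ 2 <= C * (M k + delta ^+ 4)]).
  (* The recursion is available only before the horizon; beyond it 0 is a placeholder that makes the
     sequence of drifts total. *)
  case: (ltnP k K) => [kK|]; last by exists 0.
  have [g2 [Dx2 [g20 q1 q2 q3 q4]]] := one_step hn hdy hP hN d0 dm sx0 sy0 sz0 sxs sys szs
    hss hsg hr FQ Cb0 (fun w => FB delta w d0)
    (fun i => (Tx.2 k i kK).1) (fun i => (Ty.2 k i kK).1) (fun i => (Tz.2 k i kK).1)
    (fun i => (Tx.2 k i kK).2) (fun i => (Ty.2 k i kK).2) (fun i => (Tz.2 k i kK).2)
    (tracking_conserved hN Tx (ltnW kK)) (tracking_conserved hN Ty (ltnW kK))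
    (tracking_conserved hN Tz (ltnW kK)).
  exists g2; split=> // _.
  have q3' : Dx2 <= 2 * sx ^+ 2 * (phik N k ^+ 2 * n%:R ^+ 2 * (delta ^+ 2 * enorm (G k) ^+ 2) + g2).
    by rewrite enorm_sq.
  have q1' : M k.+1 <= M k - D k + 15 / 64 * (sx * phik N k * n%:R * (delta ^+ 2 * enorm (G k) ^+ 2))
    + 2 * (sx * phik N k * n%:R * (Cb * delta ^+ 4)) by rewrite enorm_sq.
  have q4' : Fstar P (xh k.+1) <= Fstar P (xh k) - sx * phik N k * n%:R * delta * enorm (G k) ^+ 2
    + Num.sqrt (enorm (G k) ^+ 2) * (sx * Num.sqrt g2) + CF * Dx2.
    rewrite sqrtr_sqr (ger0_norm (enorm_ge0 _)) enorm_sq.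
    by have := q4; rewrite (ger0_norm (ltW CF0)).
  have sE : Num.sqrt (enorm (G k) ^+ 2) = enorm (G k).
    by rewrite sqrtr_sqr (ger0_norm (enorm_ge0 _)).
  have U0 := sqr_ge0 (enorm (G k)).
  have C_CF2 : 2 * CF <= C by apply: le_trans C_CF; apply: ler_wpM2r; [exact: ltW | rewrite ler_nat].
  have [r1 r2' r3' r4] := descent_conditions nR sx0 (phi0 k) d0 U0 g20 (ltW CF0) Cb0
    (sphi k) h32 h60 C_CF2 C_Cb C_H C_Cb2 (M_ge0 k) (DM k) q1' q2 q3' q4'.
  by rewrite sE in r2'.
have [g hg] := choice step.
have Gap0 k : 0 <= sx * Num.sqrt (g k) by rewrite mulr_ge0 ?sqrtr_ge0// ltW.
have S_le : \sum_(0 <= k < K) delta * (enorm (G k) ^+ 2 + M k) <= C1.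
  apply: (seqB K delta a Phi M D (fun k => enorm (G k)) (fun k => sx * Num.sqrt (g k))) => //.
  - exact: le_trans Kd C_c3.
  - move=> k; rewrite /a; apply/andP; split.
      apply: ler_wpM2l; first by nonneg.
      by rewrite -mulrA; apply: ler_pM; [exact: ltW | exact: ltW | exact: sxl | rewrite mulrC; exact: phif].
    apply: le_trans (le_trans (sphi k) C_H); apply: ler_piMl.
      by apply: mulr_ge0 (ltW nR); apply: mulr_ge0; exact: ltW.
    by rewrite ler_pdivrMr// mul1r ler_nat.
  - by rewrite /Phi /xh x00.
  - apply: le_trans (ler_norm M0).
    apply: (lyap_le nR L0 m0 ci0 ei0 a0 al0 au0 bl0 sx0 sy0 sz0 (p20 0%N) (r20 0%N)
      (D20 0%N) (S20 0%N) sl0 syl szl sxh).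
    + by rewrite /p2 x00 y00; apply: (gap_err_init (ltW d0) d1).
    + by rewrite /r2 x00 z00.
    + by rewrite /D2 x00 y00 z00.
    + apply: le_trans (hS3 delta (ltW d0) d1); rewrite /S2 le_eqVlt; apply/orP; left; apply/eqP.
      congr (tracking_err N 0 _ _ _); apply/funext => i.
      * by rewrite Tx.1 x00 y00 z00.
      * by rewrite Ty.1 x00 y00.
      * by rewrite Tz.1 x00 z00.
  - by move=> k; rewrite /Phi subr_ge0.
  - by move=> k kK; have [] := (hg k).2 kK.
  - by move=> k kK; have [_ h _ _] := (hg k).2 kK; exact: shift_le h.
  - by move=> k kK; have [] := (hg k).2 kK.
  - by move=> k kK; have [] := (hg k).2 kK.
  - move=> k; rewrite enorm_sq; apply: le_trans (sq_grad_le_gap CF0 FQ mFs (xh k)) _.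
    by apply: ler_wpM2r C_CF; rewrite subr_ge0.
(* grad F* is 6 CF-Lipschitz and the distance of the two means is controlled by the consensus part
   of M; hence the factor EE. *)
have near k : sq (grad (Fstar P) (average (x k))) <= EE * (enorm (G k) ^+ 2 + M k).
  have h1 := lipschitz_of_quadratic (ltW CF0) FQ (average (x k)) (xh k).
  have h2 := average_near (x k) n0 al0 (alpha_ge hN k) (alpha_sum hN k).
  have h3 := sqD_le2 (G k) (grad (Fstar P) (average (x k)) - G k).
  rewrite subrKC in h3; apply: le_trans h3 _; rewrite enorm_sq.
  have h4 : sl * oD * D2 k <= M k.
    apply: le_trans (lyap_ge_consensus (c_inf N) (a_lb N) (al N) (bl N) nR L0 m0 ei0
      au0 sx0 sy0 sz0 (D2 k) (p20 k) (r20 k) (S20 k)).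
    by do 2! (apply: ler_wpM2r; [by rewrite ?D20// ltW|]).
  have h5 : wvar (wA N k) (x k) <= D2 k.
    by rewrite /D2 /consensus_err -addrA lerDl addr_ge0//; exact: wvar_ge0.
  exact: (transfer_le (sq_ge0 _) (sqr_ge0 _) (mulr_gt0 nR al0) (mulr_gt0 sl0 oD0)
    (M_ge0 k) h1 h2 h5 h4).
apply: le_trans (ler_wpM2l (ltW EE0) S_le); rewrite mulr_sumr; apply: ler_sum => k _.
by rewrite mulrCA; apply: ler_wpM2l (near k); exact: ltW.
Qed.

End SumBound.


(** * Powers of K and the minimum over the horizon *)

Section Rates.
Context {R : realType}.

Lemma min_sum_le (K : nat) (F : nat -> R) x :
  K%:R * \big[Num.min/x]_(0 <= k < K) F k <= \sum_(0 <= k < K) F k.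
Proof.
rewrite !big_mkord; have -> : K%:R * \big[Num.min/x]_(i < K) F i
  = \sum_(j < K) \big[Num.min/x]_(i < K) F i by rewrite sumr_const card_ord mulr_natl.
by apply: ler_sum => j _; exact: (bigmin_le x j (fun i : 'I_K => F i)).
Qed.

(** The minimum runs over K - 1 indices; K <= 2 (K - 1) accounts for the factor 2, and K / p = p^2
    for the rate. *)
Lemma min_le_rate (K : nat) (p l m C c : R) : (2 <= K)%N -> 0 < p -> p ^+ 3 = K%:R ->
  0 < l -> l <= c * p -> 0 <= m -> 0 <= C -> K.-1%:R * (l^-1 * m) <= C ->
  m <= 2 * C * c * (p ^+ 2)^-1.
Proof.
move=> K2 p0 pK l0 lc m0 C0 h.
have K1 : K%:R <= 2 * K.-1%:R :> R.
  by rewrite -natrM ler_nat; case: K K2 {pK h} => [|[|K]]//= _; rewrite mul2n doubleS !ltnS -addnn leq_addr.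
have h1 : K.-1%:R * m <= C * l.
  by rewrite -ler_pdivrMr// mulrC mulrCA.
have h2 : K%:R * m <= 2 * K.-1%:R * m by apply: ler_wpM2r.
have h3 := ler_wpM2l C0 lc.
rewrite ler_pdivlMr ?exprn_gt0// -(ler_pM2r p0).
have -> : m * p ^+ 2 * p = K%:R * m by rewrite -pK; ring.
have -> : 2 * C * c * p = 2 * (C * (c * p)) by ring.
apply: le_trans h2 _; rewrite -mulrA ler_pM2l//.
exact: le_trans h1 h3.
Qed.

Lemma scaled_step_bounds (c c' p t l : R) : 0 < c -> 0 < p ->
  c * p^-1 <= t -> t <= c' * p^-1 -> c * p <= l -> l <= c' * p ->
  c ^+ 2 <= t / l^-1 <= c' ^+ 2.
Proof.
move=> c0 p0 h1 h2 h3 h4.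
have t0 : 0 < t by apply: lt_le_trans h1; pos.
have l0 : 0 < l by apply: lt_le_trans h3; pos.
have E (r : R) : r ^+ 2 = r * p^-1 * (r * p) by field; rewrite gt_eqF.
by rewrite invrK !E; apply/andP; split; apply: ler_pM => //; nonneg.
Qed.

Lemma scaled_horizon (K : nat) (c p l : R) : 0 < c -> 0 < p -> p ^+ 3 = K%:R ->
  c * p <= l -> K.-1%:R * l^-1 ^+ 3 <= c^-1 ^+ 3.
Proof.
move=> c0 p0 pK h.
have cp0 : 0 < c * p by exact: mulr_gt0.
have l0 : 0 < l by exact: lt_le_trans h.
have -> : c^-1 ^+ 3 = K%:R * (c * p)^-1 ^+ 3 by rewrite -pK; field; rewrite !gt_eqF.
apply: ler_pM => //; [by nonneg | by rewrite ler_nat leq_pred |].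
rewrite ler_pXn2r// ?nnegrE; [by rewrite lef_pV2 | by nonneg | by nonneg].
Qed.

End Rates.

Lemma tracking_prefix {R : realType} {n d : nat} (N : network R n) (K K' : nat) eta
    (xi t dir : nat -> 'I_n -> 'rV[R]_d) : (K' <= K)%N ->
  tracking N K eta xi t dir -> tracking N K' eta xi t dir.
Proof. by move=> KK [h0 hS]; split=> // k i kK; apply: hS; exact: leq_trans KK. Qed.

Section RescaledDirections.
Context {R : realType} {n dx dy : nat}.
Variables (P : problem R n dx dy).
Hypotheses (hP : problem_assumptions P).
Variables (lambda : R) (i : 'I_n) (x : 'rV[R]_dx) (y z : 'rV[R]_dy).
Hypothesis l0 : lambda != 0.

Lemma dirx_regx : lambda^-1 *: dirx P lambda i x y z = regx P lambda^-1 i x y z.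
Proof.
rewrite (dirxE hP) scalerDr scalerA mulVf// scale1r /regx /reg scale0r add0r.
by rewrite [lsubmx (_ + _)]linearD /= [lsubmx (_ *: _)]linearZ /= addrA.
Qed.

Lemma diry_regy : lambda^-1 *: diry P lambda i x y z = regy P lambda^-1 i x y.
Proof.
rewrite (diryE hP) scalerDr scalerA mulVf// scale1r /regy /reg.
by rewrite [rsubmx (_ + _)]linearD /= [rsubmx (_ *: _)]linearZ.
Qed.

Lemma dirz_regy : lambda^-1 *: dirz P lambda i x y z = regy P 0 i x z.
Proof. by rewrite (dirzE hP) /regy /reg scale0r add0r scalerA mulVf// scale1r. Qed.

End RescaledDirections.

Lemma admissible_bounds {R : realType} {n dx dy : nat} (P : problem R n dx dy)
    (N : network R n) (etax etay etaz lambda : R) :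
  (2 <= n)%N -> (0 < dy)%N -> problem_assumptions P -> network_assumptions N ->
  admissible P N etax etay etaz lambda ->
  let s := lambda * Num.max etax (Num.max etay etaz) in
  s * au N * n%:R * Lg1 P ^+ 2 <= 6 / 25 * mu P /\
  256 * lyap_T n%:R (Lg1 P) (mu P) (c_inf N) (e_inf N) (a_lb N) (al N) (au N)
      (bl N) (bu N) * n%:R ^+ 2 * s ^+ 2 <= q_inf P N / mu P /\
  (Lg1 P / mu P) ^+ 4 * ((etax / lambda^-1) ^+ 2 / (etay / lambda^-1) ^+ 2
    + (etax / lambda^-1) ^+ 2 / (etaz / lambda^-1) ^+ 2) <= 1 / 1536.
Proof.
move=> hn hdy hP hN [[ex0 ey0 ez0 l0] _ _ hl ry_le _ rz_le _] s.
have n0 : (0 < n)%N by exact: ltnW.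
have n2 : 2 <= n%:R :> R by rewrite ler_nat.
have m0 := mu_gt0 hP; have mL := mu_le_Lg1 n0 hdy hP; have L0 := Lg1_gt0 n0 hdy hP.
have one (r : R) : r <= 1 / 2 -> r <= 1 by move=> h; apply: le_trans h _; lra.
have ci0 := c_inf_gt0 hn hN; have ci1 := one _ (c_inf_le_half hn hN).
have ei0 := e_inf_gt0 hn hN.
have a0 := a_lb_gt0 hN; have A0 := alpha_lo_gt0 hN; have Aa := alpha_lo_le_a hn hN.
have A1 := alpha_lo_le1 hn hN; have B0 := beta_lo_gt0 hN; have B1 := beta_lo_le hn hN.
have U1 := alpha_up_ge1 hn hN; have V1 := beta_up_ge1 hn hN.
have q0 := q_inf_gt0 hn hN m0 mL; have qm := q_inf_le_mu hn hN m0 mL.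
have g2 := gamma_sup_ge hn hN.
have s0 : 0 < s by rewrite /s mulr_gt0// lt_max ex0.
have tl (t : R) : 0 < t -> 0 < t / lambda^-1 by move=> t0; rewrite invrK mulr_gt0.
have rE (t t' : R) : t' != 0 -> (t / lambda^-1) / (t' / lambda^-1) = t / t'.
  by move=> t0; rewrite !invrK; field; rewrite t0 gt_eqF.
case/and5P: hl => _ _ _ h4 /and4P[_ _ h7 /andP[h8 _]].
split; [|split].
- exact: (admissible_step_small n2 L0 m0 ci0 ci1 ei0 A0 A1 B0 B1 U1 V1 q0 qm g2 s0 h4 h8).
- exact: (admissible_small_gain n2 L0 m0 ci0 ci1 ei0 a0 A0 Aa A1 B0 B1 U1 V1 q0 qm g2
    s0 h4 h7 h8).
- apply: (admissible_ratio n2 L0 m0 A0 B0 B1 U1 V1 q0 qm (tl _ ex0) (tl _ ey0) (tl _ ez0)).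
    by rewrite rE ?gt_eqF//; exact: ry_le.
  by rewrite rE ?gt_eqF//; exact: rz_le.
Qed.

Theorem theorem3p4 (R : realType) (n dx dy : nat)
    (hn : (2 <= n)%N) (hdx : (0 < dx)%N) (hdy : (0 < dy)%N)
    (P : problem R n dx dy) (hP : problem_assumptions P)
    (N : network R n) (hN : network_assumptions N)
    (x0 : 'I_n -> 'rV[R]_dx) (y0 z0 : 'I_n -> 'rV[R]_dy)
    (c1 c2 : R) (hc1 : 0 < c1) (hc12 : c1 <= c2) :
  exists2 C : R, 0 < C &
    forall (K : nat) (etax etay etaz lambda : R),
      (2 <= K)%N ->
      admissible P N etax etay etaz lambda ->
      c1 * K%:R `^ (- (1 / 3)) <= etax <= c2 * K%:R `^ (- (1 / 3)) ->
      c1 * K%:R `^ (- (1 / 3)) <= etay <= c2 * K%:R `^ (- (1 / 3)) ->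
      c1 * K%:R `^ (- (1 / 3)) <= etaz <= c2 * K%:R `^ (- (1 / 3)) ->
      c1 * K%:R `^ (1 / 3) <= lambda <= c2 * K%:R `^ (1 / 3) ->
      forall (x : nat -> 'I_n -> 'rV[R]_dx) (y z : nat -> 'I_n -> 'rV[R]_dy)
        (tx : nat -> 'I_n -> 'rV[R]_dx) (ty tz : nat -> 'I_n -> 'rV[R]_dy),
        x 0%N = x0 -> y 0%N = y0 -> z 0%N = z0 ->
        FAB P N K lambda (fun=> etax) (fun=> etay) (fun=> etaz)
          x y z tx ty tz ->
        \big[Num.min/enorm (grad (Fstar P) (average (x 0%N))) ^+ 2]_(0 <= k < K.-1)
            enorm (grad (Fstar P) (average (x k))) ^+ 2
          <= C * (a_lb N * b_lb N) ^- n * K%:R `^ (- (2 / 3)).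
Proof.
have c20 : 0 < c2 by exact: lt_le_trans hc12.
have n0 : (0 < n)%N by exact: ltnW.
have i0 : 0 <= c1^-1 ^+ 3 by nonneg.
have [C' C'0 [d1 d10 sumB]] := fab_sum_bound hn hdy hP hN x0 y0 z0
  (exprn_gt0 2 hc1) (exprn_gt0 2 c20) i0.
pose E0 := enorm (grad (Fstar P) (average x0)) ^+ 2.
have E00 : 0 <= E0 by exact: sqr_ge0.
have T1 : 0 <= 2 * C' * c2 by nonneg.
have T2 : 0 <= E0 / (c1 * d1) ^+ 2 by nonneg.
(* The first summand serves small delta, the second the remaining K, which are bounded; 1 ensures
   positivity. *)
exists (2 * C' * c2 + E0 / (c1 * d1) ^+ 2 + 1); first by apply: ltr_wpDl; [nonneg | ].
move=> K etax etay etaz lambda K2 adm.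
pose p : R := K%:R `^ (1 / 3).
have KR : 0 < K%:R :> R by rewrite ltr0n; exact: ltnW.
have p0 : 0 < p by exact: powR_gt0.
have pK : p ^+ 3 = K%:R.
  rewrite -powR_mulrn ?(ltW p0)// -powRrM; have -> : 1 / 3 * 3 = 1 :> R by field.
  by rewrite powRr1// ltW.
have p2E : K%:R `^ (- (2 / 3)) = (p ^+ 2)^-1.
  rewrite powRN -powR_mulrn ?(ltW p0)// -powRrM.
  by congr (_ `^ _)^-1; field.
rewrite p2E powRN -/p => /andP[xl xu] /andP[yl yu] /andP[zl zu] /andP[ll lu].
move=> x y z tx ty tz x00 y00 z00 [Tx Ty Tz].
set m := \big[_/_]_(_ <= _ < _) _.
have m_ge0 : 0 <= m by apply: le_bigmin => [|k _]; exact: sqr_ge0.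
(* a b <= 1, hence (a b)^-n >= 1 and the bound without this factor is stronger. *)
suff : m <= (2 * C' * c2 + E0 / (c1 * d1) ^+ 2 + 1) * (p ^+ 2)^-1.
  move=> h; apply: le_trans h _; apply: ler_wpM2r; first by nonneg.
  apply: ler_peMr; first by nonneg.
  rewrite invf_ge1 ?exprn_gt0 ?mulr_gt0 ?a_lb_gt0 ?b_lb_gt0//.
  have a1 := a_lb_le1 hn hN; have b1 := b_lb_le_half hn hN.
  have ab0 : 0 <= a_lb N * b_lb N by rewrite mulr_ge0// ltW ?a_lb_gt0 ?b_lb_gt0.
  apply: exprn_ile1 => //; rewrite -[leRHS]mulr1; apply: ler_pM => //.
  - exact/ltW/a_lb_gt0.
  - exact/ltW/b_lb_gt0.
  - by apply: le_trans b1 _; rewrite ler_pdivrMr// mul1r ler1n.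
have ip0 : 0 <= (p ^+ 2)^-1 by nonneg.
(* If 1 / lambda exceeds d1, then c1 p <= lambda < 1 / d1 bounds K, and the default value of the
   minimum, the gradient at the initial average, is estimated by E0 / (c1 d1 p)^2. *)
case: (lerP lambda^-1 d1) => [ld|dl]; last first.
  have m_le : m <= E0 by rewrite /E0 -x00; exact: bigmin_le_id.
  apply: le_trans m_le _.
  have q0 : 0 < c1 * d1 by exact: mulr_gt0.
  have hp : c1 * d1 * p <= 1.
    apply: le_trans (_ : lambda * d1 <= _).
      by rewrite mulrAC; apply: ler_wpM2r ll; exact: ltW.
    have l0 : 0 < lambda by apply: lt_le_trans ll; exact: mulr_gt0.
    by rewrite -ler_pdivlMl// mulr1; exact: ltW.
  have k1 : E0 <= E0 / (c1 * d1) ^+ 2 * (p ^+ 2)^-1.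
    rewrite -mulrA; apply: ler_peMr => //; rewrite -invfM -exprMn invf_ge1 ?exprn_gt0 ?mulr_gt0//.
    by apply: exprn_ile1 => //; nonneg.
  apply: le_trans k1 _; apply: ler_wpM2r => //.
  by rewrite addrAC lerDr addr_ge0.
have l0 : 0 < lambda by apply: lt_le_trans ll; exact: mulr_gt0.
have id0 : 0 < lambda^-1 by rewrite invr_gt0.
have lN : lambda != 0 by rewrite gt_eqF.
have iN : lambda^-1 != 0 by rewrite gt_eqF.
pose s := lambda * Num.max etax (Num.max etay etaz).
have bx := scaled_step_bounds hc1 p0 xl xu ll lu.
have /andP[by_ _] := scaled_step_bounds hc1 p0 yl yu ll lu.
have /andP[bz _] := scaled_step_bounds hc1 p0 zl zu ll lu.
have sx : etax / lambda^-1 <= s.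
  by rewrite invrK mulrC /s; apply: ler_wpM2l; [exact: ltW | rewrite le_max lexx].
have sy : etay / lambda^-1 <= s.
  by rewrite invrK mulrC /s; apply: ler_wpM2l; [exact: ltW | rewrite !le_max lexx orbT].
have sz : etaz / lambda^-1 <= s.
  by rewrite invrK mulrC /s; apply: ler_wpM2l; [exact: ltW | rewrite !le_max lexx !orbT].
have [hs1 [hs2 hs3]] : s * au N * n%:R * Lg1 P ^+ 2 <= 6 / 25 * mu P /\
  256 * lyap_T n%:R (Lg1 P) (mu P) (c_inf N) (e_inf N) (a_lb N) (al N) (au N)
      (bl N) (bu N) * n%:R ^+ 2 * s ^+ 2 <= q_inf P N / mu P /\
  (Lg1 P / mu P) ^+ 4 * ((etax / lambda^-1) ^+ 2 / (etay / lambda^-1) ^+ 2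
    + (etax / lambda^-1) ^+ 2 / (etaz / lambda^-1) ^+ 2) <= 1 / 1536.
  exact: admissible_bounds hn hdy hP hN adm.
(* The minimum involves the iterates k < K - 1, so the run is cut to K - 1 steps before the sum is
   bounded. *)
have KK : (K.-1 <= K)%N by exact: leq_pred.
have S := sumB _ _ _ _ _ s x y z _ _ _ id0 ld (scaled_horizon hc1 p0 pK ll) bx by_ bz
  sx sy sz hs1 hs2 hs3 x00 y00 z00
  (tracking_prefix KK (tracking_rescale iN (fun k i => dirx_regx hP i _ _ _ lN) Tx))
  (tracking_prefix KK (tracking_rescale iN (fun k i => diry_regy hP i _ _ _ lN) Ty))
  (tracking_prefix KK (tracking_rescale iN (fun k i => dirz_regy hP i _ _ _ lN) Tz)).
have hm : K.-1%:R * (lambda^-1 * m) <= C'.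
  apply: le_trans S; rewrite -mulr_sumr mulrCA; apply: ler_wpM2l; first exact: ltW.
  apply: le_trans (min_sum_le _ _ _) _.
  by apply: ler_sum => k _; rewrite enorm_sq.
apply: le_trans (min_le_rate K2 p0 pK l0 lu m_ge0 (ltW C'0) hm) _.
by apply: ler_wpM2r => //; rewrite -addrA lerDl addr_ge0.
Qed.
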